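(* Let $d,\nu\in\mathbb R$ and let $\widetilde k(x',x_n,\xi';\mu)$ be a smooth function of $(x',x_n,\xi',\mu)\in\mathbb R^{n-1}\times\mathbb R_+\times\mathbb R^{n-1}\times\overline{\mathbb R}_+$. Then $\widetilde k$ is a weakly parameter-dependent Poisson symbol-kernel of order $d+\frac12$ and regularity $\nu$ if, and only if, there exist $$\widetilde{\mathfrak k}_1(x',\xi',\mu;x_n)\in\widetilde{\mathfrak S}^{d,\nu}_{1,0}(\mathbb R^{n-1}\times\overline{\mathbb R}_+;\mathscr S^0(\mathbb R_+)),\qquad \widetilde{\mathfrak k}_2(x',\xi',\mu;x_n)\in\widetilde{\mathfrak S}^{d,\nu}_{1,0}(\mathbb R^{n-1}\times\overline{\mathbb R}_+;H^\infty(\mathbb R_+))$$ such that $$\widetilde k(x',x_n,\xi';\mu)=\langle\xi'\rangle^{1/2}\,\widetilde{\mathfrak k}_1(x',\xi',\mu;\langle\xi'\rangle x_n)=\langle\xi',\mu\rangle^{1/2}\,\widetilde{\mathfrak k}_2(x',\xi',\mu;\langle\xi',\mu\rangle x_n).$$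
   Context: Notation: $\langle x\rangle=(1+|x|^2)^{1/2}$, $\langle x,y\rangle=(1+|x|^2+|y|^2)^{1/2}$; $D=-i\partial$; $\mathbb R_+=(0,\infty)$, $\overline{\mathbb R}_+=[0,\infty)$; $r_+=[r]_+=\max\{0,r\}$; $f\preceq g$ means $f\le Cg$ on the whole common domain for some constant $C\ge0$. Weakly parameter-dependent Poisson symbol-kernel of order $d+\frac12$ and regularity $\nu$: a smooth function $\widetilde k(x',x_n,\xi';\mu)$ such that, for all multi-indices $\alpha,\beta\in\mathbb N_0^{n-1}$ and all $j,\ell,\ell'\in\mathbb N_0$, uniformly in $(x',\xi',\mu)\in\mathbb R^{n-1}\times\mathbb R^{n-1}\times\overline{\mathbb R}_+$, $$\|D^\beta_{x'}D^\alpha_{\xi'}D^j_\mu x_n^\ell D_{x_n}^{\ell'}\widetilde k\|_{L^2(\mathbb R_{+,x_n})}\preceq\Big(\frac{\langle\xi'\rangle}{\langle\xi',\mu\rangle}\Big)^{\nu-[\ell-\ell']_+-|\alpha|}\langle\xi',\mu\rangle^{d-\ell+\ell'-|\alpha|-j}.$$ For a Fréchet space $E$, $\widetilde{\mathfrak S}^{d,\nu}_{1,0}(\mathbb R^{n-1}\times\overline{\mathbb R}_+;E)$ consists of all smooth $E$-valued functions $\mathfrak a(x',\xi';\mu)$ on $\mathbb R^{n-1}\times\mathbb R^{n-1}\times\overline{\mathbb R}_+$ with $$p\big(D^\beta_{x'}D^\alpha_{\xi'}D^j_\mu\mathfrak a(x',\xi';\mu)\big)\preceq\langle\xi'\rangle^{\nu-|\alpha|}\langle\xi',\mu\rangle^{d-\nu-j}$$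 for every continuous semi-norm $p$ of $E$ and all $\alpha,\beta,j$. A function $\mathfrak a$ with values in a space of functions on $\mathbb R_+$ is written $\mathfrak a(x',\xi',\mu;x_n)$. $H^\infty(\mathbb R_+)$ is the Fréchet space of all $v$ with $\|D_t^{\ell'}v\|_{L^2(\mathbb R_+)}<\infty$ for all $\ell'\in\mathbb N_0$ (with these semi-norms). $\mathscr S^0(\mathbb R_+)$ is the Fréchet space of all $u$ with $\|t^\ell D_t^{\ell'}u\|_{L^2(\mathbb R_+)}<\infty$ for all integers $\ell\ge\ell'\ge0$ (with these semi-norms). *)

(* Defs.v *)
From HB Require Import structures.
From mathcomp Require Import all_boot all_order all_algebra.
From mathcomp Require Import all_classical all_reals all_analysis.
From mathcomp Require Import complex.

Set Implicit Arguments.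
Unset Strict Implicit.
Unset Printing Implicit Defensive.

Import Order.TTheory GRing.Theory Num.Theory.
Import numFieldNormedType.Exports.

Local Open Scope classical_set_scope.
Local Open Scope ring_scope.
Local Open Scope complex_scope.

(* A complex locally convex space presented by a countable family of
   semi-norms.  [elt] is the set of elements inside an ambient vector space;
   on the ambient space the semi-norms may take the value +oo. *)
Record lcs (R : realType) := Lcs {
  vect : lmodType R[i];
  elt : set vect;
  sn_idx : countType;
  sn : sn_idx -> vect -> \bar R }.

Definition cvg_lcs (R : realType) (E : lcs R) (T : Type)
    (f : T -> vect E) (F : set_system T) (l : vect E) : Prop :=
  forall i, sn (l := E) i (f x - l) @[x --> F] --> (0 : \bar R)%E.

Definition seminorm_on (R : realType) (E : lcs R) (p : vect E -> R) : Prop :=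
  (forall u v, elt u -> elt v -> p (u + v) <= p u + p v) /\
  (forall (c : R[i]) u, elt u -> p (c *: u) = Normc.normc c * p u).

(* Continuity in the topology generated by the family [sn]. *)
Definition continuous_on_lcs (R : realType) (E : lcs R) (p : vect E -> R)
    : Prop :=
  forall u, elt u -> forall e : R, 0 < e ->
    exists (s : seq (sn_idx E)) (r : R), 0 < r /\
      forall v, elt v -> (forall i, i \in s -> (sn i (v - u)%R < r%:E)%E) ->
        `|p v - p u| < e.

(* Smooth vector-valued functions on a subset Om of a normed space W, with
   derivatives taken along Om; at boundary points of Om they are one-sided. *)
Section smooth.
Variables (R : realType) (E : lcs R) (W : normedModType R) (Om : set W).

Definition continuous_along (a : W -> vect E) : Prop :=
  forall p, Om p -> cvg_lcs a (within Om (nbhs p)) (a p).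

(* b is D_v a = -i d_v a on Om. *)
Definition is_D (v : W) (a b : W -> vect E) : Prop :=
  forall p, Om p ->
    cvg_lcs (fun h : R => (- 'i * (h^-1)%:C) *: (a (p + h *: v) - a p))
      (within [set h : R | Om (p + h *: v)] 0^') (b p).

(* A al is D^al a, for multi-indices al relative to the coordinate
   directions e; partial derivatives of smooth functions commute, so
   multi-indices suffice to index them. *)
Definition D_family (I : finType) (e : I -> W) (a : W -> vect E)
    (A : {ffun I -> nat} -> W -> vect E) : Prop :=
  (forall p, Om p -> A [ffun=> 0%N] p = a p) /\
  forall al : {ffun I -> nat},
    [/\ forall p, Om p -> elt (A al p),
        continuous_along (A al) &
        forall i, is_D (e i) (A al) (A [ffun k => (al k + (k == i))%N])].

Definition smooth (I : finType) (e : I -> W) (a : W -> vect E) : Prop :=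
  exists A, D_family e a A.

End smooth.

Definition complex_lcs (R : realType) : lcs R :=
  @Lcs R (R[i]^o : lmodType R[i]) setT unit (fun _ z => (Normc.normc z)%:E).

Definition msize (m : nat) (al : {ffun 'I_m -> nat}) : nat :=
  (\sum_(i < m) al i)%N.

(* Variables (x', xi', mu) of symbols. *)
Definition pvar (R : realType) (m : nat) : normedModType R :=
  ('rV[R]_m * 'rV[R]_m * R^o)%type.

Definition pdom (R : realType) (m : nat) : set (pvar R m) :=
  [set p | 0 <= p.2].

Definition pcoord (m : nat) : finType := ('I_m + 'I_m + unit)%type.

Definition pdir (R : realType) (m : nat) (i : pcoord m) : pvar R m :=
  match i with
  | inl (inl i) => (delta_mx 0 i, 0, 0)
  | inl (inr i) => (0, delta_mx 0 i, 0)
  | inr _ => (0, 0, 1)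
  end.

Definition pidx (m : nat) (be al : {ffun 'I_m -> nat}) (j : nat)
    : {ffun pcoord m -> nat} :=
  [ffun i : pcoord m => match i with
    | inl (inl i) => be i | inl (inr i) => al i | inr _ => j end].

(* Variables (x', x_n, xi', mu) of symbol-kernels. *)
Definition kvar (R : realType) (m : nat) : normedModType R :=
  ('rV[R]_m * R^o * 'rV[R]_m * R^o)%type.

Definition kdom (R : realType) (m : nat) : set (kvar R m) :=
  [set p | 0 < p.1.1.2 /\ 0 <= p.2].

Definition kcoord (m : nat) : finType := ('I_m + unit + 'I_m + unit)%type.

Definition kdir (R : realType) (m : nat) (i : kcoord m) : kvar R m :=
  match i with
  | inl (inl (inl i)) => (delta_mx 0 i, 0, 0, 0)
  | inl (inl (inr _)) => (0, 1, 0, 0)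
  | inl (inr i) => (0, 0, delta_mx 0 i, 0)
  | inr _ => (0, 0, 0, 1)
  end.

Definition kidx (m : nat) (be : {ffun 'I_m -> nat}) (l : nat)
    (al : {ffun 'I_m -> nat}) (j : nat) : {ffun kcoord m -> nat} :=
  [ffun i : kcoord m => match i with
    | inl (inl (inl i)) => be i | inl (inl (inr _)) => l
    | inl (inr i) => al i | inr _ => j end].

Section kernels.
Variable R : realType.

(* |x| is the Euclidean norm; the library norm of 'rV is the sup norm. *)
Definition jap (m : nat) (xi : 'rV[R]_m) : R :=
  Num.sqrt (1 + \sum_(i < m) xi 0 i ^+ 2).

Definition jap2 (m : nat) (xi : 'rV[R]_m) (mu : R) : R :=
  Num.sqrt (1 + \sum_(i < m) xi 0 i ^+ 2 + mu ^+ 2).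

Definition L2norm (f : R -> R[i]) : \bar R :=
  'N[@lebesgue_measure R]_(2%:E)
    [(fun t => (Normc.normc (f t))%:E) \_ [set t : R | 0 < t]].

Definition poisson_symbol_kernel (m : nat) (order nu : R)
    (k : kvar R m -> R[i]) : Prop :=
  let d := order - 2^-1 in
  exists K : {ffun kcoord m -> nat} -> kvar R m -> R[i],
    D_family (E := complex_lcs R) (@kdom R m) (@kdir R m) k K /\
    forall (be al : {ffun 'I_m -> nat}) (j l l' : nat),
      exists2 C : R, 0 <= C &
      forall (x xi : 'rV[R]_m) (mu : R), 0 <= mu ->
        let rhs : R :=
          (jap xi / jap2 xi mu)
            `^ (nu - Num.max 0 (l%:R - l'%:R) - (msize al)%:R)
          * jap2 xi mu `^ (d - l%:R + l'%:R - (msize al)%:R - j%:R) in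
        (L2norm (fun xn =>
           ((xn ^+ l)%:C * K (kidx be l' al j) (x, xn, xi, mu))%R)
         <= (C * rhs)%:E)%E.

Definition symbol (m : nat) (d nu : R) (E : lcs R) (a : pvar R m -> vect E)
    : Prop :=
  exists A : {ffun pcoord m -> nat} -> pvar R m -> vect E,
    D_family (@pdom R m) (@pdir R m) a A /\
    forall p : vect E -> R, seminorm_on p -> continuous_on_lcs p ->
    forall (be al : {ffun 'I_m -> nat}) (j : nat),
      exists2 C : R, 0 <= C &
      forall (x xi : 'rV[R]_m) (mu : R), 0 <= mu ->
        p (A (pidx be al j) (x, xi, mu))
        <= C * (jap xi `^ (nu - (msize al)%:R)
                * jap2 xi mu `^ (d - nu - j%:R)).

(* Functions on (0, +oo) are represented by total functions whose values
   outside (0, +oo) play no role. *)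

Definition smooth_Rplus (u : R -> R[i]) : Prop :=
  forall (l : nat) (t : R), 0 < t ->
    derivable (derive1n l (fun s : R => complex.Re (u s) : R^o)) t 1 /\
    derivable (derive1n l (fun s : R => complex.Im (u s) : R^o)) t 1.

Definition Dt (l : nat) (u : R -> R[i]) (t : R) : R[i] :=
  (- 'i) ^+ l * (derive1n l (fun s : R => complex.Re (u s) : R^o) t
                 +i* derive1n l (fun s : R => complex.Im (u s) : R^o) t).

(* In the two spaces below, a function all of whose distributional
   derivatives are locally L^2 on (0, +oo) is identified with its smooth
   representative. *)

Definition Hinfty_sn (l' : nat) (v : R -> R[i]) : \bar R := L2norm (Dt l' v).

Definition Hinfty : lcs R :=
  @Lcs R ((R -> R[i]^o) : lmodType R[i])
    [set v | smooth_Rplus v /\ forall l', (Hinfty_sn l' v < +oo)%E]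
    nat Hinfty_sn.

Definition S0_idx : countType := {q : nat * nat | (q.2 <= q.1)%N}.

Definition S0_sn (q : S0_idx) (u : R -> R[i]) : \bar R :=
  L2norm (fun t => (t ^+ (val q).1)%:C * Dt (val q).2 u t).

Definition S0 : lcs R :=
  @Lcs R ((R -> R[i]^o) : lmodType R[i])
    [set u | smooth_Rplus u /\ forall q, (S0_sn q u < +oo)%E]
    S0_idx S0_sn.

End kernels.

(* Main.v *)
(** Write <.> for <xi'> or <xi',mu>. The unitary dilation x_n -> x_n / <.> in
    L^2 multiplies the norm of x_n^l D_(x_n)^l' k by <.>^(l-l'). With w =
    <xi'>^(nu-|alpha|) <xi',mu>^(d-nu-j), the weight of a Poisson symbol-kernel
    is w <xi'>^-(l-l') for l >= l' and w <xi',mu>^-(l-l') for l <= l'. Hence the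
    dilation by <xi'> makes the first half of the estimates equal to those of an
    S^0-valued symbol; the dilation by <xi',mu> makes the second half those of a
    symbol with the norms of t^l D_t^l', l <= l', of which l = 0 gives H^infty
    and the others follow by interpolation with the diagonal l = l'.

    That a dilation preserves these classes follows by induction on the number
    of derivatives: an xi'- or mu-derivative only brings in x_n D_(x_n) and the
    logarithmic derivatives of <.>. The passage between scalar derivatives and
    derivatives of function-valued symbols uses the mean value inequality and
    Taylor's formula in L^2, the L^2 bounds being locally uniform in the
    parameters. *)

Require Import Defs.
From mathcomp Require Import all_boot all_order all_algebra.
From mathcomp Require Import all_classical all_reals all_analysis.
From mathcomp Require Import measurable_realfun.
From mathcomp Require Import complex.
From mathcomp Require Import ring lra.

Set Implicit Arguments.
Unset Strict Implicit.
Unset Printing Implicit Defensive.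
Import Order.TTheory GRing.Theory Num.Theory.
Import numFieldNormedType.Exports.
Local Open Scope classical_set_scope.
Local Open Scope ring_scope.
Local Open Scope complex_scope.

(** * Complex derivatives along a set *)

(** Smoothness is given by a family of derivatives on a set with boundary mu = 0, in a scalar or a
    function-valued sense, with an estimate for each member. To carry both through products and
    dilations, every derivative gets a grade and differentiability up to order N is defined
    recursively ([CN]): the Leibniz and chain rules preserve a class as soon as each term of the
    first derivative has the right grade. The way back to a family needs a choice of derivatives,
    their uniqueness also at the boundary, where only one-sided steps exist, and the symmetry of
    second derivatives.

    The mean value inequality in L^2 is obtained without integrating in the parameter: Riemann sums
    of the derivative obey the bound by the triangle inequality and converge pointwise in x_n, and
    Fatou's lemma passes to the limit. Fatou's lemma also identifies the derivatives of a
    function-valued symbol with the pointwise ones.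

    The diagonal l = l', about which the H^infty norms say nothing, is taken from the S^0-valued
    symbol: there the weight of the surplus factors x_n has exponent 0, so that both dilations give
    the same estimate. *)

Section complex_limits.
Variable R : realType.
Implicit Types (z : R[i]) (T : Type).
Local Notation normc := Normc.normc.
Local Notation Re := complex.Re.
Local Notation Im := complex.Im.

Lemma normCE z : `|z| = (normc z)%:C.
Proof. by case: z. Qed.

Lemma normc_ge0 z : 0 <= normc z.
Proof. by rewrite -lecR -normCE normr_ge0. Qed.

Lemma normcB z1 z2 : normc (z1 - z2) = normc (z2 - z1).
Proof. by rewrite -opprB normcN. Qed.

Lemma normc_Re z : `|Re z| <= normc z.
Proof. by have := normc_ge_Re z; rewrite normCE lecR. Qed.

Lemma normc_Im z : `|Im z| <= normc z.
Proof.
case: z => a b /=; rewrite -sqrtr_sqr ler_sqrt ?addr_ge0 ?sqr_ge0//.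
by rewrite lerDr sqr_ge0.
Qed.

Lemma normc_real (r : R) : normc r%:C = `|r|.
Proof. by rewrite /= expr0n/= addr0 sqrtr_sqr. Qed.

Lemma le_normc_ReIm z : normc z <= `|Re z| + `|Im z|.
Proof.
rewrite {1}(complexE z); apply: (le_trans (le_normcD _ _)).
by rewrite Normc.normcM !normc_real /= expr0n/= expr1n add0r sqrtr1 mul1r.
Qed.

Lemma Re_sub z1 z2 : Re (z1 - z2) = Re z1 - Re z2.
Proof. by case: z1 z2 => ? ? [? ?]. Qed.

Lemma Im_sub z1 z2 : Im (z1 - z2) = Im z1 - Im z2.
Proof. by case: z1 z2 => ? ? [? ?]. Qed.

Lemma Re_mul z1 z2 : Re (z1 * z2) = Re z1 * Re z2 - Im z1 * Im z2.
Proof. by case: z1 z2 => ? ? [? ?]. Qed.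

Lemma Im_mul z1 z2 : Im (z1 * z2) = Re z1 * Im z2 + Im z1 * Re z2.
Proof. by case: z1 z2 => ? ? [? ?]. Qed.

Section filter.
Context {T : Type} {F : set_system T} {FF : Filter F}.
Local Notation cvgC f l := (cvg_lcs (E := complex_lcs R) f F l).
Implicit Types f g : T -> R[i].

Lemma cvg_lcs_near f l :
  cvgC f l <-> forall e, 0 < e -> \forall x \near F, normc (f x - l) < e.
Proof.
split.
- move=> /(_ tt) /= /fine_cvgP [_ /cvgrPdist_lt H] e e0.
  have := H e e0; apply: filterS => x /=.
  by rewrite sub0r normrN ger0_norm ?normc_ge0.
- move=> H [] /=; apply/fine_cvgP; split; first by near=> x.
  apply/cvgrPdist_lt => e e0.
  have := H e e0; apply: filterS => x /=.
  by rewrite sub0r normrN ger0_norm ?normc_ge0.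
Unshelve. all: by end_near. Qed.

Lemma cvg_lcsP f l : cvgC f l <->
  (Re (f x) @[x --> F] --> Re l /\ Im (f x) @[x --> F] --> Im l).
Proof.
rewrite cvg_lcs_near; split.
- move=> H; split; apply/cvgrPdist_lt => e e0; have := H e e0;
  apply: filterS => x /=; rewrite normcB; apply: le_lt_trans.
  + by rewrite -Re_sub normc_Re.
  + by rewrite -Im_sub normc_Im.
- move=> [/cvgrPdist_lt H1 /cvgrPdist_lt H2] e e0.
  have e2 : 0 < e / 2 by rewrite divr_gt0.
  near=> x; rewrite normcB; apply: le_lt_trans (le_normc_ReIm _) _.
  rewrite Re_sub Im_sub (splitr e); apply: ltrD.
    by near: x; exact: H1.
  by near: x; exact: H2.
Unshelve. all: by end_near. Qed.

Lemma cvg_lcs_cst (c : R[i]) : cvgC (fun=> c) c.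
Proof. by apply/cvg_lcsP; split; exact: cvg_cst. Qed.

Lemma cvg_lcsD f g l m : cvgC f l -> cvgC g m ->
  cvgC (fun x => f x + g x) (l + m).
Proof.
have E1 a b : Re (a + b) = Re a + Re b by case: a b => ? ? [? ?].
have E2 a b : Im (a + b) = Im a + Im b by case: a b => ? ? [? ?].
move=> /cvg_lcsP[f1 f2] /cvg_lcsP[g1 g2]; apply/cvg_lcsP; split.
- by under eq_fun do rewrite E1; rewrite E1; exact: cvgD.
- by under eq_fun do rewrite E2; rewrite E2; exact: cvgD.
Qed.

Lemma cvg_lcsM f g l m : cvgC f l -> cvgC g m ->
  cvgC (fun x => f x * g x) (l * m).
Proof.
move=> /cvg_lcsP[f1 f2] /cvg_lcsP[g1 g2]; apply/cvg_lcsP; split.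
- under eq_fun do rewrite Re_mul; rewrite Re_mul.
  by apply: cvgB; exact: cvgM.
- under eq_fun do rewrite Im_mul; rewrite Im_mul.
  by apply: cvgD; exact: cvgM.
Qed.

Lemma cvg_lcsRC (f : T -> R) (l : R) : f x @[x --> F] --> l ->
  cvgC (fun x => (f x)%:C) l%:C.
Proof. by move=> H; apply/cvg_lcsP; split => //=; exact: cvg_cst. Qed.

Lemma cvg_lcs_unique f l m {PF : ProperFilter F} :
  cvgC f l -> cvgC f m -> l = m.
Proof.
move=> /cvg_lcsP[f1 f2] /cvg_lcsP[g1 g2]; apply/eqP; rewrite eq_complex.
by apply/andP; split; apply/eqP;
  [exact: (cvg_unique _ f1 g1)|exact: (cvg_unique _ f2 g2)].
Qed.

End filter.

Lemma cvg_lcs_eq (T : Type) (F : set_system T) (f g : T -> R[i]) l :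
  f =1 g -> cvg_lcs (E := complex_lcs R) f F l ->
  cvg_lcs (E := complex_lcs R) g F l.
Proof. by move=> /funext ->. Qed.

Lemma cvg_lcs_eq_within (T : Type) (F : set_system T) (D : set T)
    (f g : T -> R[i]) l : Filter F -> (forall x, D x -> f x = g x) ->
  cvg_lcs (E := complex_lcs R) f (within D F) l ->
  cvg_lcs (E := complex_lcs R) g (within D F) l.
Proof.
move=> FF fg /cvg_lcs_near H; apply/cvg_lcs_near => e e0.
have := H e e0; rewrite !near_withinE; apply: filterS => x + Dx.
by rewrite fg//; apply.
Qed.


End complex_limits.

(** * Directional derivatives along a set: calculus rules and the mean value theorem *)

Section directional_derivatives.
Variables (R : realType) (W : normedModType R) (Om : set W).
Implicit Types (u w : W -> R[i]) (p v : W).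
Local Notation normc := Normc.normc.
Local Notation Re := complex.Re.
Local Notation cvgC := (cvg_lcs (E := complex_lcs R)).
Local Notation cont := (continuous_along (E := complex_lcs R) Om).
Local Notation isD := (is_D (E := complex_lcs R) Om).

Lemma cvg_lcs_within (T : Type) (F : set_system T) (D : set T)
    (f : T -> R[i]) l : Filter F -> F D -> cvgC f (within D F) l -> cvgC f F l.
Proof.
move=> FF FD /cvg_lcs_near H; apply/cvg_lcs_near => e e0.
by apply: filterS2 FD (H e e0) => x Dx; apply.
Qed.

Lemma cvg_line p v : p + h *: v @[h --> (0 : R)] --> p.
Proof.
rewrite -[X in _ --> X](addr0 p) -(scale0r v).
by apply: cvgD; [exact: cvg_cst | apply: cvgZr_tmp; exact: cvg_id].
Qed.

Lemma cont_line u p v : cont u -> Om p ->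
  cvgC (fun h : R => u (p + h *: v))
    (within [set h : R | Om (p + h *: v)] (nbhs (0 : R))) (u p).
Proof.
move=> cu Op; apply/cvg_lcs_near => e e0.
have /cvg_lcs_near /(_ e e0) := cu p Op; rewrite near_withinE => H.
rewrite near_withinE.
exact: (@cvg_line p v _ H).
Qed.

Lemma cont_line' u p v : cont u -> Om p ->
  cvgC (fun h : R => u (p + h *: v))
    (within [set h : R | Om (p + h *: v)] (0 : R)^') (u p).
Proof.
move=> cu Op; apply/cvg_lcs_near => e e0.
have /cvg_lcs_near /(_ e e0) := @cont_line u p v cu Op.
rewrite !near_withinE; exact: nbhs_dnbhs.
Qed.

Lemma contD u w : cont u -> cont w -> cont (fun p => u p + w p).
Proof. by move=> cu cw p Op; apply: cvg_lcsD; [exact: cu|exact: cw]. Qed.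

Lemma contM u w : cont u -> cont w -> cont (fun p => u p * w p).
Proof. by move=> cu cw p Op; apply: cvg_lcsM; [exact: cu|exact: cw]. Qed.

Lemma cont_cst c : cont (fun=> c).
Proof. by move=> p Op; exact: cvg_lcs_cst. Qed.

Lemma isDD v u u' w w' : isD v u u' -> isD v w w' ->
  isD v (fun p => u p + w p) (fun p => u' p + w' p).
Proof.
move=> du dw p Op; refine (cvg_lcs_eq _ (cvg_lcsD (du p Op) (dw p Op))) => h /=.
by rewrite -scalerDr opprD addrACA.
Qed.

Lemma isDM v u u' w w' : cont u -> isD v u u' -> isD v w w' ->
  isD v (fun p => u p * w p) (fun p => u' p * w p + u p * w' p).
Proof.
move=> cu du dw p Op.
refine (cvg_lcs_eq _ (cvg_lcsD (cvg_lcsM (du p Op) (cvg_lcs_cst (w p)))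
   (cvg_lcsM (@cont_line' _ _ v cu Op) (dw p Op)))) => h /=.
rewrite /GRing.scale /=; ring.
Qed.

Lemma isD_cst v c : isD v (fun=> c) (fun=> 0).
Proof.
move=> p Op; refine (cvg_lcs_eq _ (cvg_lcs_cst 0)) => h /=.
by rewrite subrr scaler0.
Qed.

Lemma isDZ v u u' c : isD v u u' -> isD v (fun p => c * u p) (fun p => c * u' p).
Proof.
move=> du; have := isDM (@cont_cst c) (@isD_cst v c) du.
by under [X in isD _ _ X]eq_fun do rewrite mul0r add0r.
Qed.

(** Substituting -h for h; this reduces steps h < 0 to steps h > 0 along the opposite direction. *)
Lemma isDN v u u' : isD v u u' -> isD (- v) u (fun p => - u' p).
Proof.
move=> du p Op; apply/cvg_lcs_near => e e0.
have /cvg_lcs_near /(_ e e0) := du p Op.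
rewrite near_withinE => H; rewrite near_withinE.
pose P h := Om (p + h *: v) -> normc ((- 'i * (h^-1)%:C) *:
      (u (p + h *: v) - u p : R[i]^o) - u' p) < e.
have {}H : \forall h \near (0 : R)^', P (- h).
  rewrite near_withinE; move: H; rewrite near_withinE => H.
  have N : (- h) @[h --> (0:R)] --> (0 : R).
    by rewrite -[X in _ --> X]oppr0; apply: cvgN; exact: cvg_id.
  have NH : \forall h \near (0:R), - h != 0 -> P (- h) := N _ H.
  by apply: filterS NH => h; rewrite oppr_eq0.
apply: filterS H => h; rewrite /P /= scalerN scaleNr => + Oh => /(_ Oh).
have -> : - 'i * ((- h)^-1)%:C = - (- 'i * (h^-1)%:C) :> R[i].
  by rewrite invrN; simpc.
by rewrite -[in X in X -> _]normcN opprD scaleNr opprK.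
Qed.

Lemma cont_ext u w : (forall p, Om p -> u p = w p) -> cont u -> cont w.
Proof.
move=> uw cu p Op; rewrite -uw//; by refine (cvg_lcs_eq_within _ _ (cu p Op)).
Qed.

Lemma isD_ext v u u' w w' : (forall p, Om p -> u p = w p) ->
  (forall p, Om p -> u' p = w' p) -> isD v u u' -> isD v w w'.
Proof.
move=> uw uw' du p Op; rewrite -uw'//; refine (cvg_lcs_eq_within _ _ (du p Op)).
by move=> h Oh; rewrite !uw.
Qed.

Lemma isD_translate q v u u' (Om' : set W) : (forall p, Om' p -> Om (p + q)) ->
  isD v u u' ->
  is_D (E := complex_lcs R) Om' v (fun p => u (p + q)) (fun p => u' (p + q)).
Proof.
move=> O du p Op; apply/cvg_lcs_near => e e0.
have /cvg_lcs_near /(_ e e0) := du (p + q) (O p Op).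
rewrite !near_withinE; apply: filterS => h /= + h0 Oh.
by rewrite [p + q + _]addrAC => /(_ h0 (O _ Oh)).
Qed.

(** The factor ['i] undoes the -i contained in D. Near s the line lies in [Om], so the limit along
    [Om] is an ordinary two-sided one. *)
Lemma line_derive u u' v p (s : R) : isD v u u' ->
  (\forall h \near s, Om (p + h *: v)) ->
  is_derive s 1 (fun h : R => Re (u (p + h *: v))) (Re ('i * u' (p + s *: v))).
Proof.
move=> du Os.
suff H : (fun h => h^-1 *: (((fun h : R => Re (u (p + h *: v))) \o shift s)
    (h *: 1) - Re (u (p + s *: v)))) @ 0^' --> Re ('i * u' (p + s *: v)).
  by apply: DeriveDef; [apply/cvg_ex; eexists; exact: H | exact/cvg_lim].
have Op : Om (p + s *: v) by exact: nbhs_singleton Os.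
have H := cvg_lcs_within _ (f := fun h : R => (- 'i * (h^-1)%:C) *:
  (u (p + s *: v + h *: v) - u (p + s *: v) : R[i]^o)) _ (du _ Op).
have /H {}H : 0^' [set h : R | Om (p + s *: v + h *: v)].
  apply: nbhs_dnbhs.
  have N : s + h @[h --> (0 : R)] --> s.
    by rewrite -[X in _ --> X]addr0; apply: cvgD; [exact: cvg_cst|exact: cvg_id].
  have NH : \forall h \near (0:R), Om (p + (s + h) *: v) := N _ Os.
  by apply: filterS NH => h /=; rewrite scalerDl addrA.
pose proof (cvg_lcsM (cvg_lcs_cst 'i%C) H) as H2.
have /cvg_lcsP[+ _] := H2.
apply: cvg_trans; apply: near_eq_cvg; apply: nearW => h /=.
rewrite [h%:A](mulr1 h) scalerDl [h *: v + _]addrC addrA.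
move: (u _) (u _) => [a1 a2] [b1 b2]; rewrite /GRing.scale /=; ring.
Qed.

Lemma Re_segment_continuous u v p (h : R) :
  (forall s, 0 <= s <= h -> Om (p + s *: v)) -> cont u ->
  {within `[0, h], continuous (fun s : R => Re (u (p + s *: v)))}.
Proof.
move=> Oh cu; apply/subspace_continuousP => s /=; rewrite in_itv/= => sh.
pose proof (@cont_line _ _ v cu (Oh s sh)) as H.
apply/cvgrPdist_lt => e e0; rewrite near_withinE.
have /cvg_lcs_near /(_ e e0) := H; rewrite near_withinE => {}H.
have N : t - s @[t --> s] --> 0.
  by rewrite -(subrr s); apply: cvgB; [exact: cvg_id|exact: cvg_cst].
have NH : \forall t \near s, Om (p + s *: v + (t - s) *: v) ->
  normc (u (p + s *: v + (t - s) *: v) - u (p + s *: v)) < e := N _ H.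
apply: filterS NH => t; rewrite -addrA -scalerDl subrKC => + th; move: th; rewrite /= in_itv/= => th.
move=> /(_ (Oh t th)); apply: le_lt_trans.
by rewrite distrC -Re_sub normc_Re.
Qed.

(** The real and imaginary parts of u need not share a mean value point, hence the restriction to
    [Re]. The imaginary part of u is reached as the real part of -i u. *)
Lemma Re_MVT u u' v p h : 0 < h -> (forall s, 0 <= s <= h -> Om (p + s *: v)) ->
  cont u -> isD v u u' -> exists2 s, 0 < s < h &
    Re (u (p + h *: v)) - Re (u p) = h * Re ('i * u' (p + s *: v)).
Proof.
move=> h0 Oh cu du.
have [||s] := @MVT R (fun s => Re (u (p + s *: v)))
  (fun s => Re ('i * u' (p + s *: v))) 0 h h0.
- move=> s sh; apply: line_derive du _.
  have : \forall t \near s, t \in `]0, h[ by exact: near_in_itvoo.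
  apply: filterS => t; rewrite in_itv/= => /andP[t0 th].
  by apply: Oh; rewrite !ltW.
- exact: Re_segment_continuous.
- rewrite in_itv/= => sh; rewrite scale0r addr0 subr0 => ->.
  by exists s => //; rewrite mulrC.
Qed.

End directional_derivatives.

(** * Differentiability of finite order with graded estimates; symmetry of second derivatives *)

Section graded_smoothness.
Variables (R : realType) (W : normedModType R) (Om : set W).
Variables (I : finType) (e : I -> W).
Hypothesis Om_e : forall p i (h : R), Om p -> 0 <= h -> Om (p + h *: e i).
Implicit Types (u w : W -> R[i]) (p v : W).
Local Notation normc := Normc.normc.
Local Notation Re := complex.Re.
Local Notation cvgC := (cvg_lcs (E := complex_lcs R)).
Local Notation cont := (continuous_along (E := complex_lcs R) Om).
Local Notation isD := (is_D (E := complex_lcs R) Om).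

Lemma isD_right v u u' p : isD v u u' -> (forall h, 0 <= h -> Om (p + h *: v)) ->
  cvgC (fun h : R => (- 'i * (h^-1)%:C) * (u (p + h *: v) - u p)) (0 : R)^'+
    (u' p).
Proof.
move=> du Oh; apply/cvg_lcs_near => d d0.
have Op : Om p by have := Oh 0 (lexx _); rewrite scale0r addr0.
have /cvg_lcs_near /(_ d d0) := du p Op; rewrite !near_withinE.
by apply: filterS => h H h0; apply: H; rewrite ?gt_eqF//; apply/Oh/ltW.
Qed.

(** At a boundary point only the steps h > 0 are sure to stay in [Om]; the right-hand limit alone
    already determines the derivative. *)
Lemma isD_unique i u u' w' : isD (e i) u u' -> isD (e i) u w' ->
  forall p, Om p -> u' p = w' p.
Proof.
move=> du dw p Op.
pose proof (isD_right du (fun h => @Om_e p i h Op)) as H1.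
pose proof (isD_right dw (fun h => @Om_e p i h Op)) as H2.
exact: cvg_lcs_unique H1 H2.
Qed.

Lemma nbhs_corner (A : set W) p v1 v2 : nbhs p A ->
  exists2 h : R, 0 < h & forall a b, 0 < a < h -> 0 < b < h ->
    A (p + a *: v1 + b *: v2).
Proof.
move=> /nbhs_ballP[d /= d0 dA]; pose M := `|v1| + `|v2| + 1.
have M0 : 0 < M by rewrite ltr_wpDl ?addr_ge0.
exists (d / M); first by rewrite divr_gt0.
move=> a b /andP[a0 ad] /andP[b0 bd]; apply: dA; rewrite -ball_normE /=.
rewrite -addrA opprD addrA subrr add0r normrN.
apply: (le_lt_trans (ler_normD _ _)); rewrite !normrZ !gtr0_norm//.
apply: (@le_lt_trans _ _ (d / M * (`|v1| + `|v2|))).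
  by rewrite mulrDr lerD// ler_wpM2r// ltW.
by rewrite -mulrA gtr_pMr// mulrC ltr_pdivrMr// mul1r /M ltrDl.
Qed.

Lemma cont_translate q u : (forall p, Om p -> Om (p + q)) -> cont u ->
  cont (fun p => u (p + q)).
Proof.
move=> O cu p Op; apply/cvg_lcs_near => d d0.
have /cvg_lcs_near /(_ d d0) := cu (p + q) (O p Op); rewrite !near_withinE.
move=> H; have N : x + q @[x --> p] --> p + q.
  by apply: cvgD; [exact: cvg_id|exact: cvg_cst].
have NH : \forall x \near p, Om (x + q) -> normc (u (x + q) - u (p + q)) < d
  := N _ H.
by apply: filterS NH => x /= + Ox; apply; exact: O.
Qed.

(** The mean value theorem along e i, applied to the increment of u in direction e j, and then along
    e j. The minus sign is ['i * 'i]. All points are reached from p by nonnegative steps, so they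
    lie in [Om] even if p is on the boundary. *)
Lemma second_difference i j u ui uij p h : cont u -> cont ui -> cont uij ->
  isD (e i) u ui -> isD (e j) ui uij -> Om p -> 0 < h ->
  exists a b, [/\ 0 < a < h, 0 < b < h &
    Re (u (p + h *: e i + h *: e j)) - Re (u (p + h *: e i))
    - (Re (u (p + h *: e j)) - Re (u p)) =
    h ^+ 2 * Re (- uij (p + a *: e i + b *: e j))].
Proof.
move=> cu cui cuij du dui Op h0.
have Oj q : Om q -> Om (q + h *: e j) by move=> Oq; apply: Om_e => //; exact: ltW.
have cU : cont (fun q => u (q + h *: e j) + (- 1) * u q).
  apply: contD; first exact: cont_translate.
  by apply: contM => //; exact: cont_cst.
have dU : isD (e i) (fun q => u (q + h *: e j) + (- 1) * u q)
                    (fun q => ui (q + h *: e j) + (- 1) * ui q).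
  by apply: isDD; [exact: isD_translate Oj du|exact: isDZ].
have [|a aP H] := @Re_MVT _ _ _ _ _ (e i) p h h0 _ cU dU.
  by move=> s /andP[s0 _]; exact: Om_e.
have [|||b bP H'] := @Re_MVT _ _ Om (fun q => 'i * ui q) (fun q => 'i * uij q)
  (e j) (p + a *: e i) h h0.
- move=> s /andP[s0 _]; apply: Om_e => //; apply: Om_e => //.
  by case/andP: aP => /ltW.
- by apply: contM => //; exact: cont_cst.
- exact: isDZ.
exists a, b; split => //.
move: H' H; rewrite !mulN1r mulrBr !Re_sub => -> ->.
by case: (uij _) => ? ? /=; ring.
Qed.

(** Both orders of differentiation express the same second difference. So the real parts of [uij]
    and [uji] agree at two points, possibly different, as close to p as desired, and continuity at p
    concludes. *)
Lemma Re_schwarz i j u ui uj uij uji p :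
  cont u -> cont ui -> cont uj -> cont uij -> cont uji ->
  isD (e i) u ui -> isD (e j) u uj -> isD (e j) ui uij -> isD (e i) uj uji ->
  Om p -> Re (uij p) = Re (uji p).
Proof.
move=> cu cui cuj cuij cuji du duj dui dji Op.
apply/eqP; rewrite -subr_eq0 -normr_le0; apply/ler_addgt0Pr => d d0; rewrite add0r.
have d2 : 0 < d / 2 by rewrite divr_gt0.
have /cvg_lcs_near /(_ _ d2) := cuij p Op; rewrite near_withinE.
move=> /(@nbhs_corner _ _ (e i) (e j)) [h1 h10 H1].
have /cvg_lcs_near /(_ _ d2) := cuji p Op; rewrite near_withinE.
move=> /(@nbhs_corner _ _ (e j) (e i)) [h2 h20 H2].
pose h := Num.min h1 h2; have h0 : 0 < h by rewrite lt_min h10.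
have [a [b [a0 b0 E]]] := second_difference cu cui cuij du dui Op h0.
have [a' [b' [a'0 b'0 E']]] := second_difference cu cuj cuji duj dji Op h0.
rewrite [p + _ + _]addrAC in E'.
have {E E'} : h ^+ 2 * Re (uij (p + a *: e i + b *: e j))
    = h ^+ 2 * Re (uji (p + a' *: e j + b' *: e i)).
  move: E E'; case: (uij _) (uji _) => ? ? [? ?] /=; lra.
move=> /(mulfI (lt0r_neq0 (exprn_gt0 2 h0))) E.
have [h1l h2l] : h <= h1 /\ h <= h2 by rewrite !ge_min !lexx orbT.
have in_h s k : 0 < s < h -> h <= k -> 0 < s < k.
  by move=> /andP[-> sh] hk; apply: lt_le_trans hk.
have pos s : 0 < s < h -> 0 <= s by case/andP => /ltW.
have O1 : Om (p + a *: e i + b *: e j).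
  by apply: Om_e; [apply: Om_e => //; exact: pos a0|exact: pos b0].
have {}H1 := H1 _ _ (in_h _ _ a0 h1l) (in_h _ _ b0 h1l).
have {}H2 := H2 _ _ (in_h _ _ a'0 h2l) (in_h _ _ b'0 h2l).
have {}H1 := H1 O1.
have O2 : Om (p + a' *: e j + b' *: e i).
  by apply: Om_e; [apply: Om_e => //; exact: pos a'0|exact: pos b'0].
have {}H2 := H2 O2.
rewrite (splitr d); apply: le_trans (lerD (ltW H1) (ltW H2)).
rewrite normcB; apply: le_trans (lerD (normc_Re _) (normc_Re _)).
by rewrite !Re_sub E (le_trans _ (ler_normD _ _))// addrA subrK.
Qed.

Lemma schwarz i j u ui uj uij uji p :
  cont u -> cont ui -> cont uj -> cont uij -> cont uji ->
  isD (e i) u ui -> isD (e j) u uj -> isD (e j) ui uij -> isD (e i) uj uji ->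
  Om p -> uij p = uji p.
Proof.
move=> cu cui cuj cuij cuji du duj dui dji Op.
have ci w : cont w -> cont (fun p => 'i * w p).
  by move=> cw; apply: contM => //; exact: cont_cst.
have /eqP E1 := Re_schwarz cu cui cuj cuij cuji du duj dui dji Op.
have E2 : Re ('i * uij p) = Re ('i * uji p).
  exact: (Re_schwarz (ci _ cu) (ci _ cui) (ci _ cuj) (ci _ cuij) (ci _ cuji)
    (isDZ 'i du) (isDZ 'i duj) (isDZ 'i dui) (isDZ 'i dji) Op).
apply/eqP; rewrite eq_complex E1 /=; move: E2.
by rewrite !Re_mul /= !mul0r !mul1r !sub0r => /oppr_inj ->.
Qed.

Section graded.
Variables (G : nmodType) (eg : I -> G).

(* u is N times continuously differentiable along Om, and every derivative
   satisfies P at the grade reached by adding the grades of the directions. *)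
Fixpoint CN (P : G -> (W -> R[i]) -> Prop) (N : nat) (g : G) (u : W -> R[i]) :=
  [/\ cont u, P g u & if N is N'.+1 then
    forall i, exists2 u', isD (e i) u u' & CN P N' (g + eg i) u' else True].

Section one.
Variable P : G -> (W -> R[i]) -> Prop.
Hypothesis P_ext : forall g u w, (forall p, Om p -> u p = w p) -> P g u -> P g w.

Lemma CN_cont N g u : CN P N g u -> cont u. Proof. by case: N => [[]|N []]. Qed.

Lemma CN_P N g u : CN P N g u -> P g u. Proof. by case: N => [[]|N []]. Qed.

Lemma CN_ext N g u w : (forall p, Om p -> u p = w p) -> CN P N g u -> CN P N g w.
Proof.
move=> uw; case: N => [|N] [cu Pu H]; split;
  [exact: cont_ext uw cu|exact: P_ext uw Pu|exact: Logic.I|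
   exact: cont_ext uw cu|exact: P_ext uw Pu|].
move=> i; have [u' du' Hu'] := H i.
by exists u'; [exact: isD_ext uw _ du'|exact: Hu'].
Qed.

Lemma CNW N g u : CN P N.+1 g u -> CN P N g u.
Proof.
elim: N g u => [|N IH] g u [cu Pu H]; split; [exact: cu|exact: Pu|exact: Logic.I|
  exact: cu|exact: Pu|].
move=> i; have [u' du' /IH Hu'] := H i.
by exists u'; [exact: du'|exact: Hu'].
Qed.

Lemma CN_add N g u w : (forall g u w, cont u -> cont w -> P g u -> P g w ->
    P g (fun p => u p + w p)) -> CN P N g u -> CN P N g w -> CN P N g (fun p => u p + w p).
Proof.
move=> PD; elim: N g u w => [|N IH] g u w [cu Pu H] [cw Pw K]; split;
  [exact: contD|exact: PD|exact: Logic.I|exact: contD|exact: PD|].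
move=> i; have [u' du' Hu'] := H i; have [w' dw' Hw'] := K i.
by exists (fun p => u' p + w' p); [exact: isDD|exact: IH].
Qed.

Lemma CN_family (a : W -> R[i]) A g : D_family (E := complex_lcs R) Om e a A ->
  (forall al : {ffun I -> nat}, P (g + \sum_i eg i *+ al i) (A al)) ->
  forall N (al : {ffun I -> nat}), CN P N (g + \sum_i eg i *+ al i) (A al).
Proof.
move=> [_ DA] PA; elim=> [|N IH] al; have [_ cA dA] := DA al; split;
  [exact: cA|exact: PA|exact: Logic.I|exact: cA|exact: PA|].
move=> i; exists (A [ffun k => (al k + (k == i))%N]); first exact: dA.
have := IH [ffun k => (al k + (k == i))%N]; congr CN.
rewrite -addrA; congr (_ + _).
rewrite (eq_bigr (fun k => eg k *+ al k + eg k *+ (k == i))); last first.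
  by move=> k _; rewrite ffunE mulrnDr.
rewrite big_split /=; congr (_ + _).
rewrite (bigD1 i)//= eqxx mulr1n big1 ?addr0// => k /negbTE ->.
by rewrite mulr0n.
Qed.

End one.

Lemma CN_mul (P1 P2 P3 : G -> (W -> R[i]) -> Prop) N g1 g2 u w :
  (forall g u w, (forall p, Om p -> u p = w p) -> P3 g u -> P3 g w) ->
  (forall g u w, cont u -> cont w -> P3 g u -> P3 g w ->
    P3 g (fun p => u p + w p)) ->
  (forall g1 g2 u w, cont u -> cont w -> P1 g1 u -> P2 g2 w ->
    P3 (g1 + g2) (fun p => u p * w p)) ->
  CN P1 N g1 u -> CN P2 N g2 w -> CN P3 N (g1 + g2) (fun p => u p * w p).
Proof.
move=> Pe PD PM.
elim: N g1 g2 u w => [|N IH] g1 g2 u w Hu Hw; case: (Hu) (Hw) => [cu Pu H] [cw Pw K];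
  split; [exact: contM|exact: PM|exact: Logic.I|exact: contM|exact: PM|].
move=> i; have [u' du' Hu'] := H i; have [w' dw' Hw'] := K i.
exists (fun p => u' p * w p + u p * w' p); first exact: isDM.
(* In each Leibniz term the new grade goes to the differentiated factor; the other factor has one
   order to spare, which [CNW] discards. *)
apply: (CN_add PD).
- by rewrite addrAC; apply: (IH _ _ _ _ Hu'); apply: CNW Hw.
- by rewrite -addrA; apply: (IH _ _ _ _ _ Hw'); apply: CNW Hu.
Qed.

End graded.
End graded_smoothness.

(** * From differentiability of every finite order to a family of derivatives, and its uniqueness *)

Section derivative_family.
Variables (R : realType) (W : normedModType R) (Om : set W).
Variables (I : finType) (e : I -> W).
Hypothesis Om_e : forall p i (h : R), Om p -> 0 <= h -> Om (p + h *: e i).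
Variables (G : nmodType) (eg : I -> G) (P : G -> (W -> R[i]) -> Prop).
Hypothesis P_ext : forall g u w, (forall p, Om p -> u p = w p) -> P g u -> P g w.
Implicit Types (u w : W -> R[i]) (p v : W) (i j : I) (g : G).
Local Notation isD := (is_D (E := complex_lcs R) Om).
Local Notation CN := (CN Om e eg P).

Let S g u := forall N, CN N g u.
Let eqOm u w := forall p, Om p -> u p = w p.

(** [CN] may provide a different derivative for each order N. By [isD_unique] these agree on [Om],
    so one choice serves all orders. *)
Definition some_derivative i u : W -> R[i] :=
  if pselect (exists u', isD (e i) u u') is left H then projT1 (cid H) else u.
Local Notation d := some_derivative.

Lemma some_derivativeP g u i : S g u -> isD (e i) u (d i u) /\ S (g + eg i) (d i u).
Proof.
move=> Su; have dd : isD (e i) u (d i u).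
  rewrite /d; case: pselect => [H|[]]; first exact: projT2 (cid H).
  by have [_ _ /(_ i)[u' du' _]] := Su 1%N; exists u'.
split; first exact: dd.
move=> N; have [_ _ /(_ i)[u' du' Hu']] := Su N.+1.
by apply: (CN_ext P_ext _ Hu') => p Op; exact: (isD_unique Om_e du' dd Op).
Qed.

Lemma some_derivative_ext g u w i : S g u -> eqOm u w ->
  eqOm (d i u) (d i w).
Proof.
move=> Su uw p Op; have [du _] := some_derivativeP i Su.
have Sw : S g w by move=> N; exact: (CN_ext P_ext uw (Su N)).
have [dw _] := some_derivativeP i Sw.
have du' : isD (e i) w (d i u) by exact: isD_ext uw _ du.
exact: (isD_unique Om_e du' dw Op).
Qed.

Lemma some_derivativeC g u i j : S g u -> eqOm (d i (d j u)) (d j (d i u)).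
Proof.
move=> Su p Op.
have [di Sdi] := some_derivativeP i Su; have [dj Sdj] := some_derivativeP j Su.
have [dij Sdij] := some_derivativeP j Sdi.
have [dji Sdji] := some_derivativeP i Sdj.
exact: (schwarz Om_e (CN_cont (Su 0%N)) (CN_cont (Sdj 0%N)) (CN_cont (Sdi 0%N))
  (CN_cont (Sdji 0%N)) (CN_cont (Sdij 0%N)) dj di dji dij Op).
Qed.

Lemma iter_derivativeP g u i n : S g u -> S (g + eg i *+ n) (iter n (d i) u).
Proof.
move=> Su; elim: n => [|n IH]; first by rewrite mulr0n addr0.
by rewrite mulrSr addrA /=; case: (some_derivativeP i IH).
Qed.

Lemma iter_derivative_ext g u w i n : S g u -> eqOm u w ->
  eqOm (iter n (d i) u) (iter n (d i) w).
Proof.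
move=> Su uw; elim: n => [//|n IH] /=.
exact: some_derivative_ext (iter_derivativeP i n Su) IH.
Qed.

Lemma derivative_iterC g u i j n : S g u ->
  eqOm (d i (iter n (d j) u)) (iter n (d j) (d i u)).
Proof.
move=> Su; elim: n => [//|n IH] /= p Op.
have Sn := iter_derivativeP j n Su.
rewrite (some_derivativeC i j Sn Op).
exact: (some_derivative_ext j (some_derivativeP i Sn).2 IH Op).
Qed.

Definition derivatives (a : W -> R[i]) (s : seq I) (al : I -> nat) : W -> R[i] :=
  foldr (fun i w => iter (al i) (d i) w) a s.

Lemma derivativesP a g s al : S g a ->
  S (g + \sum_(i <- s) eg i *+ al i) (derivatives a s al).
Proof.
move=> Sa; elim: s => [|i s IH] /=; first by rewrite big_nil addr0.
by rewrite big_cons addrCA addrC; exact: iter_derivativeP.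
Qed.

Lemma eq_derivatives a s al al' : (forall i, i \in s -> al i = al' i) ->
  derivatives a s al = derivatives a s al'.
Proof.
elim: s => [//|i s IH] /= E; rewrite E ?mem_head// IH// => j js.
by rewrite E// inE js orbT.
Qed.

(** [derivatives] treats one coordinate after the other, the head of the list outermost. By Schwarz
    a further derivative in direction e i moves past the blocks of the coordinates preceding i until
    it joins its own. *)
Lemma derivatives_succ a g s al i : S g a -> uniq s -> i \in s ->
  eqOm (d i (derivatives a s al)) (derivatives a s (fun k => al k + (k == i))%N).
Proof.
move=> Sa; elim: s => [//|j s IH] /= /andP[js us]; rewrite inE.
have Ss := derivativesP s al Sa.
have [ij _|ij /= is_] := eqVneq i j.
  subst j; rewrite addn1 (@eq_derivatives a s _ al)// => k ks.
  by case: eqP ks => [->|]; [rewrite (negbTE js)|rewrite addn0].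
rewrite addn0 => p Op.
rewrite (derivative_iterC i j (al j) Ss Op).
exact: (iter_derivative_ext j (al j) (some_derivativeP i Ss).2 (IH us is_) Op).
Qed.

Lemma CN_D_family (a : W -> R[i]) g : (forall N, CN N g a) ->
  exists A, D_family (E := complex_lcs R) Om e a A /\
    forall al : {ffun I -> nat}, P (g + \sum_i eg i *+ al i) (A al).
Proof.
move=> Sa; exists (fun al => derivatives a (index_enum I) al); split; last first.
  by move=> al; exact: CN_P (derivativesP (index_enum I) al Sa 0%N).
split.
  move=> p Op; suff -> : derivatives a (index_enum I) [ffun=> 0%N] = a by [].
  by elim: (index_enum I) => [//|i s IH] /=; rewrite ffunE.
move=> al; have Sal := derivativesP (index_enum I) al Sa; split.
- by [].
- exact: CN_cont (Sal 0%N).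
- move=> i; have [du _] := some_derivativeP i Sal.
  apply: (isD_ext _ _ du) => // p Op.
  rewrite (derivatives_succ al Sa (index_enum_uniq I) (mem_index_enum i) Op).
  by congr (derivatives _ _ _ _); apply/funext => k; rewrite ffunE.
Qed.

(** Induction on the total order of [al]: a nonzero multi-index is a successor in some coordinate,
    where [isD_unique] applies. Consequently an estimate does not depend on the family that
    witnesses smoothness. *)
Lemma D_family_unique (a : W -> R[i]) A B :
  D_family (E := complex_lcs R) Om e a A ->
  D_family (E := complex_lcs R) Om e a B ->
  forall (al : {ffun I -> nat}) p, Om p -> A al p = B al p.
Proof.
move=> [A0 DA] [B0 DB] al.
have [n] := ubnP (\sum_i al i)%N; elim: n al => [//|n IH] al.
have [/forallP al0 _|] := boolP [forall i, al i == 0%N].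
  have -> : al = [ffun=> 0%N] by apply/ffunP => i; rewrite ffunE; apply/eqP.
  by move=> p Op; rewrite A0// B0.
rewrite negb_forall => /existsP[i ali] aln.
pose al' := [ffun k => (al k - (k == i))%N].
have E : al = [ffun k => (al' k + (k == i))%N].
  apply/ffunP => k; rewrite !ffunE; case: eqP => [->|_]; last by rewrite subn0 addn0.
  by rewrite subnK// lt0n.
have aln' : (\sum_k al' k < n)%N.
  move: aln; rewrite {1}E (eq_bigr (fun k => al' k + (k == i))%N); last first.
    by move=> k _; rewrite ffunE.
  rewrite big_split /= (bigD1 i (F := fun k => nat_of_bool (k == i)))//= eqxx.
  rewrite [X in (_ + (_ + X))%N]big1; last by move=> k /negbTE ->.
  by rewrite addn0 addn1.
have [_ _ dA] := DA al'; have [_ _ dB] := DB al'.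
rewrite E; apply: isD_unique (dA i) _ => //.
by apply: (isD_ext _ _ (dB i)) => // p Op; rewrite IH.
Qed.

End derivative_family.

(** * The norm of L^2(0, +oo) *)

Section L2_norm.
Variable R : realType.
Local Notation normc := Normc.normc.
Local Notation Re := complex.Re.
Local Notation Im := complex.Im.
Local Notation D := [set t : R | 0 < t].
Local Notation mu := (@lebesgue_measure R).
Implicit Types (f g : R -> R[i]).

Definition measC f := measurable_fun D (fun t => Re (f t)) /\
                      measurable_fun D (fun t => Im (f t)).

Lemma pos_itv : D = [set` `]0%R, +oo[ ].
Proof. by apply/seteqP; split => t /=; rewrite in_itv/= andbT. Qed.

Lemma measurable_pos : measurable D.
Proof. by rewrite pos_itv; exact: measurable_itv. Qed.
Hint Resolve measurable_pos : core.

Lemma normc_sqr (z : R[i]) : normc z ^+ 2 = Re z ^+ 2 + Im z ^+ 2.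
Proof. by case: z => a b /=; rewrite sqr_sqrtr// addr_ge0// sqr_ge0. Qed.

Lemma measurable_normc_sqr f : measC f -> measurable_fun D (fun t => normc (f t) ^+ 2).
Proof.
move=> [m1 m2].
rewrite (_ : (fun t => _) = (fun t => Re (f t) ^+ 2 + Im (f t) ^+ 2)).
  by apply: measurable_funD; exact: measurable_funX.
by apply/funext => t; exact: normc_sqr.
Qed.

Lemma measurable_normc f : measC f -> measurable_fun D (fun t => normc (f t)).
Proof.
move=> mf; have -> : (fun t => normc (f t)) = Num.sqrt \o (fun t => normc (f t) ^+ 2).
  by apply/funext => t /=; rewrite sqrtr_sqr ger0_norm// normc_ge0.
apply: measurableT_comp; last exact: measurable_normc_sqr.
apply: continuous_measurable_fun; exact: sqrt_continuous.
Qed.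

Lemma measC_add f g : measC f -> measC g -> measC (fun t => f t + g t).
Proof.
move=> [f1 f2] [g1 g2]; split.
- rewrite (_ : (fun t => _) = (fun t => Re (f t) + Re (g t))).
    exact: measurable_funD.
  by apply/funext => t; case: (f t) (g t) => ? ? [? ?].
- rewrite (_ : (fun t => _) = (fun t => Im (f t) + Im (g t))).
    exact: measurable_funD.
  by apply/funext => t; case: (f t) (g t) => ? ? [? ?].
Qed.

Lemma measC_mul f g : measC f -> measC g -> measC (fun t => f t * g t).
Proof.
move=> [f1 f2] [g1 g2]; split.
- rewrite (_ : (fun t => _) = (fun t => Re (f t) * Re (g t) - Im (f t) * Im (g t)));
    last by apply/funext => t; exact: Re_mul.
  by apply: measurable_funB; exact: measurable_funM.
- rewrite (_ : (fun t => _) = (fun t => Re (f t) * Im (g t) + Im (f t) * Re (g t)));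
    last by apply/funext => t; exact: Im_mul.
  by apply: measurable_funD; exact: measurable_funM.
Qed.

Lemma measC_cst c : measC (fun=> c).
Proof. by split; exact: measurable_cst. Qed.

Lemma measC_pow l : measC (fun t : R => (t ^+ l)%:C).
Proof.
by split => /=; [apply: measurable_funX; exact: measurable_id|exact: measurable_cst].
Qed.

Lemma measC_dilation (g : R) f : 0 < g -> measC f -> measC (fun t => f (t / g)).
Proof.
move=> g0 [f1 f2].
have m : measurable_fun D (fun t : R => t / g).
  by apply: measurable_funM; [exact: measurable_id|exact: measurable_cst].
have DD : (fun t : R => t / g) @` D `<=` D.
  by move=> _ [t /= t0 <-]; rewrite divr_gt0.
split; [apply: (measurable_comp measurable_pos DD f1 m)|
        apply: (measurable_comp measurable_pos DD f2 m)].
Qed.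

Definition Q2 f : \bar R := (\int[mu]_(t in D) (normc (f t) ^+ 2)%:E)%E.

Lemma Q2_ge0 f : (0 <= Q2 f)%E.
Proof. by apply: integral_ge0 => t _; rewrite lee_fin sqr_ge0. Qed.

Lemma L2normE f : L2norm f = (Q2 f `^ 2^-1)%E.
Proof.
rewrite /L2norm unlock /Lnorm; congr poweR; rewrite /Q2 [RHS]integral_mkcond.
apply: eq_integral => t _; rewrite !patchE; case: ifPn => _.
  by rewrite /= ger0_norm ?normc_ge0// powR_mulrn// normc_ge0.
by rewrite abse0 poweR0r// pnatr_eq0.
Qed.

Lemma L2norm_ge0 f : (0 <= L2norm f)%E.
Proof. by rewrite L2normE poweR_ge0. Qed.

Lemma L2norm_le f M : 0 <= M -> (L2norm f <= M%:E)%E <-> (Q2 f <= (M ^+ 2)%:E)%E.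
Proof.
move=> M0; rewrite L2normE; split => H.
- have -> : Q2 f = ((Q2 f `^ 2^-1) `^ 2)%E.
    by rewrite -poweRrM mulVf ?pnatr_eq0// poweRe1// Q2_ge0.
  have -> : (M ^+ 2)%:E = (M%:E `^ 2)%E by rewrite poweR_EFin powR_mulrn.
  apply: gt0_ler_poweR => //; rewrite in_itv/= ?leey ?andbT ?poweR_ge0//.
- have -> : M%:E = ((M ^+ 2)%:E `^ 2^-1)%E.
    by rewrite poweR_EFin -powR_mulrn// -powRrM mulfV ?pnatr_eq0// powRr1.
  apply: gt0_ler_poweR => //; rewrite ?invr_ge0// in_itv/= ?leey ?andbT ?Q2_ge0//.
  by rewrite lee_fin sqr_ge0.
Qed.

Lemma eq_L2norm f g : (forall t, 0 < t -> f t = g t) -> L2norm f = L2norm g.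
Proof.
move=> fg; rewrite !L2normE; congr (_ `^ _)%E.
by apply: eq_integral => t; rewrite inE => t0; rewrite fg.
Qed.

Lemma le_L2norm f g : measC f -> measC g ->
  (forall t, 0 < t -> normc (f t) <= normc (g t)) -> (L2norm f <= L2norm g)%E.
Proof.
move=> mf mg fg; rewrite !L2normE; apply: gt0_ler_poweR; rewrite ?invr_ge0//;
  rewrite ?in_itv/= ?leey ?andbT ?Q2_ge0//.
apply: ge0_le_integral => //.
- by move=> t _; rewrite lee_fin sqr_ge0.
- by apply/measurable_EFinP; exact: measurable_normc_sqr.
- by apply/measurable_EFinP; exact: measurable_normc_sqr.
- by move=> t t0; rewrite lee_fin lerXn2r ?nnegrE ?normc_ge0// fg.
Qed.

Lemma L2normZ (c : R[i]) f : measC f ->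
  L2norm (fun t => c * f t) = ((normc c)%:E * L2norm f)%E.
Proof.
move=> mf; rewrite !L2normE /Q2.
under eq_integral do rewrite Normc.normcM exprMn EFinM.
rewrite ge0_integralZl//; last 3 first.
- by apply/measurable_EFinP; exact: measurable_normc_sqr.
- by move=> t _; rewrite lee_fin sqr_ge0.
- by rewrite lee_fin sqr_ge0.
rewrite poweRM ?lee_fin ?sqr_ge0 ?Q2_ge0//; congr (_ * _)%E.
by rewrite poweR_EFin -powR_mulrn ?normc_ge0// -powRrM mulfV ?pnatr_eq0// powRr1// normc_ge0.
Qed.

Lemma L2normD f g : measC f -> measC g ->
  (L2norm (fun t => f t + g t)%R <= L2norm f + L2norm g)%E.
Proof.
move=> mf mg.
have E (h : R -> R[i]) : L2norm h = ('N[mu]_(2%:E)[EFin \o ((fun t : R => normc (h t)) \_ D)%R])%E.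
  rewrite /L2norm; congr Lnorm; apply/funext => t /=.
  by rewrite !patchE; case: ifPn.
have mn (h : R -> R[i]) : measC h -> measurable_fun setT ((fun t : R => normc (h t)) \_ D).
  by move=> mh; apply/(measurable_restrictT _ _).1 => //; exact: measurable_normc.
(* Minkowski's inequality is applied to the moduli, whose sum dominates the modulus of f + g. *)
pose k t := (normc (f t) + normc (g t))%:C.
apply: (@le_trans _ _ (L2norm k)).
  apply: le_L2norm; first exact: measC_add.
    split => /=; last exact: measurable_cst.
    by apply: measurable_funD; exact: measurable_normc.
  move=> t _; rewrite normc_real ger0_norm ?addr_ge0 ?normc_ge0//.
  exact: le_normcD.
have -> : L2norm k = ('N[mu]_(2%:E)[EFin \o ((fun t : R => normc (f t)) \_ D
    \+ (fun t : R => normc (g t)) \_ D)%R])%E.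
  rewrite E; apply: eq_Lnorm => t /=; congr EFin; rewrite !patchE.
  case: ifPn => _; last by rewrite addr0.
  by apply: etrans (normc_real _) _; rewrite ger0_norm// addr_ge0// normc_ge0.
by rewrite !E; apply: minkowski_EFin; [exact: mn|exact: mn|rewrite ler1n].
Qed.

(** Uniqueness of Lebesgue measure: 1/g times the pushforward gives every half-open interval its
    length. *)
Lemma lebesgue_measure_dilation (g : R) (A : set R) (g0 : 0 < g) : measurable A ->
  pushforward mu ((fun t => t / g) : R -> measurableTypeR R) A =
  mscale (NngNum (ltW g0)) mu A.
Proof.
move=> mA; rewrite /mscale/=.
have gN0 : g != 0 by rewrite gt_eqF.
pose h : {nonneg R} := NngNum (ltW (divr_gt0 ltr01 g0)).
pose phi : R -> measurableTypeR R := fun t => t / g.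
have mphi : measurable_fun setT phi by exact: measurable_funM.
pose nu := mscale h (pushforward mu phi) : {measure set (measurableTypeR R) -> \bar R}.
have H : lebesgue_measure A = nu mphi A.
  refine (@lebesgue_measure_unique R (nu mphi) _ A mA) => _ [[a b]] _ <-.
  have E : phi @^-1` `]a, b] = `]a * g, b * g]%classic.
    by apply/seteqP; split => t /=; rewrite !in_itv/= /phi ltr_pdivlMr// ler_pdivrMr.
  have -> : nu mphi [set` `]a, b]%R] = ((1 / g)%:E * mu [set` `]a * g, b * g]%R])%E by rewrite -E.
  rewrite !lebesgue_measure_itv/= !lte_fin ltr_pM2r//.
  case: ifP => _; last by rewrite mule0.
  by rewrite -!EFinB -EFinM; congr EFin; field.
have -> : mu A = ((1 / g)%:E * pushforward mu phi A)%E by exact: H.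
by rewrite muleA -EFinM mul1r mulfV// mul1e.
Qed.

Lemma L2norm_dilation (g : R) f : 0 < g -> measC f ->
  L2norm (fun t => f (t / g)) = ((g `^ 2^-1)%:E * L2norm f)%E.
Proof.
move=> g0 mf; rewrite !L2normE -poweR_EFin -poweRM ?Q2_ge0 ?lee_fin ?ltW//.
congr (_ `^ _)%E; pose phi : R -> measurableTypeR R := fun t => t / g.
have mphi : measurable_fun setT phi by exact: measurable_funM.
have msq := (measurable_EFinP _ _).2 (measurable_normc_sqr mf).
have sq0 : {in D, forall y : R, 0 <= (normc (f y) ^+ 2)%:E}%E.
  by move=> t _; rewrite lee_fin sqr_ge0.
rewrite /Q2; transitivity (\int[mu]_(t in phi @^-1` D)
    ((fun y => (normc (f y) ^+ 2)%:E) \o phi) t)%E.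
  congr (integral _ _ _).
  by apply/seteqP; split => t /=; rewrite /phi pmulr_lgt0// invr_gt0.
rewrite -ge0_integral_pushforward//=.
rewrite -(ge0_integral_mscale mu measurable_pos (NngNum (ltW g0)) msq) //; last first.
  by move=> t _; rewrite lee_fin sqr_ge0.
by apply: eq_measure_integral => A mA _; exact: lebesgue_measure_dilation.
Qed.

(** Fatou's lemma for the squared moduli. A bound uniform in n survives a merely pointwise limit; no
    convergence in L^2 is asked for. *)
Lemma L2norm_fatou (f_ : nat -> R -> R[i]) f M : 0 <= M ->
  (forall n, measC (f_ n)) -> measC f ->
  (forall t, 0 < t -> cvg_lcs (E := complex_lcs R) (fun n => f_ n t) \oo (f t)) ->
  (forall n, (L2norm (f_ n) <= M%:E)%E) -> (L2norm f <= M%:E)%E.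
Proof.
move=> M0 mf_ mf f_f LM; apply/L2norm_le => //.
pose F n t := (normc (f_ n t) ^+ 2)%:E.
have := @fatou _ _ _ mu D measurable_pos F
  (fun n => (measurable_EFinP _ _).2 (measurable_normc_sqr (mf_ n)))
  (fun n t _ => ltac:(by rewrite lee_fin sqr_ge0)).
move=> H; apply: (le_trans _ (le_trans H _)).
- rewrite le_eqVlt; apply/orP; left; apply/eqP.
  apply: eq_integral => t; rewrite inE => t0; apply/esym/(@cvg_limn_einf_sup _ _ _ _).1.
  apply/cvg_EFin; first by near=> n.
  have /cvg_lcsP[h1 h2] := f_f t t0.
  rewrite normc_sqr (_ : fine \o _ = (fun n =>
      Re (f_ n t) * Re (f_ n t) + Im (f_ n t) * Im (f_ n t))); last first.
    by apply/funext => n; rewrite /F /= -!expr2; exact: normc_sqr.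
  by rewrite !expr2; apply: cvgD; exact: cvgM.
- rewrite limn_einf_lim; apply: lime_le; first exact: is_cvg_einfs.
  apply: nearW => n; apply: (@le_trans _ _ (\int[mu]_(t in D) F n t)%E).
    by apply: ereal_inf_lbound; exists n => /=.
  by apply/L2norm_le.
Unshelve. all: by end_near. Qed.

End L2_norm.

(** * The mean value inequality in L^2 by Riemann sums *)

Section L2_mean_value.
Variable R : realType.
Local Notation normc := Normc.normc.
Local Notation Re := complex.Re.
Local Notation Im := complex.Im.
Local Notation D := [set t : R | 0 < t].
Local Notation mu := (@lebesgue_measure R).

Definition contC (f : R -> R[i]) := forall t, 0 < t ->
  {for t, continuous (fun t => Re (f t))} /\ {for t, continuous (fun t => Im (f t))}.

Lemma open_pos : open D.
Proof. exact: open_gt. Qed.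

Lemma contC_measC f : contC f -> measC f.
Proof.
move=> cf; split; apply: open_continuous_measurable_fun; try exact: open_pos;
  by move=> t; rewrite inE/= => /cf[].
Qed.

(** By continuity a value different from 0 keeps the squared modulus above half of its value there
    on a whole interval, which makes the integral positive. *)
Lemma L2norm_eq0 f : contC f -> L2norm f = 0%E -> forall t, 0 < t -> f t = 0.
Proof.
move=> cf L0 t0 t00; apply: contrapT => /eqP ft0.
have Q0 : (Q2 f <= 0)%E.
  have : (L2norm f <= 0%:E)%E by rewrite L0.
  by move/(L2norm_le f (lexx 0)); rewrite expr0n.
pose c := normc (f t0) ^+ 2.
have c0 : 0 < c.
  rewrite exprn_gt0// lt0r normc_ge0 andbT; apply: contra_neq ft0.
  exact: Normc.eq0_normc.
have cc : {for t0, continuous (fun t => normc (f t) ^+ 2)}.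
  rewrite (_ : (fun t => _) = (fun t => Re (f t) * Re (f t) + Im (f t) * Im (f t))).
    have [h1 h2] := cf t0 t00; apply: cvgD; exact: cvgM.
  by apply/funext => t; rewrite normc_sqr !expr2.
have : \forall t \near t0, 0 < t /\ c / 2 < normc (f t) ^+ 2.
  apply: filterI; first exact: lt_nbhsr.
  apply: (cvgr_gt _ cc); rewrite ltr_pdivrMr// mulr2n mulrDr mulr1.
  by rewrite ltrDl.
move=> /nbhs_ballP[e /= e0 eP].
pose J := `]t0 - e, t0 + e[%classic.
have JP t : J t -> 0 < t /\ c / 2 < normc (f t) ^+ 2.
  by move=> Jt; apply: eP; rewrite ball_itv.
have mJ : measurable J by exact: measurable_itv.
have JD : J `<=` D by move=> t /JP[].
have msq := (measurable_EFinP _ _).2 (measurable_normc_sqr (contC_measC cf)).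
have : ((c / 2)%:E * mu J <= 0)%E.
  apply: le_trans Q0; rewrite -integral_cst//.
  apply: (@le_trans _ _ (\int[mu]_(t in J) (normc (f t) ^+ 2)%:E)%E).
    apply: ge0_le_integral => //.
    - by move=> t _; rewrite lee_fin divr_ge0// ltW.
    - by apply: measurable_funS msq => //; exact: measurable_pos.
    - by move=> t /JP[_ /ltW]; rewrite lee_fin.
  apply: ge0_subset_integral => //; first exact: measurable_pos.
  by move=> t _; rewrite lee_fin sqr_ge0.
apply/negP; rewrite -ltNge lebesgue_measure_itv/= lte_fin ltrD2l gt0_cp// -EFinB.
by rewrite -EFinM lte_fin mulr_gt0 ?divr_gt0//; lra.
Qed.

Lemma L2norm_sum_le N (F : nat -> R -> R[i]) (M : R) : (forall i, (i < N)%N -> measC (F i)) ->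
  (forall i, (i < N)%N -> (L2norm (F i) <= M%:E)%E) ->
  measC (fun t => \sum_(i < N) F i t) /\
  (L2norm (fun t => \sum_(i < N) F i t)%R <= (N%:R * M)%:E)%E.
Proof.
elim: N => [|N IH] mF LF.
  have E : (fun t : R => \sum_(i < 0) F i t) = (fun=> 0).
    by apply/funext => t; rewrite big_ord0.
  rewrite E mul0r; split; first exact: measC_cst.
  apply/(L2norm_le _ (lexx 0)); rewrite /Q2 expr0n /=.
  by rewrite integral0_eq// => t _; rewrite expr0n /= addr0 sqrtr0 expr0n.
have [m1 L1] := IH (fun i iN => mF i (ltnW iN)) (fun i iN => LF i (ltnW iN)).
have E : (fun t : R => \sum_(i < N.+1) F i t) =
    (fun t => \sum_(i < N) F i t + F N t).
  by apply/funext => t; rewrite big_ord_recr.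
rewrite E; split; first by apply: measC_add => //; exact: mF.
apply: (le_trans (L2normD m1 (mF N (ltnSn N)))).
by rewrite -natr1 mulrDl mul1r EFinD; apply: leeD => //; exact: LF.
Qed.

(** With d = h / (N + 1), each increment of f is d times a value of [f1], which differs from the
    value at the left endpoint by at most d B. This makes N + 1 errors of size d^2 B. The hypotheses
    are mean value statements instead of derivatives, since nothing is known outside [0, h]. *)
Lemma riemann_sum_error (f f1 f2 : R -> R) (h B : R) N : 0 < h ->
  (forall a b, 0 <= a -> a < b -> b <= h ->
    exists2 c, a < c < b & f b - f a = (b - a) * f1 c) ->
  (forall a b, 0 <= a -> a < b -> b <= h ->
    exists2 c, a < c < b & f1 b - f1 a = (b - a) * f2 c) ->
  (forall s, 0 <= s <= h -> `|f2 s| <= B) ->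
  `|f h - f 0 - \sum_(i < N.+1) (h / N.+1%:R) * f1 (i%:R * (h / N.+1%:R))|
    <= h ^+ 2 * B / N.+1%:R.
Proof.
move=> h0 H1 H2 HB; set d := h / N.+1%:R.
have d0 : 0 < d by rewrite divr_gt0.
have B0 : 0 <= B by apply: le_trans (HB 0 _); rewrite ?normr_ge0// lexx ltW.
have hd : h = N.+1%:R * d by rewrite /d mulrC divfK.
have -> : f h - f 0 = \sum_(i < N.+1) (f (i.+1%:R * d) - f (i%:R * d)).
  rewrite -(big_mkord xpredT (fun i => f (i.+1%:R * d) - f (i%:R * d))).
  by rewrite telescope_sumr// -hd mul0r.
rewrite -sumrB; apply: (le_trans (ler_norm_sum _ _ _)).
have -> : h ^+ 2 * B / N.+1%:R = \sum_(i < N.+1) (d * d * B).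
  by rewrite sumr_const card_ord -mulr_natl {1}hd /d; field; rewrite nat1r pnatr_eq0.
apply: ler_sum => i _.
have dih : i.+1%:R * d <= h by rewrite hd ler_pM2r// ler_nat.
have di0 : 0 <= i%:R * d by rewrite mulr_ge0// ltW.
have E : i.+1%:R * d = i%:R * d + d by rewrite -natr1 mulrDl mul1r.
have [||c /andP[c1 c2] ->] := H1 (i%:R * d) (i.+1%:R * d) di0.
- by rewrite E ltrDl.
- exact: dih.
rewrite E [_ + d - _]addrAC subrr add0r -mulrBr normrM gtr0_norm//.
rewrite -mulrA ler_pM2l//.
have [|c' /andP[c'1 c'2] ->] := H2 (i%:R * d) c di0 c1.
  exact: le_trans (ltW c2) dih.
rewrite normrM; apply: ler_pM => //.
- rewrite gtr0_norm ?subr_gt0// lerBlDl -E; exact: ltW.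
- by apply: HB; rewrite (le_trans di0 (ltW c'1))/= (le_trans (ltW c'2))// (le_trans (ltW c2)).
Qed.

(** By the triangle inequality every Riemann sum of [f1] has norm at most h M. The sums converge to
    the increment of f for each fixed t, and [L2norm_fatou] concludes. The second derivative [f2]
    only serves this pointwise convergence, so it is bounded for each t separately and not in
    L^2. *)
Lemma L2norm_mean_value (f f1 f2 : R -> R -> R) (h M : R) : 0 < h -> 0 <= M ->
  (forall s, 0 <= s <= h -> measurable_fun D (f s) /\ measurable_fun D (f1 s)) ->
  (forall t, 0 < t -> forall a b, 0 <= a -> a < b -> b <= h ->
    exists2 c, a < c < b & f b t - f a t = (b - a) * f1 c t) ->
  (forall t, 0 < t -> forall a b, 0 <= a -> a < b -> b <= h ->
    exists2 c, a < c < b & f1 b t - f1 a t = (b - a) * f2 c t) ->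
  (forall t, 0 < t -> exists B, forall s, 0 <= s <= h -> `|f2 s t| <= B) ->
  (forall s, 0 <= s <= h -> (L2norm (fun t => (f1 s t)%:C) <= M%:E)%E) ->
  (L2norm (fun t => (f h t - f 0 t)%:C)%R <= (h * M)%:E)%E.
Proof.
move=> h0 M0 mf H1 H2 HB LM.
pose S N t := \sum_(i < N.+1) (h / N.+1%:R)%:C * (f1 (i%:R * (h / N.+1%:R)) t)%:C.
have ok N i : (i < N.+1)%N -> 0 <= i%:R * (h / N.+1%:R) <= h.
  move=> iN; apply/andP; split; first by rewrite mulr_ge0// divr_ge0// ltW.
  by rewrite mulrA ler_pdivrMr// mulrC ler_pM2l// ler_nat ltnW.
have mC (g : R -> R) : measurable_fun D g -> measC (fun t => (g t)%:C).
  by move=> mg; split => //=; exact: measurable_cst.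
have HS N : measC (S N) /\ (L2norm (S N) <= (h * M)%:E)%E.
  have -> : h * M = N.+1%:R * (h / N.+1%:R * M) by field; rewrite nat1r pnatr_eq0.
  apply: (@L2norm_sum_le N.+1 (fun i t => (h / N.+1%:R)%:C *
    (f1 (i%:R * (h / N.+1%:R)) t)%:C)) => i iN; have [_ m1] := mf _ (ok _ _ iN).
    by apply: measC_mul; [exact: measC_cst|exact: mC].
  rewrite L2normZ; last exact: mC.
  rewrite normc_real ger0_norm; last by rewrite divr_ge0// ltW.
  rewrite [leRHS]EFinM.
  by rewrite lee_pmul2l ?lte_fin ?divr_gt0//; exact/LM/ok.
have h0h : 0 <= h <= h by rewrite lexx ltW.
have h00 : 0 <= (0:R) <= h by rewrite lexx ltW.
apply: (@L2norm_fatou R S); rewrite ?mulr_ge0// ?ltW//.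
- by move=> N; case: (HS N).
- apply: mC; apply: measurable_funB; [exact: (mf _ h0h).1|exact: (mf _ h00).1].
- move=> t t0; have [B HBt] := HB t t0.
  have SE N : S N t = (\sum_(i < N.+1) (h / N.+1%:R) * f1 (i%:R * (h / N.+1%:R)) t)%:C.
    by rewrite (rmorph_sum (real_complex R)); apply: eq_bigr => i _; rewrite -rmorphM.
  rewrite (_ : (fun n => _) = fun N => (\sum_(i < N.+1) (h / N.+1%:R) *
      f1 (i%:R * (h / N.+1%:R)) t)%:C); last by apply/funext => N; exact: SE.
  apply: cvg_lcsRC; apply/cvgrPdist_le => e e0.
  have := @cvg_harmonic R; move=> /cvgrPdist_le /(_ (e / (h ^+ 2 * B + 1))).
  have hB : 0 < h ^+ 2 * B + 1.
    rewrite ltr_wpDl// mulr_ge0 ?sqr_ge0//.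
    exact: le_trans (normr_ge0 _) (HBt 0 h00).
  move=> /(_ (divr_gt0 e0 hB)); apply: filterS => N.
  rewrite /harmonic /= sub0r normrN ger0_norm ?invr_ge0// ler_pdivlMr// => le_e.
  apply: le_trans (riemann_sum_error N h0 (H1 t t0) (H2 t t0) HBt) _.
  apply: le_trans le_e; rewrite mulrC ler_pM2l ?invr_gt0// lerDl//.
- by move=> N; case: (HS N).
Qed.

End L2_mean_value.

(** * The chain rule along a curve p + h v + eta(h) n *)

Section chain_rule.
Variables (R : realType) (W : normedModType R) (Om : set W).
Implicit Types (u w : W -> R[i]) (p v : W).
Local Notation normc := Normc.normc.
Local Notation Re := complex.Re.
Local Notation cvgC := (cvg_lcs (E := complex_lcs R)).
Local Notation cont := (continuous_along (E := complex_lcs R) Om).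
Local Notation isD := (is_D (E := complex_lcs R) Om).

(** The segment from 0 to h for either sign of h: the shift in x_n caused by a dilation may be
    negative. *)
Definition between (s h : R) := (0 <= s <= h) || (h <= s <= 0).

Lemma Re_MVT_between u u' v p h : (forall s, between s h -> Om (p + s *: v)) ->
  cont u -> isD v u u' -> exists2 s, between s h &
    Re (u (p + h *: v)) - Re (u p) = h * Re ('i * u' (p + s *: v)).
Proof.
move=> Oh cu du; case: (ltgtP 0 h) => [h0|h0|<-].
- have [s /andP[s0 sh] E] := Re_MVT h0 (fun s sh => Oh s (introT orP (or_introl sh))) cu du.
  by exists s => //; rewrite /between (ltW s0) (ltW sh).
- have Nh0 : 0 < - h by rewrite oppr_gt0.
  have Oh' s : 0 <= s <= - h -> Om (p + s *: - v).
    move=> /andP[s0 sh]; rewrite scalerN -scaleNr; apply: Oh.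
    by apply/orP; right; rewrite lerNr sh oppr_le0 s0.
  have [s /andP[s0 sh] E] := Re_MVT Nh0 Oh' cu (isDN du).
  exists (- s); first by apply/orP; right; rewrite lerNr (ltW sh) oppr_le0 (ltW s0).
  move: E; rewrite !scalerN !scaleNr opprK => ->.
  by case: (u' _) => a b /=; ring.
- exists 0; first by rewrite /between lexx.
  by rewrite scale0r addr0 subrr mul0r.
Qed.

(** The increment is split into the step h v followed by the step eta(h) n. The first is the
    derivative along v at p. The second starts at a point moving with h, so the mean value theorem
    and the continuity of [un] at p compare it with the derivative at p, with an error o(eta(h))
    ([key]). *)
Lemma isD_chain u ue un v n p (eta : R -> R) (eta' : R) (D : set R) :
  cont u -> cont un -> isD v u ue -> isD n u un -> Om p ->
  eta 0 = 0 -> h^-1 * eta h @[h --> 0^'] --> eta' ->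
  eta h @[h --> (0 : R)] --> 0 ->
  (forall h, D h -> Om (p + h *: v)) ->
  (forall h, D h -> forall s, between s (eta h) -> Om (p + h *: v + s *: n)) ->
  cvgC (fun h : R => (- 'i * (h^-1)%:C) * (u (p + h *: v + eta h *: n) - u p))
    (within D (0 : R)^') (ue p + eta'%:C * un p).
Proof.
move=> cu cun due dun Op eta0 deta ceta DO Dseg.
pose A h := (- 'i * (h^-1)%:C) * (u (p + h *: v) - u p).
pose B h := (- 'i * (h^-1)%:C) * (u (p + h *: v + eta h *: n) - u (p + h *: v)).
refine (cvg_lcs_eq _ (cvg_lcsD (f := A) (g := B) _ _)) => [h||].
- by rewrite /A /B; ring.
- apply/cvg_lcs_near => e e0; have /cvg_lcs_near /(_ e e0) := due p Op.
  by rewrite !near_withinE; apply: filterS => h + h0 Dh => /(_ h0 (DO _ Dh)).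
have key e : 0 < e -> \forall h \near (0 : R), D h ->
    normc (u (p + h *: v + eta h *: n) - u (p + h *: v) - (eta h)%:C * ('i * un p))
    <= e * `|eta h|.
  move=> e0; have e2 : 0 < e / 2 by rewrite divr_gt0.
  have /cvg_lcs_near /(_ _ e2) := cun p Op; rewrite near_withinE.
  move=> /nbhs_ballP[d /= d0 dP].
  pose M := `|v| + `|n| + 1; have M0 : 0 < M by rewrite ltr_wpDl ?addr_ge0.
  have small : \forall h \near (0 : R), `|h| < d / M /\ `|eta h| < d / M.
    apply: filterI; first by apply: (@nbhs0_lt R R); rewrite divr_gt0.
    have := cvgr0_norm_lt _ ceta (d / M); apply; by rewrite divr_gt0.
  apply: filterS small => h [hd etad] Dh.
  have Oz := Dseg h Dh.
  have zp s : between s (eta h) ->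
      normc (un (p + h *: v + s *: n) - un p) < e / 2.
    move=> sb; apply: dP; last exact: Oz.
    rewrite -ball_normE /= -addrA opprD addrA subrr add0r normrN.
    have se : `|s| <= `|eta h|.
      case/orP: sb => /andP[s1 s2]; first by rewrite !ger0_norm// (le_trans s1).
      by rewrite !ler0_norm ?lerN2// (le_trans s1).
    apply: (le_lt_trans (ler_normD _ _)); rewrite !normrZ.
    apply: (@le_lt_trans _ _ (d / M * (`|v| + `|n|))).
      by rewrite mulrDr lerD// ler_wpM2r// ltW// (le_lt_trans se).
    by rewrite -mulrA gtr_pMr// mulrC ltr_pdivrMr// mul1r /M ltrDl.
  have part w wn : cont w -> isD n w wn ->
      (forall s, between s (eta h) -> normc (wn (p + h *: v + s *: n) - wn p) < e / 2) ->
      `|Re (w (p + h *: v + eta h *: n) - w (p + h *: v) - (eta h)%:C * ('i * wn p))|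
        <= e / 2 * `|eta h|.
    move=> cw dw H; have [s sb E] := Re_MVT_between Oz cw dw.
    rewrite Re_sub Re_sub E.
    have -> : Re ((eta h)%:C * ('i * wn p)) = eta h * Re ('i * wn p).
      by case: (wn p) => ? ? /=; ring.
    rewrite -mulrBr normrM mulrC ler_wpM2r//; apply/ltW/(le_lt_trans _ (H s sb)).
    rewrite -Re_sub -mulrBr (le_trans (normc_Re _))// Normc.normcM.
    by rewrite /= expr0n expr1n add0r sqrtr1 mul1r.
  apply: (le_trans (le_normc_ReIm _)); rewrite (splitr e) mulrDl; apply: lerD.
    exact: part.
  (* The imaginary part is [part] applied to -i u. *)
  have H s : between s (eta h) ->
      normc (- 'i * un (p + h *: v + s *: n) - (- 'i * un p)) < e / 2.
    move=> sb; rewrite -mulrBr Normc.normcM.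
    rewrite [normc (- _)](_ : _ = 1) ?mul1r; first exact: zp.
    by rewrite normcN /= expr0n expr1n add0r sqrtr1.
  have := part _ _ (contM (@cont_cst _ _ Om (- 'i)) cu) (isDZ (- 'i) dun) H.
  congr (`|_| <= _); move: (u _) (u _) (un _) => [? ?] [? ?] [? ?] /=; ring.
have lim2 : cvgC (fun h => (h^-1 * eta h)%:C * un p) (0 : R)^' (eta'%:C * un p).
  exact: cvg_lcsM (cvg_lcsRC deta) (cvg_lcs_cst _).
apply/cvg_lcs_near => e e0; rewrite near_withinE.
pose K := `|eta'| + 1; have K0 : 0 < K by rewrite ltr_wpDl.
have bd : \forall h \near (0 : R)^', `|h^-1 * eta h| < K.
  by apply: (cvgr_norm_lt _ deta); rewrite ltrDl.
have /cvg_lcs_near /(_ _ (divr_gt0 e0 (ltr0Sn R 1))) := lim2 => lim2'.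
have keyK := nbhs_dnbhs (key _ (divr_gt0 (divr_gt0 e0 (ltr0Sn R 1)) K0)).
apply: filterS3 bd lim2' keyK => h bdh l2 kh Dh.
rewrite (splitr e) -(subrKA ((h^-1 * eta h)%:C * un p)).
apply: (le_lt_trans (le_normcD _ _)); apply: ler_ltD l2.
have -> : B h - (h^-1 * eta h)%:C * un p = (- 'i * (h^-1)%:C) *
  (u (p + h *: v + eta h *: n) - u (p + h *: v) - (eta h)%:C * ('i * un p)).
  rewrite /B; move: (u _) (u _) (un _) => [? ?] [? ?] [? ?]; simpc.
  by apply/eqP; rewrite eq_complex /=; apply/andP; split; apply/eqP; ring.
rewrite !Normc.normcM normcN normc_real.
rewrite [normc 'i](_ : _ = 1) ?mul1r; last by rewrite /= expr0n expr1n add0r sqrtr1.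
apply: (le_trans (ler_wpM2l (normr_ge0 _) (kh Dh))).
rewrite mulrCA -normrM -[leRHS](divfK (lt0r_neq0 K0)) ler_wpM2l ?(ltW bdh)//.
by rewrite !divr_ge0// ltW.
Qed.

End chain_rule.

(** * Graded classes of symbol-kernels *)

Section kernel_domain.
Variables (R : realType) (m : nat).
Implicit Types (u w : kvar R m -> R[i]) (p v : kvar R m).
Local Notation normc := Normc.normc.
Local Notation cvgC := (cvg_lcs (E := complex_lcs R)).
Local Notation Om := (@kdom R m).
Local Notation dir := (@kdir R m).
Local Notation cont := (continuous_along (E := complex_lcs R) Om).
Local Notation isD := (is_D (E := complex_lcs R) Om).
Local Notation nn := (inl (inl (inr tt)) : kcoord m).

Lemma kdir_sndE p i (h : R) : (p + h *: dir i).2 = p.2 + h * (i == inr tt)%:R.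
Proof.
by case: i => [[[i|[]]|i]|[]] /=; rewrite ?scaler0 ?mulr0// /GRing.scale/= mulr1.
Qed.

Lemma kdir_xnE p i (h : R) : (p + h *: dir i).1.1.2 = p.1.1.2 + h * (i == nn)%:R.
Proof.
by case: i => [[[i|[]]|i]|[]] /=; rewrite ?scaler0 ?mulr0// /GRing.scale/= mulr1.
Qed.

Lemma kdir_xiE p i (h : R) k : (p + h *: dir i).1.2 0 k =
  p.1.2 0 k + h * (i == inl (inr k))%:R.
Proof.
case: i => [[[i|[]]|i]|[]] /=; rewrite ?scaler0 !mxE ?mulr0//.
by congr (_ + _ * (nat_of_bool _)%:R); rewrite eqxx/=; apply/eqP/eqP => [->|[->]].
Qed.

Lemma kdom_dir p i (h : R) : Om p -> 0 <= h -> Om (p + h *: dir i).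
Proof.
move=> [p1 p2] h0; split; rewrite ?kdir_sndE ?kdir_xnE.
- by rewrite ltr_wpDr// mulr_ge0.
- by rewrite addr_ge0// mulr_ge0.
Qed.

Lemma kdir_xn x t xi mu (h : R) :
  (x, t, xi, mu) + h *: dir nn = (x, t + h, xi, mu) :> kvar R m.
Proof.
by congr (_, _, _, _); rewrite /= ?scaler0 ?addr0// [_ *: _]mulr1.
Qed.

Lemma slice_contC u x xi mu : cont u -> 0 <= mu ->
  contC (fun t => u (x, t, xi, mu)).
Proof.
move=> cu mu0 t t0; have Op : Om (x, t, xi, mu) by [].
pose proof (@cont_line _ _ Om u _ (dir nn) cu Op) as H.
have H2 : cvgC (fun h : R => u (x, t + h, xi, mu)) (nbhs (0 : R)) (u (x, t, xi, mu)).
  apply/cvg_lcs_near => e e0; have /cvg_lcs_near /(_ e e0) := H.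
  rewrite near_withinE => {}H.
  have : \forall h \near (0:R), - t < h by apply: lt_nbhsr; rewrite oppr_lt0.
  apply: filterS2 H => h /= + th; rewrite kdir_xn; apply; split => //=.
  by rewrite -ltrBlDl sub0r.
have H3 : cvgC (fun s : R => u (x, s, xi, mu)) (nbhs t) (u (x, t, xi, mu)).
  apply/cvg_lcs_near => e e0; have /cvg_lcs_near /(_ e e0) := H2 => {}H2.
  have N : s - t @[s --> t] --> (0:R).
    by rewrite -(subrr t); apply: cvgB; [exact: cvg_id|exact: cvg_cst].
  have NH : \forall s \near t, normc (u (x, t + (s - t), xi, mu) - u (x, t, xi, mu)) < e
    := N _ H2.
  by apply: filterS NH => s; rewrite subrKC.
by have /cvg_lcsP := H3.
Qed.

Lemma slice_measC u x xi mu : cont u -> 0 <= mu ->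
  measC (fun t => u (x, t, xi, mu)).
Proof. by move=> cu mu0; apply: contC_measC; exact: slice_contC. Qed.

Lemma real_isD (f f' : kvar R m -> R) v :
  (forall p, Om p -> is_derive (0 : R) 1 (fun h : R => f (p + h *: v)) (f' p)) ->
  isD v (fun p => (f p)%:C) (fun p => - 'i * (f' p)%:C).
Proof.
move=> H p Op; have [+ +] := H p Op; rewrite /derive => /cvg_ex[l Hl] E.
have {}E : l = f' p by rewrite -E; apply/esym/cvg_lim.
subst l.
pose proof (cvg_lcsM (cvg_lcs_cst (- 'i : R[i])) (cvg_lcsRC Hl)) as H2.
apply/cvg_lcs_near => e e0; have /cvg_lcs_near /(_ e e0) := H2.
rewrite near_withinE; apply: filterS => h /= + _.
rewrite [h%:A](mulr1 h) addr0 scale0r addr0.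
apply: le_lt_trans; rewrite le_eqVlt; apply/orP; left; apply/eqP.
by rewrite /GRing.scale/=; congr (Num.sqrt (_ ^+ 2 + _ ^+ 2)); ring.
Qed.

Lemma real_cont (f : kvar R m -> R) : continuous f -> cont (fun p => (f p)%:C).
Proof.
move=> cf p Op; apply/cvg_lcs_near => e e0; rewrite near_withinE.
have /cvgrPdist_lt /(_ e e0) := cf p; apply: filterS => q + _.
by rewrite -(rmorphB (real_complex R)) normc_real distrC.
Qed.

Variable eps : bool.

(* [jap] and [jap2] are the square roots of [bracket] for [eps = false] and
   [eps = true]. *)
Definition bracket p : R := 1 + \sum_(k < m) p.1.2 0 k ^+ 2 + eps%:R * p.2 ^+ 2.

(** Along a coordinate line [bracket] is a quadratic polynomial in the step; [bracket_d] and
    [bracket_dd] are its coefficients of degree one and two. *)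
Definition bracket_d (i : kcoord m) p : R :=
  match i with
  | inl (inr k) => 2 * p.1.2 0 k
  | inr _ => 2 * eps%:R * p.2
  | _ => 0
  end.

Definition bracket_dd (i : kcoord m) : R :=
  match i with inl (inr k) => 1 | inr _ => eps%:R | _ => 0 end.

Lemma bracket_ge1 p : 1 <= bracket p.
Proof.
rewrite /bracket -addrA lerDl addr_ge0//; last by rewrite mulr_ge0// sqr_ge0.
by apply: sumr_ge0 => k _; rewrite sqr_ge0.
Qed.

Lemma bracket_gt0 p : 0 < bracket p.
Proof. exact: lt_le_trans (bracket_ge1 p). Qed.

Lemma bracket_line p i (h : R) : bracket (p + h *: dir i) =
  bracket p + h * bracket_d i p + h ^+ 2 * bracket_dd i.
Proof.
rewrite /bracket kdir_sndE; under eq_bigr do rewrite kdir_xiE.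
have S0 : \sum_(k < m) (p.1.2 0 k + 0) ^+ 2 = \sum_(k < m) p.1.2 0 k ^+ 2.
  by apply: eq_bigr => k _; rewrite addr0.
case: i => [[[i|[]]|i]|[]] /=; rewrite ?mulr0 ?addr0 ?S0//; last by ring.
rewrite (bigD1 i)//= eqxx mulr1 [in RHS](bigD1 i)//=.
rewrite (eq_bigr (fun k => p.1.2 0 k ^+ 2)); first ring.
move=> k ki; case: eqP => [[ik]|_]; first by rewrite ik eqxx in ki.
by rewrite mulr0 addr0.
Qed.

Lemma bracket_continuous : continuous bracket.
Proof.
move=> p; apply: cvgD; last first.
  apply: cvgM; first exact: cvg_cst.
  by rewrite expr2; under eq_fun do rewrite expr2; apply: cvgM; exact: cvg_snd.
apply: cvgD; first exact: cvg_cst.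
apply: (@cvg_big _ _ +%R) => [x|k _]; first exact: add_continuous.
have H : (fun q : kvar R m => q.1.2 0 k) @ p --> p.1.2 0 k.
  apply: (@cvg_comp _ _ _ (fun q : kvar R m => q.1.2)
    (fun M : 'rV[R]_m => M 0 k) (nbhs p) (nbhs p.1.2) (nbhs (p.1.2 0 k))).
    apply: (@cvg_comp _ _ _ (fun q : kvar R m => q.1)
      (fun q : 'rV[R]_m * R^o * 'rV[R]_m => q.2) (nbhs p) (nbhs p.1) (nbhs p.1.2)).
      exact: cvg_fst.
    exact: cvg_snd.
  exact: coord_continuous.
by rewrite expr2; under eq_fun do rewrite expr2; apply: cvgM.
Qed.

Lemma is_derive_bracket p i r :
  is_derive (0 : R) 1 (fun h : R => bracket (p + h *: dir i) `^ r)
    (r * bracket p `^ (r - 1) * bracket_d i p).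
Proof.
rewrite (_ : (fun h : R => _) = (fun x => x `^ r) \o (fun h =>
    bracket p + h * bracket_d i p + h ^+ 2 * bracket_dd i)); last first.
  by apply/funext => h /=; rewrite bracket_line.
have d1 : is_derive (0:R) 1 (fun h : R =>
    bracket p + h * bracket_d i p + h ^+ 2 * bracket_dd i) (bracket_d i p).
  apply: is_derive_eq; rewrite /GRing.scale /=; ring.
have E : bracket p + 0 * bracket_d i p + 0 ^+ 2 * bracket_dd i = bracket p by ring.
have d2 : is_derive (bracket p + 0 * bracket_d i p + 0 ^+ 2 * bracket_dd i) 1
    (fun x : R => x `^ r) (r * bracket p `^ (r - 1)).
  by rewrite E; apply: is_derive1_powR; exact: bracket_gt0.
by apply: is_derive_eq; rewrite /GRing.scale /= mulrC.
Qed.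

Lemma isD_bracket i r : isD (dir i) (fun p => (bracket p `^ r)%:C)
  (fun p => - 'i * (r * bracket p `^ (r - 1) * bracket_d i p)%:C).
Proof. by apply: real_isD => p Op; exact: is_derive_bracket. Qed.

Lemma powR_bracket_continuous r : continuous (fun p => bracket p `^ r).
Proof.
move=> p; apply: (cvg_comp bracket (fun x => x `^ r)).
  exact: bracket_continuous.
have [/derivable1_diffP d _] := @is_derive1_powR R r (bracket p) (bracket_gt0 p).
have H : {for bracket p, continuous (fun x : R => x `^ r)}.
  exact: (differentiable_continuous d).
exact: H.
Qed.

End kernel_domain.

(** * Graded coefficients: coordinates and inverse brackets *)

Section symbol_classes.
Variables (R : realType) (m : nat).
Implicit Types (u w c : kvar R m -> R[i]) (p v : kvar R m).
Local Notation normc := Normc.normc.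
Local Notation Om := (@kdom R m).
Local Notation dir := (@kdir R m).
Local Notation cont := (continuous_along (E := complex_lcs R) Om).
Local Notation nn := (inl (inl (inr tt)) : kcoord m).

(* A grade (l', a, b) counts the derivatives in x_n, xi' and mu; coefficients
   multiplying kernels may have negative grades: x_n has grade (-1, 0, 0). *)
Definition grade : nmodType := (int * R * R)%type.

Definition kgrade (i : kcoord m) : grade :=
  match i with
  | inl (inl (inl _)) => 0
  | inl (inl (inr _)) => (1, 0, 0)
  | inl (inr _) => (0, 1, 0)
  | inr _ => (0, 0, 1)
  end.

Lemma jap_ge1 (xi : 'rV[R]_m) : 1 <= jap xi.
Proof.
rewrite -sqrtr1 ler_sqrt; last by rewrite addr_ge0// sumr_ge0// => k _; rewrite sqr_ge0.
by rewrite lerDl sumr_ge0// => k _; rewrite sqr_ge0.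
Qed.

Lemma jap_gt0 (xi : 'rV[R]_m) : 0 < jap xi.
Proof. exact: lt_le_trans (jap_ge1 xi). Qed.

Lemma le_jap2 (xi : 'rV[R]_m) mu : jap xi <= jap2 xi mu.
Proof.
rewrite ler_sqrt ?lerDl ?sqr_ge0//.
by rewrite addr_ge0 ?sqr_ge0// addr_ge0// sumr_ge0// => k _; rewrite sqr_ge0.
Qed.

Lemma jap2_gt0 (xi : 'rV[R]_m) mu : 0 < jap2 xi mu.
Proof. exact: lt_le_trans (jap_gt0 xi) (le_jap2 xi mu). Qed.

Lemma normr_xi_le (xi : 'rV[R]_m) k : `|xi 0 k| <= jap xi.
Proof.
rewrite -sqrtr_sqr ler_sqrt; last by rewrite addr_ge0// sumr_ge0// => j _; rewrite sqr_ge0.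
by rewrite (bigD1 k)//= addrCA lerDl addr_ge0// sumr_ge0// => j _; rewrite sqr_ge0.
Qed.

Lemma normr_mu_le (xi : 'rV[R]_m) mu : `|mu| <= jap2 xi mu.
Proof.
rewrite -sqrtr_sqr ler_sqrt.
  by rewrite lerDr addr_ge0// sumr_ge0// => j _; rewrite sqr_ge0.
by rewrite addr_ge0 ?sqr_ge0// addr_ge0// sumr_ge0// => j _; rewrite sqr_ge0.
Qed.

Lemma bracket_jap p : bracket false p = jap p.1.2 ^+ 2.
Proof.
rewrite sqr_sqrtr ?/bracket ?mul0r ?addr0//.
by rewrite addr_ge0// sumr_ge0// => j _; rewrite sqr_ge0.
Qed.

Lemma bracket_jap2 p : bracket true p = jap2 p.1.2 p.2 ^+ 2.
Proof.
rewrite sqr_sqrtr ?/bracket ?mul1r//.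
by rewrite addr_ge0 ?sqr_ge0// addr_ge0// sumr_ge0// => j _; rewrite sqr_ge0.
Qed.

Definition coef_weight (g : grade) p : R :=
  p.1.1.2 `^ (- g.1.1%:~R) *
    (jap p.1.2 `^ (- g.1.2) * jap2 p.1.2 p.2 `^ (- g.2)).

(** A coefficient of positive x_n-grade has to vanish, as the x_n-derivative of a constant does: its
    weight would be a negative power of x_n, which cannot be absorbed into the factor x_n^l of a
    kernel estimate when l is small. *)
Definition coef_bound (g : grade) c := exists C : R, [/\ 0 <= C,
  0 < g.1.1 -> C = 0 &
  forall p, Om p -> normc (c p) <= C * coef_weight g p].

Lemma coef_weightD g1 g2 p : Om p ->
  coef_weight (g1 + g2) p = coef_weight g1 p * coef_weight g2 p.
Proof.
move=> [p1 _]; have jp := jap_gt0 p.1.2; have j2p := jap2_gt0 p.1.2 p.2.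
rewrite /coef_weight /= rmorphD /= !opprD !powRD; last 3 first.
- by rewrite (gt_eqF j2p) implybT.
- by rewrite (gt_eqF jp) implybT.
- by rewrite (gt_eqF p1) implybT.
ring.
Qed.

Lemma coef_bound_ext g c c' : (forall p, Om p -> c p = c' p) ->
  coef_bound g c -> coef_bound g c'.
Proof.
by move=> cc [C [C0 Cg H]]; exists C; split => // p Op; rewrite -cc//; exact: H.
Qed.

Lemma coef_boundD g c c' : cont c -> cont c' -> coef_bound g c -> coef_bound g c' ->
  coef_bound g (fun p => c p + c' p).
Proof.
move=> _ _ [C [C0 Cg H]] [C' [C'0 C'g H']]; exists (C + C'); split.
- exact: addr_ge0.
- by move=> g0; rewrite Cg// C'g// addr0.
- move=> p Op; rewrite mulrDl; apply: (le_trans (le_normcD _ _)).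
  by apply: lerD; [exact: H|exact: H'].
Qed.

Lemma coef_boundM g g' c c' : cont c -> cont c' -> coef_bound g c -> coef_bound g' c' ->
  coef_bound (g + g') (fun p => c p * c' p).
Proof.
move=> _ _ [C [C0 Cg H]] [C' [C'0 C'g H']]; exists (C * C'); split.
- exact: mulr_ge0.
- move=> /= gg; have [/Cg ->|g0] := ltP 0 g.1.1; first by rewrite mul0r.
  by rewrite C'g ?mulr0// (lt_le_trans gg)// gerDr.
- move=> p Op; rewrite coef_weightD// Normc.normcM mulrACA.
  by apply: ler_pM; rewrite ?normc_ge0 ?H ?H'.
Qed.

Local Notation CNc := (CN Om dir kgrade coef_bound).

Lemma CNc_mul N g1 g2 c1 c2 : CNc N g1 c1 -> CNc N g2 c2 ->
  CNc N (g1 + g2) (fun p => c1 p * c2 p).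
Proof.
exact: (CN_mul (P1 := coef_bound) (P2 := coef_bound) (P3 := coef_bound)
  coef_bound_ext coef_boundD coef_boundM).
Qed.

Lemma CNc_ext N g c c' : (forall p, Om p -> c p = c' p) -> CNc N g c -> CNc N g c'.
Proof. exact: (CN_ext coef_bound_ext). Qed.

Lemma CNc0 N g : CNc N g (fun=> 0).
Proof.
elim: N g => [|N IH] g.
  split; [exact: cont_cst| |exact: Logic.I].
  exists 0; split => // p Op; rewrite mul0r.
  by rewrite -[0 in leLHS]/(0%:C : R[i]) normc_real normr0.
split; [exact: cont_cst|exact: CN_P (IH g)|].
by move=> i; exists (fun=> 0); [exact: isD_cst|exact: IH].
Qed.

Lemma CNc_cst N (a : R[i]) : CNc N 0 (fun=> a).
Proof.
have b : coef_bound 0 (fun=> a).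
  exists (normc a); split => //; first exact: normc_ge0.
  by move=> p Op; rewrite /coef_weight /= oppr0 !powRr0 !mulr1.
case: N => [|N]; split; [exact: cont_cst|exact: b|exact: Logic.I|exact: cont_cst
  |exact: b|].
by move=> i; exists (fun=> 0); [exact: isD_cst|exact: CNc0].
Qed.

(** The derivatives are constants, and in the directions where they do not vanish they have grade 0;
    the recursion stops after one step. *)
Lemma CNc_affine N g (f : kvar R m -> R) (a : kcoord m -> R) :
  continuous f -> (forall p i h, f (p + h *: dir i) = f p + h * a i) ->
  (forall i, a i = 0 \/ g + kgrade i = 0) ->
  coef_bound g (fun p => (f p)%:C) -> CNc N g (fun p => (f p)%:C).
Proof.
move=> cf fl ga b; case: N => [|N]; split;
  [exact: real_cont|exact: b|exact: Logic.I|exact: real_cont|exact: b|].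
move=> i; exists (fun=> - 'i * (a i)%:C).
  apply: real_isD => p Op; rewrite (_ : (fun h => _) = (fun h => f p + h * a i)).
    by apply: is_derive_eq; rewrite /GRing.scale/=; ring.
  by apply/funext => h; rewrite fl.
have [->|->] := ga i; last exact: CNc_cst.
by rewrite mulr0; exact: CNc0.
Qed.

Lemma CNc_xn N : CNc N (- 1, 0, 0) (fun p => (p.1.1.2)%:C).
Proof.
apply: (@CNc_affine _ _ (fun p => p.1.1.2) (fun i => (i == nn)%:R)).
- move=> p; apply: (@cvg_comp _ _ _ (fun q : kvar R m => q.1.1)
    (fun q : 'rV[R]_m * R^o => q.2) (nbhs p) (nbhs p.1.1)); last exact: cvg_snd.
  apply: (@cvg_comp _ _ _ (fun q : kvar R m => q.1)
    (fun q : 'rV[R]_m * R^o * 'rV[R]_m => q.1) (nbhs p) (nbhs p.1)); exact: cvg_fst.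
- exact: kdir_xnE.
- case=> [[[i|[]]|i]|[]]; [by left|right|by left|by left].
  by congr (_, _, _); rewrite /= ?addr0 ?addNr.
- exists 1; split => // p [p1 _].
  rewrite normc_real gtr0_norm// mul1r /coef_weight /= !oppr0 !powRr0 !mulr1.
  by rewrite mulrN1z opprK powRr1// ltW.
Qed.

Lemma CNc_xi N k : CNc N (0, - 1, 0) (fun p => (p.1.2 0 k)%:C).
Proof.
apply: (@CNc_affine _ _ (fun p => p.1.2 0 k) (fun i => (i == inl (inr k))%:R)).
- move=> p; apply: (@cvg_comp _ _ _ (fun q : kvar R m => q.1.2)
    (fun M : 'rV[R]_m => M 0 k) (nbhs p) (nbhs p.1.2) (nbhs (p.1.2 0 k))).
    apply: (@cvg_comp _ _ _ (fun q : kvar R m => q.1)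
      (fun q : 'rV[R]_m * R^o * 'rV[R]_m => q.2) (nbhs p) (nbhs p.1) (nbhs p.1.2)).
      exact: cvg_fst.
    exact: cvg_snd.
  exact: coord_continuous.
- by move=> p i h; exact: kdir_xiE.
- case=> [[[i|[]]|i]|[]]; [by left|by left|right|by left].
  by congr (_, _, _); rewrite /= ?addr0 ?addNr.
- exists 1; split => // p [p1 _].
  rewrite normc_real mul1r /coef_weight /= !oppr0 !powRr0 mulr1 mul1r.
  by rewrite opprK powRr1 ?normr_xi_le// ltW// jap_gt0.
Qed.

Lemma CNc_mu N : CNc N (0, 0, - 1) (fun p => (p.2)%:C).
Proof.
apply: (@CNc_affine _ _ (fun p => p.2) (fun i => (i == inr tt)%:R)).
- by move=> p; exact: cvg_snd.
- exact: kdir_sndE.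
- case=> [[[i|[]]|i]|[]]; [by left|by left|by left|right].
  by congr (_, _, _); rewrite /= ?addr0 ?addNr.
- exists 1; split => // p [p1 _].
  rewrite normc_real mul1r /coef_weight /= !oppr0 !powRr0 !mul1r.
  by rewrite opprK powRr1 ?normr_mu_le// ltW// jap2_gt0.
Qed.

Variable eps : bool.

(** As <xi'> is at most <xi',mu>, the decay <xi',mu>^-2 may be shared between the two brackets in
    any proportion a + b = 2. The freedom is needed because a xi'-derivative must gain a power of
    <xi'> and a mu-derivative a power of <xi',mu>. *)
Lemma CNc_bracket_inv N (a b : R) : 0 <= a -> 0 <= b -> a + b = 2 -> (~~ eps -> b = 0) ->
  CNc N (0, a, b) (fun p => (bracket eps p `^ (- 1))%:C).
Proof.
move=> a0 b0 ab eb.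
have bound a' b' : 0 <= a' -> 0 <= b' -> a' + b' = 2 -> (~~ eps -> b' = 0) ->
    coef_bound (0, a', b') (fun p => (bracket eps p `^ (- 1))%:C).
  move=> a'0 b'0 ab' eb'; exists 1; split => // p Op.
  rewrite normc_real mul1r ger0_norm ?powR_ge0//.
  rewrite /coef_weight/= oppr0 powRr0 mul1r.
  move: eb'; case: eps => [_|/(_ isT) b'E].
    rewrite bracket_jap2 -powR_mulrn ?(ltW (jap2_gt0 _ _))// -powRrM.
    have -> : 2 * -1 = - a' + - b' :> R by rewrite -opprD ab' mulrN1.
    rewrite powRD; last by apply/implyP => _; rewrite gt_eqF// jap2_gt0.
    rewrite ler_wpM2r ?powR_ge0//.
    rewrite !powRN lef_pV2 ?posrE ?powR_gt0 ?jap_gt0 ?jap2_gt0//.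
    by apply: ge0_ler_powR; rewrite ?nnegrE ?le_jap2 ?(ltW (jap_gt0 _)) ?(ltW (jap2_gt0 _ _)).
  have -> : a' = 2 by rewrite -ab' b'E addr0.
  rewrite b'E oppr0 powRr0 mulr1 bracket_jap -powR_mulrn ?(ltW (jap_gt0 _))//.
  by rewrite -powRrM mulrN1.
elim: N a b a0 b0 ab eb => [|N IH] a b a0 b0 ab eb; split;
  [apply: real_cont; exact: powR_bracket_continuous|exact: bound|exact: Logic.I|
   apply: real_cont; exact: powR_bracket_continuous|exact: bound|].
have IHab := IH a b a0 b0 ab eb.
move=> i; eexists; first exact: isD_bracket.
have E p : bracket eps p `^ (-1 - 1) = bracket eps p `^ (-1) * bracket eps p `^ (-1).
  by rewrite powRD//; apply/implyP => _; rewrite gt_eqF// bracket_gt0.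
case: i => [[[i|[]]|k]|[]].
- apply: CNc_ext (CNc0 _ _) => p Op.
  by apply/eqP; rewrite eq_complex /=; apply/andP; split; apply/eqP; ring.
- apply: CNc_ext (CNc0 _ _) => p Op.
  by apply/eqP; rewrite eq_complex /=; apply/andP; split; apply/eqP; ring.
(* The derivative is 2 i xi_k times two inverse brackets: one, of grade (0, 2, 0), outweighs xi_k
   and leaves the grade of the derivative; the other keeps (0, a, b). *)
- have I2 := IH 2 0 (ler0n _ _) (lexx _) (addr0 _) (fun _ => erefl).
  have := CNc_mul (CNc_cst N (2%:R * 'i)) (CNc_mul (CNc_xi N k) (CNc_mul I2 IHab)).
  have -> : 0 + ((0, -1, 0) + ((0, 2, 0) + (0, a, b))) =
      (0, a, b) + kgrade (inl (inr k)) :> grade.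
    by congr (_, _, _); rewrite /=; ring.
  apply: CNc_ext => p Op; rewrite E.
  by apply/eqP; rewrite eq_complex /=; apply/andP; split; apply/eqP; ring.
- move: IH IHab E eb bound; case: eps => IH IHab E eb bound; last first.
    apply: CNc_ext (CNc0 _ _) => p Op.
    by apply/eqP; rewrite eq_complex /=; apply/andP; split; apply/eqP; ring.
  have I2 := IH 0 2 (lexx _) (ler0n _ _) (add0r _) (fun h => False_ind _ (notF h)).
  have := CNc_mul (CNc_cst N (2%:R * 'i)) (CNc_mul (CNc_mu N) (CNc_mul I2 IHab)).
  have -> : 0 + ((0, 0, -1) + ((0, 0, 2) + (0, a, b))) =
      (0, a, b) + kgrade (inr tt) :> grade.
    by congr (_, _, _); rewrite /=; ring.
  apply: CNc_ext => p Op; rewrite E.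
  by apply/eqP; rewrite eq_complex /=; apply/andP; split; apply/eqP; ring.
Qed.

(* Differentiating a dilation in xi' or mu only produces this factor, which is
   graded like the derivative itself, besides the operator x_n D_(x_n) of grade 0. *)
Lemma CNc_log_derivative N i : i != nn ->
  CNc N (kgrade i) (fun p => (bracket_d eps i p * bracket eps p `^ (- 1))%:C).
Proof.
case: i => [[[i|[]]|k]|[]] // _.
- by apply: CNc_ext (CNc0 _ _) => p Op; rewrite /= mul0r.
- have I2 := @CNc_bracket_inv N 2 0 (ler0n _ _) (lexx _) (addr0 _) (fun _ => erefl).
  have := CNc_mul (CNc_cst N 2%:R) (CNc_mul (CNc_xi N k) I2).
  have -> : 0 + ((0, -1, 0) + (0, 2, 0)) = kgrade (inl (inr k)) :> grade.
    by congr (_, _, _); rewrite /=; ring.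
  apply: CNc_ext => p Op.
  by apply/eqP; rewrite eq_complex /=; apply/andP; split; apply/eqP; ring.
- move: CNc_bracket_inv; case: eps => Bi; last first.
    by apply: CNc_ext (CNc0 _ _) => p Op; rewrite /= mulr0 !mul0r.
  have I2 := Bi N 0 2 (lexx _) (ler0n _ _) (add0r _) (fun h => False_ind _ (notF h)).
  have := CNc_mul (CNc_cst N 2%:R) (CNc_mul (CNc_mu N) I2).
  have -> : 0 + ((0, 0, -1) + (0, 0, 2)) = kgrade (inr tt) :> grade.
    by congr (_, _, _); rewrite /=; ring.
  apply: CNc_ext => p Op.
  by apply/eqP; rewrite eq_complex /=; apply/andP; split; apply/eqP; ring.
Qed.

End symbol_classes.

(** * Kernels with weighted L^2 estimates as a module over the coefficients *)

Section kernel_classes.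
Variables (R : realType) (m : nat) (nu delta : R).
Implicit Types (u w c : kvar R m -> R[i]) (p v : kvar R m).
Implicit Types (L : int -> Prop) (sigma : 'rV[R]_m -> R -> R).
Local Notation normc := Normc.normc.
Local Notation Om := (@kdom R m).
Local Notation dir := (@kdir R m).
Local Notation cont := (continuous_along (E := complex_lcs R) Om).
Local Notation grade := (grade R).
Local Notation kgrade := (@kgrade R m).

Definition kernel_weight sigma (l : nat) (g : grade) (xi : 'rV[R]_m) mu : R :=
  sigma xi mu `^ (l%:R - g.1.1%:~R) *
    (jap xi `^ (nu - g.1.2) * jap2 xi mu `^ (delta - g.2)).

(* sigma is the weight of each surplus factor x_n; L selects the regime of
   l - l', namely l >= l', l <= l' or l = l'. *)
Definition kernel_bound L sigma (g : grade) u :=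
  forall l : nat, L (l%:Z - g.1.1) -> exists2 C : R, 0 <= C &
    forall x xi mu, 0 <= mu ->
      (L2norm (fun t => ((t ^+ l)%:C * u (x, t, xi, mu))%R)
        <= (C * kernel_weight sigma l g xi mu)%:E)%E.

Lemma kernel_bound_ext L sigma g u w : (forall p, Om p -> u p = w p) ->
  kernel_bound L sigma g u -> kernel_bound L sigma g w.
Proof.
move=> uw H l Ll; have [C C0 HC] := H l Ll; exists C => // x xi mu mu0.
rewrite -(eq_L2norm (f := fun t => (t ^+ l)%:C * u (x, t, xi, mu))) ?HC//.
by move=> t t0; rewrite uw.
Qed.

Lemma measC_slice u x xi mu l : cont u -> 0 <= mu ->
  measC (fun t => (t ^+ l)%:C * u (x, t, xi, mu)).
Proof. by move=> cu mu0; apply: measC_mul; [exact: measC_pow|exact: slice_measC]. Qed.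

Lemma kernel_boundD L sigma g u w : cont u -> cont w ->
  kernel_bound L sigma g u -> kernel_bound L sigma g w ->
  kernel_bound L sigma g (fun p => u p + w p).
Proof.
move=> cu cw Hu Hw l Ll; have [C C0 HC] := Hu l Ll; have [C' C'0 HC'] := Hw l Ll.
exists (C + C'); first exact: addr_ge0.
move=> x xi mu mu0.
have := L2normD (measC_slice x xi l cu mu0) (measC_slice x xi l cw mu0).
rewrite (eq_L2norm (g := fun t => (t ^+ l)%:C * (u (x, t, xi, mu) + w (x, t, xi, mu)))).
  move=> H; apply: (le_trans H); rewrite mulrDl EFinD; apply: leeD; [exact: HC|exact: HC'].
by move=> t _; rewrite mulrDr.
Qed.

(** A coefficient of x_n-grade -k is bounded by x_n^k, so the estimate for t^l of the product is the
    one for t^(l+k) of u. The difference l - l', and with it the regime L and the power of sigma, is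
    the same in both. *)
Lemma kernel_boundM L sigma g g' c u : (forall xi mu, 0 < sigma xi mu) ->
  cont c -> cont u -> coef_bound g c -> kernel_bound L sigma g' u ->
  kernel_bound L sigma (g + g') (fun p => c p * u p).
Proof.
move=> sigma0 cc cu [C [C0 Cg HC]] Hu l Ll.
have [g0|g0] := ltP 0 g.1.1.
  exists 0 => // x xi mu mu0; rewrite mul0r; apply/L2norm_le => //.
  rewrite /Q2 integral0_eq ?expr0n// => t t0.
  have Op : Om (x, t, xi, mu) by [].
  have := HC _ Op; rewrite Cg// mul0r => c0.
  have -> : normc ((t ^+ l)%:C * (c (x, t, xi, mu) * u (x, t, xi, mu))) = 0.
    by rewrite !Normc.normcM (le_anti (introT andP (conj c0 (normc_ge0 _)))) mul0r mulr0.
  by rewrite expr0n.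
have [k gk] : exists k : nat, g.1.1 = - k%:Z.
  by exists `|g.1.1|%N; rewrite -[LHS]opprK -(ler0_norm g0) abszE.
have Llk : L ((l + k)%N%:Z - g'.1.1).
  by move: Ll; rewrite /= gk opprD opprK addrA PoszD.
have [C' C'0 HC'] := Hu _ Llk.
exists (C * C'); first exact: mulr_ge0.
move=> x xi mu mu0; pose B := C * (jap xi `^ (- g.1.2) * jap2 xi mu `^ (- g.2)).
have B0 : 0 <= B by rewrite !mulr_ge0// powR_ge0.
have -> : C * C' * kernel_weight sigma l (g + g') xi mu =
    B * (C' * kernel_weight sigma (l + k)%N g' xi mu).
  have jp := jap_gt0 xi; have j2p := jap2_gt0 xi mu.
  rewrite /B /kernel_weight /= gk !rmorphD /= mulrNz opprD opprK -pmulrn.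
  have -> : l%:R + (k%:R - g'.1.1%:~R) = l%:R + k%:R - g'.1.1%:~R :> R by rewrite addrA.
  have -> : nu - (g.1.2 + g'.1.2) = - g.1.2 + (nu - g'.1.2) by ring.
  have -> : delta - (g.2 + g'.2) = - g.2 + (delta - g'.2) by ring.
  move: (nu - g'.1.2) (delta - g'.2) => e1 e2.
  rewrite (@powRD _ (jap xi)); last by apply/implyP => _; rewrite gt_eqF.
  rewrite (@powRD _ (jap2 xi mu)); last by apply/implyP => _; rewrite gt_eqF.
  ring.
rewrite EFinM.
have mC := slice_measC x xi cc mu0; have mU := measC_slice x xi (l + k)%N cu mu0.
apply: (@le_trans _ _ (L2norm (fun t => B%:C * ((t ^+ (l + k)%N)%:C * u (x, t, xi, mu)))));
  last first.
  rewrite L2normZ// normc_real ger0_norm//; apply: lee_wpmul2l; first by rewrite lee_fin.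
  exact: HC'.
apply: le_L2norm.
- by apply: measC_mul; [exact: measC_pow|apply: measC_mul => //; exact: slice_measC].
- by apply: measC_mul => //; exact: measC_cst.
- move=> t t0; have Op : Om (x, t, xi, mu) by [].
  rewrite !Normc.normcM !normc_real (ger0_norm B0) exprD normrM !ger0_norm ?exprn_ge0 ?(ltW t0)//.
  have := HC _ Op; rewrite /coef_weight /= gk mulrNz opprK powR_mulrn ?(ltW t0)// => H.
  rewrite mulrA [leRHS]mulrA; apply: ler_wpM2r; first exact: normc_ge0.
  apply: (le_trans (ler_wpM2l (exprn_ge0 l (ltW t0)) H)).
  by rewrite /B le_eqVlt; apply/orP; left; apply/eqP; ring.
Qed.

Lemma CNk_mul L sigma N g g' c u : (forall xi mu, 0 < sigma xi mu) ->
  CN Om dir kgrade (@coef_bound R m) N g c ->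
  CN Om dir kgrade (kernel_bound L sigma) N g' u ->
  CN Om dir kgrade (kernel_bound L sigma) N (g + g') (fun p => c p * u p).
Proof.
move=> s0; apply: (CN_mul (@kernel_bound_ext L sigma) (@kernel_boundD L sigma)).
by move=> *; exact: kernel_boundM.
Qed.

End kernel_classes.

(** * Dilations *)

Section dilation.
Variables (R : realType) (m : nat) (eps : bool) (s : R).
Implicit Types (u w c : kvar R m -> R[i]) (p v : kvar R m).
Local Notation normc := Normc.normc.
Local Notation Om := (@kdom R m).
Local Notation dir := (@kdir R m).
Local Notation cont := (continuous_along (E := complex_lcs R) Om).
Local Notation isD := (is_D (E := complex_lcs R) Om).
Local Notation nn := (inl (inl (inr tt)) : kcoord m).
Local Notation B := (@bracket R m eps).

Definition dilate p : kvar R m :=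
  (p.1.1.1, p.1.1.2 * B p `^ (- s), p.1.2, p.2).

Lemma kdom_dilate p : Om p -> Om (dilate p).
Proof.
by move=> [p1 p2]; split => //=; rewrite mulr_gt0// powR_gt0// bracket_gt0.
Qed.

Lemma xn_continuous : continuous (fun p => p.1.1.2).
Proof.
move=> p; apply: (@cvg_comp _ _ _ (fun q : kvar R m => q.1.1)
  (fun q : 'rV[R]_m * R^o => q.2) (nbhs p) (nbhs p.1.1)); last exact: cvg_snd.
apply: (@cvg_comp _ _ _ (fun q : kvar R m => q.1)
  (fun q : 'rV[R]_m * R^o * 'rV[R]_m => q.1) (nbhs p) (nbhs p.1)); exact: cvg_fst.
Qed.

Lemma dilate_continuous : continuous dilate.
Proof.
move=> p; have H1 : (fun q : kvar R m => q.1.1.1) @ p --> p.1.1.1.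
  apply: (@cvg_comp _ _ _ (fun q : kvar R m => q.1.1)
    (fun q : 'rV[R]_m * R^o => q.1) (nbhs p) (nbhs p.1.1)); last exact: cvg_fst.
  apply: (@cvg_comp _ _ _ (fun q : kvar R m => q.1)
    (fun q : 'rV[R]_m * R^o * 'rV[R]_m => q.1) (nbhs p) (nbhs p.1)); exact: cvg_fst.
have H2 : (fun q : kvar R m => q.1.1.2 * B q `^ (- s)) @ p -->
    p.1.1.2 * B p `^ (- s).
  by apply: cvgM; [exact: xn_continuous|exact: powR_bracket_continuous].
have H3 : (fun q : kvar R m => q.1.2) @ p --> p.1.2.
  apply: (@cvg_comp _ _ _ (fun q : kvar R m => q.1)
    (fun q : 'rV[R]_m * R^o * 'rV[R]_m => q.2) (nbhs p) (nbhs p.1)).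
    exact: cvg_fst.
  exact: cvg_snd.
have H4 : (fun q : kvar R m => q.2) @ p --> p.2 by exact: cvg_snd.
exact: (cvg_pair (cvg_pair (cvg_pair H1 H2) H3) H4).
Qed.

Lemma cont_comp_dilate u : cont u -> cont (fun p => u (dilate p)).
Proof.
move=> cu p Op; apply/cvg_lcs_near => e e0; rewrite near_withinE.
have /cvg_lcs_near /(_ e e0) := cu _ (kdom_dilate Op); rewrite near_withinE => H.
have NH : \forall q \near p, Om (dilate q) -> normc (u (dilate q) - u (dilate p)) < e
  := dilate_continuous H.
by apply: filterS NH => q + Oq; apply; exact: kdom_dilate.
Qed.

Definition dilated_xn_d (i : kcoord m) p : R :=
  (i == nn)%:R * B p `^ (- s) +
  p.1.1.2 * (- s * B p `^ (- s - 1) * bracket_d eps i p).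

Lemma is_derive_dilated_xn p i :
  is_derive (0 : R) 1 (fun h : R => (dilate (p + h *: dir i)).1.1.2) (dilated_xn_d i p).
Proof.
have d1 : is_derive (0:R) 1 (fun h : R => (p + h *: dir i).1.1.2) (i == nn)%:R.
  rewrite (_ : (fun h => _) = (fun h : R => p.1.1.2 + h * (i == nn)%:R)).
    by apply: is_derive_eq; rewrite /GRing.scale/=; ring.
  by apply/funext => h; rewrite kdir_xnE.
have d2 := is_derive_bracket eps p i (- s).
rewrite /dilate /=; apply: is_derive_eq.
rewrite !scale0r !addr0 /dilated_xn_d addrC; congr (_ + _); exact: mulrC.

Qed.

(** The form required by [isD_chain]: a step in the parameters, followed by a shift in x_n. For the
    direction x_n itself the first step is 0 and the shift does everything. *)
Lemma dilate_line p i (h : R) : dilate (p + h *: dir i) = dilate p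
  + h *: (if i == nn then 0 else dir i)
  + ((dilate (p + h *: dir i)).1.1.2 - (dilate p).1.1.2) *: dir nn.
Proof.
transitivity ((p + h *: dir i).1.1.1, (dilate (p + h *: dir i)).1.1.2,
  (p + h *: dir i).1.2, (p + h *: dir i).2) => //.
move: ((dilate (p + h *: dir i)).1.1.2) => y.
have E : dilate p + (y - (dilate p).1.1.2) *: dir nn = (p.1.1.1, y, p.1.2, p.2).
  apply: etrans (kdir_xn p.1.1.1 (dilate p).1.1.2 p.1.2 p.2 _) _.
  by rewrite subrKC.
rewrite addrAC E {E}; case: p => [[[x t] xi] mu].
by case: i => [[[i|[]]|i]|[]] /=;
  congr (_, _, _, _); rewrite /= ?scaler0 ?addr0.
Qed.

Lemma isD_comp_dilate u un ui i : cont u -> cont un -> isD (dir nn) u un ->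
  isD (dir i) u ui ->
  isD (dir i) (fun p => u (dilate p)) (fun p =>
    (i != nn)%:R * ui (dilate p) + (dilated_xn_d i p)%:C * un (dilate p)).
Proof.
move=> cu cun dn di p Op.
pose v := if i == nn then 0 else dir i.
pose ue := if i == nn then (fun=> 0) else ui.
have due : isD v u ue.
  rewrite /v /ue; case: eqP => _; last exact: di.
  move=> q Oq; apply: (cvg_lcs_eq _ (cvg_lcs_cst 0)) => h.
  by rewrite scaler0 addr0 subrr scaler0.
have Odp := kdom_dilate Op.
pose eta h := (dilate (p + h *: dir i)).1.1.2 - (dilate p).1.1.2.
have [ex val] := is_derive_dilated_xn p i.
have deta : h^-1 * eta h @[h --> (0 : R)^'] --> dilated_xn_d i p.
  move: ex; rewrite /derivable => /cvg_ex[l Hl].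
  have El : l = dilated_xn_d i p by rewrite -val; apply/esym/cvg_lim.
  rewrite -El; move: Hl; apply: cvg_trans; apply: near_eq_cvg; apply: nearW => h.
  have y0 : dilate (p + 0 *: dir i) = dilate p by rewrite scale0r addr0.
  have h1 : h *: (1 : R) + 0 = h by rewrite addr0 [LHS]mulr1.
  rewrite /eta -y0.
  transitivity (h^-1 * ((dilate (p + (h *: (1 : R) + 0) *: dir i)).1.1.2 -
    (dilate (p + 0 *: dir i)).1.1.2)); last by rewrite h1.
  exact: erefl.
have ceta : eta h @[h --> (0 : R)] --> 0.
  have /derivable1_diffP/differentiable_continuous c := ex.
  rewrite -[X in _ --> X](subrr ((dilate (p + 0 *: dir i)).1.1.2)).
  apply: cvgB; first exact: c.
  by rewrite scale0r addr0; exact: cvg_cst.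
have H := @isD_chain R _ Om u ue un v (dir nn) (dilate p) eta (dilated_xn_d i p)
  [set h : R | Om (p + h *: dir i)] cu cun due dn Odp.
have xv h : (dilate p + h *: v).1.1.2 = (dilate p).1.1.2.
  rewrite /v; case: eqP => [_|/eqP ii]; first by rewrite scaler0 addr0.
  by rewrite kdir_xnE (negbTE ii) mulr0 addr0.
have muv h : Om (p + h *: dir i) -> 0 <= (dilate p + h *: v).2.
  move=> [_]; rewrite kdir_sndE /v; case: (eqVneq i nn) => [->|_].
    by rewrite scaler0 addr0 /= mulr0 addr0.
  by rewrite kdir_sndE.
have E0 : eta 0 = 0 by rewrite /eta scale0r addr0 subrr.
have D1 h : Om (p + h *: dir i) -> Om (dilate p + h *: v).
  by move=> Oh; split; [rewrite xv; case: Odp|exact: muv].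
(* The x_n-coordinates of both ends of the segment are positive, hence so are those in between. *)
have D2 h : Om (p + h *: dir i) -> forall r, between r (eta h) ->
    Om (dilate p + h *: v + r *: dir nn).
  move=> Oh r rb; split; last by rewrite kdir_sndE /= mulr0 addr0; exact: muv.
  rewrite kdir_xnE eqxx mulr1 xv; have [y0 _] := Odp.
  have [y1 _] := kdom_dilate Oh.
  case/orP: rb => /andP[r1 r2]; first by rewrite ltr_wpDr.
  apply: (lt_le_trans y1); rewrite -lerBlDl; exact: r1.
have {}H := H E0 deta ceta D1 D2.
refine (cvg_lcs_eq _ _); last first.
  have -> : (i != nn)%:R * ui (dilate p) = ue (dilate p).
    by rewrite /ue; case: eqP; rewrite ?mul0r ?mul1r.
  exact: H.
by move=> h; rewrite /v -dilate_line.
Qed.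

End dilation.

(** * Invariance of the graded classes under dilations *)

Section dilation_classes.
Variables (R : realType) (m : nat) (nu delta : R) (eps : bool) (s : R).
Implicit Types (u w c : kvar R m -> R[i]) (p v : kvar R m).
Implicit Types (L : int -> Prop) (sigma : 'rV[R]_m -> R -> R).
Local Notation Om := (@kdom R m).
Local Notation dir := (@kdir R m).
Local Notation cont := (continuous_along (E := complex_lcs R) Om).
Local Notation isD := (is_D (E := complex_lcs R) Om).
Local Notation nn := (inl (inl (inr tt)) : kcoord m).
Local Notation kgrade := (@kgrade R m).
Local Notation B := (@bracket R m eps).
Local Notation dil := (dilate eps s).
Local Notation CNk := (fun L sigma => CN Om dir kgrade (kernel_bound nu delta L sigma)).

(* As [bracket] is the square of a Japanese bracket <.>, for s = 1/2 this is
   u |-> <.>^(-1/2-l') u(x', x_n / <.>, xi', mu): one more factor <.>^-1 for each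
   derivative in x_n. *)
Definition prefactor_exp (l' : int) : R := - s * (2^-1 + l'%:~R).

Definition dilation (l' : int) u p : R[i] :=
  (B p `^ (prefactor_exp l'))%:C * u (dil p).

Definition bracket_pow (xi : 'rV[R]_m) (mu : R) : R := B (0, 0, xi, mu) `^ s.

Lemma cont_dilation l' u : cont u -> cont (dilation l' u).
Proof.
move=> cu; apply: contM; last exact: cont_comp_dilate.
by apply: real_cont; exact: powR_bracket_continuous.
Qed.

Lemma kernel_bound_dilation L sigma g u : (forall xi mu, 0 < sigma xi mu) ->
  cont u -> kernel_bound nu delta L sigma g u ->
  kernel_bound nu delta L (fun xi mu => sigma xi mu * bracket_pow xi mu) g
    (dilation g.1.1 u).
Proof.
move=> s0 cu Hu l Ll; have [C C0 HC] := Hu l Ll; exists C => // x xi mu mu0.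
pose b := B (0, 0, xi, mu); have b0 : 0 < b by exact: bracket_gt0.
pose a := b `^ s; have a0 : 0 < a by exact: powR_gt0.
pose f t := (t ^+ l)%:C * u (x, t, xi, mu).
have mf : measC f by exact: measC_slice.
(* The exponent l comes from t^l = a^l (t/a)^l and -1/2 - l' from the prefactor; the change of
   variables in L^2 gives back the factor a^(1/2). *)
pose K : R := a `^ (l%:R - g.1.1%:~R - 2^-1).
rewrite (eq_L2norm (g := fun t => K%:C * f (t / a))); last first.
  move=> t t0; rewrite /f /dilation mulrA [RHS]mulrA.
  have -> : dil (x, t, xi, mu) = (x, t / a, xi, mu).
    by rewrite /dilate; congr (_, _ * _, _, _); rewrite powRN.
  congr (_ * _); rewrite -!rmorphM; congr (_%:C).
  rewrite exprMn mulrCA; congr (_ * _).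
  rewrite exprVn -powR_mulrn ?(ltW a0)// -powRN /K.
  rewrite -powRD; last by apply/implyP => _; rewrite gt_eqF.
  rewrite /a -powRrM /prefactor_exp; congr (_ `^ _); rewrite -/b.
  ring.
rewrite L2normZ; last exact: measC_dilation.
rewrite L2norm_dilation// normc_real ger0_norm ?powR_ge0// muleA -EFinM.
have -> : K * a `^ 2^-1 = a `^ (l%:R - g.1.1%:~R).
  by rewrite /K -powRD ?subrK//; apply/implyP => _; rewrite gt_eqF.
have -> : C * kernel_weight nu delta (fun xi mu => sigma xi mu * bracket_pow xi mu) l g xi mu
    = a `^ (l%:R - g.1.1%:~R) * (C * kernel_weight nu delta sigma l g xi mu).
  rewrite /kernel_weight powRM; [|exact/ltW/s0|exact: ltW].
  by rewrite /bracket_pow -/b -/a; ring.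
by rewrite [leRHS]EFinM; apply: lee_wpmul2l; [rewrite lee_fin powR_ge0|exact: HC].
Qed.

(** The inner derivative contributes B^-s, which is exactly the change of the prefactor from l' to
    l' + 1. *)
Lemma isD_dilation_xn l' u un : cont u -> cont un -> isD (dir nn) u un ->
  isD (dir nn) (dilation l' u) (dilation (l' + 1) un).
Proof.
move=> cu cun dn.
have cB r : cont (fun p => (B p `^ r)%:C).
  by apply: real_cont; exact: powR_bracket_continuous.
have := isDM (cB (prefactor_exp l')) (isD_bracket eps nn (prefactor_exp l'))
  (isD_comp_dilate eps s cu cun dn dn).
apply: isD_ext => // p Op; rewrite /dilated_xn_d eqxx /dilation.
have -> : B p `^ prefactor_exp (l' + 1) = B p `^ prefactor_exp l' * B p `^ (- s).
  rewrite -powRD; last by apply/implyP => _; rewrite gt_eqF// bracket_gt0.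
  by congr (_ `^ _); rewrite /prefactor_exp rmorphD /=; ring.
rewrite [bracket_d _ _ _]/=.
move: (u _) (un _) (B p `^ _) (B p `^ _) (B p `^ _) (B p `^ _)
  => [u1 u2] [v1 v2] b1 b2 b3 b4.
by apply/eqP; rewrite eq_complex /=; apply/andP; split; apply/eqP; ring.
Qed.

(** [bracket] does not depend on x_n, so its logarithmic derivative passes unchanged through the
    dilation, and x_n B^-s is the dilated coordinate x_n. The derivative is therefore again a
    dilation, with the same l'. *)
Lemma isD_dilation l' u un ui i : i != nn -> cont u -> cont un ->
  isD (dir nn) u un -> isD (dir i) u ui ->
  isD (dir i) (dilation l' u) (dilation l' (fun p =>
    ui p + ((- 'i * (prefactor_exp l')%:C) *
             ((bracket_d eps i p * B p `^ (- 1))%:C * u p)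
    + (- s)%:C * ((bracket_d eps i p * B p `^ (- 1))%:C * (p.1.1.2%:C * un p))))).
Proof.
move=> inn cu cun dn di.
have cB r : cont (fun p => (B p `^ r)%:C).
  by apply: real_cont; exact: powR_bracket_continuous.
have := isDM (cB (prefactor_exp l')) (isD_bracket eps i (prefactor_exp l'))
  (isD_comp_dilate eps s cu cun dn di).
apply: isD_ext => // p Op; rewrite /dilated_xn_d.
have -> : (i != nn)%:R = 1 :> R[i] by rewrite inn.
rewrite (negbTE inn).
have Bd : B (dil p) = B p by [].
have dd : bracket_d eps i (dil p) = bracket_d eps i p by case: i {inn di} => [[[]|]|].
have B1 r : B p `^ (r - 1) = B p `^ r * B p `^ (- 1).
  by rewrite powRD//; apply/implyP => _; rewrite gt_eqF// bracket_gt0.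
rewrite /dilation Bd dd !B1.
have -> : (dil p).1.1.2 = p.1.1.2 * B p `^ (- s) by [].
rewrite mul0r add0r mul1r.
move: (u _) (un _) (ui _) (B p `^ _) (B p `^ _) (B p `^ _) (bracket_d _ _ _) (p.1.1.2)
  => [u1 u2] [v1 v2] [w1 w2] b1 b2 b3 b4 b5.
by apply/eqP; rewrite eq_complex /=; apply/andP; split; apply/eqP; ring.
Qed.

(** Induction on N for all g and u at once, since a first derivative is the dilation of another
    kernel, of order N and of the grade of the derivative. *)
Lemma CN_dilation L sigma N g u : (forall xi mu, 0 < sigma xi mu) ->
  CNk L sigma N g u ->
  CNk L (fun xi mu => sigma xi mu * bracket_pow xi mu) N g (dilation g.1.1 u).
Proof.
move=> s0; elim: N g u => [|N IH] g u Hu.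
  have cu := CN_cont Hu; split; [exact: cont_dilation| |exact: Logic.I].
  by apply: kernel_bound_dilation => //; exact: CN_P Hu.
have cu := CN_cont Hu; have [_ Pu H] := Hu.
split; [exact: cont_dilation|exact: kernel_bound_dilation|].
have [un dn Hn] := H nn; have cun := CN_cont Hn.
move=> i; have [->|inn] := eqVneq i nn.
  exists (dilation (g.1.1 + 1) un); first exact: isD_dilation_xn.
  exact: (IH (g + kgrade nn) un Hn).
have [ui di Hi] := H i; eexists; first exact: (isD_dilation g.1.1 inn cu cun dn di).
(* Directions other than x_n leave l' alone, so the prefactor in the induction hypothesis is the
   right one. *)
have Eg : (g + kgrade i).1.1 = g.1.1.
  by case: i inn {di Hi} => [[[i|[]]|i]|[]]//= _; rewrite addr0.
rewrite -Eg; apply: IH; rewrite Eg.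
have Kext := @kernel_bound_ext R m nu delta L sigma.
have KD := @kernel_boundD R m nu delta L sigma.
have log := @CNc_log_derivative R m eps N i inn.
apply: (CN_add KD Hi); apply: (CN_add KD).
- have := CNk_mul s0 (@CNc_cst R m N (- 'i * (prefactor_exp g.1.1)%:C))
    (CNk_mul s0 log (CNW Hu)).
  by rewrite add0r addrC.
- have := CNk_mul s0 (@CNc_cst R m N (- s)%:C) (CNk_mul s0 log
    (CNk_mul s0 (@CNc_xn R m N) Hn)).
  (* The grade (-1, 0, 0) of x_n cancels the grade (1, 0, 0) gained by [un]. *)
  rewrite add0r addrC; congr (CN _ _ _ _ _ (_ + _)).
  rewrite addrC -addrA [X in _ + X](_ : _ = 0) ?addr0//.
  by congr (_, _, _); rewrite /= ?addr0 ?addrN.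
Qed.

End dilation_classes.

(** * Function-valued symbols *)

Section Dt_sequences.
Variable R : realType.
Local Notation Re := complex.Re.
Local Notation Im := complex.Im.
Implicit Types (U V : nat -> R -> R[i]).

(** A candidate for the successive D_t-derivatives, certified by first derivatives only. It is
    stable under linear combinations, and [Dt_sequence_Dt] identifies it with the iterated
    derivatives [Dt]. *)
Definition Dt_sequence U := forall (l : nat) (t : R), 0 < t ->
  is_derive t 1 (fun t : R => Re (U l t) : R^o) (Re ('i * U l.+1 t)) /\
  is_derive t 1 (fun t : R => Im (U l t) : R^o) (Im ('i * U l.+1 t)).

Lemma Dt_sequenceD U V : Dt_sequence U -> Dt_sequence V ->
  Dt_sequence (fun l t => U l t + V l t).
Proof.
move=> HU HV l t t0; have [u1 u2] := HU l t t0; have [v1 v2] := HV l t t0; split.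
- rewrite (_ : (fun t : R => _) = (fun t : R => Re (U l t) + Re (V l t) : R^o)).
    by apply: is_derive_eq; case: (U l.+1 t) (V l.+1 t) => ? ? [? ?] /=; ring.
  by apply/funext => r /=; case: (U l r) (V l r) => ? ? [? ?].
- rewrite (_ : (fun t : R => _) = (fun t : R => Im (U l t) + Im (V l t) : R^o)).
    by apply: is_derive_eq; case: (U l.+1 t) (V l.+1 t) => ? ? [? ?] /=; ring.
  by apply/funext => r /=; case: (U l r) (V l r) => ? ? [? ?].
Qed.

Lemma Dt_sequenceZ c U : Dt_sequence U -> Dt_sequence (fun l t => c * U l t).
Proof.
move=> HU l t t0; have [u1 u2] := HU l t t0; split.
- rewrite (_ : (fun t : R => _) = (fun t : R => Re c * Re (U l t) - Im c * Im (U l t) : R^o)).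
    apply: is_derive_eq; rewrite /GRing.scale /=.
    by case: c (U l.+1 t) => ? ? [? ?] /=; ring.
  by apply/funext => r /=; case: c (U l r) => ? ? [? ?].
- rewrite (_ : (fun t : R => _) = (fun t : R => Re c * Im (U l t) + Im c * Re (U l t) : R^o)).
    apply: is_derive_eq; rewrite /GRing.scale /=.
    by case: c (U l.+1 t) => ? ? [? ?] /=; ring.
  by apply/funext => r /=; case: c (U l r) => ? ? [? ?].
Qed.

Lemma derive1n_Dt_sequence U (v : R -> R[i]) : Dt_sequence U ->
  (forall t, 0 < t -> v t = U 0%N t) -> forall l t, 0 < t ->
  derive1n l (fun s : R => Re (v s) : R^o) t = Re ('i ^+ l * U l t) /\
  derive1n l (fun s : R => Im (v s) : R^o) t = Im ('i ^+ l * U l t).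
Proof.
move=> HU vU; elim=> [|l IH] t t0.
  by rewrite /= vU// expr0 mul1r.
have HUl := Dt_sequenceZ ('i ^+ l) HU; have [d1 d2] := HUl l t t0.
have pos : \forall r \near t, 0 < r by exact: lt_nbhsr.
rewrite /= !derive1E; split.
- rewrite exprS -mulrA -(@derive_val _ _ _ _ _ _ _ d1).
  apply: near_eq_derive.
  by apply: filterS pos => r /IH[].
- rewrite exprS -mulrA -(@derive_val _ _ _ _ _ _ _ d2).
  apply: near_eq_derive.
  by apply: filterS pos => r /IH[].
Qed.

Lemma Dt_sequence_smooth U (v : R -> R[i]) : Dt_sequence U ->
  (forall t, 0 < t -> v t = U 0%N t) -> smooth_Rplus v.
Proof.
move=> HU vU l t t0; have HUl := Dt_sequenceZ ('i ^+ l) HU.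
have [[d1 _] [d2 _]] := HUl l t t0.
have H := derive1n_Dt_sequence HU vU.
have pos : \forall r \near t, 0 < r by exact: lt_nbhsr.
split.
- move: d1; apply: near_eq_derivable.
  by apply: filterS pos => r r0; have [-> _] := H l r r0.
- move: d2; apply: near_eq_derivable.
  by apply: filterS pos => r r0; have [_ ->] := H l r r0.
Qed.

Lemma Dt_sequence_Dt U (v : R -> R[i]) : Dt_sequence U ->
  (forall t, 0 < t -> v t = U 0%N t) ->
  forall l t, 0 < t -> Dt l v t = U l t.
Proof.
move=> HU vU l t t0; rewrite /Dt; have [-> ->] := derive1n_Dt_sequence HU vU l t0.
have -> z : Re z +i* Im z = z :> R[i] by case: z.
by rewrite mulrA -exprMn mulNr -expr2 sqr_i opprK expr1n mul1r.
Qed.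

Lemma smooth_Dt_sequence (v : R -> R[i]) : smooth_Rplus v ->
  Dt_sequence (fun l => Dt l v).
Proof.
move=> sv l t t0; have [d1 d2] := sv l t t0.
pose X l (s : R) : R[i] := derive1n l (fun s : R => Re (v s) : R^o) s
   +i* derive1n l (fun s : R => Im (v s) : R^o) s.
have E l' : Dt l' v = (fun s => (- 'i) ^+ l' * X l' s) by [].
have i2 : - 'i * 'i = 1 :> R[i] by rewrite mulNr -expr2 sqr_i opprK.
rewrite !E exprS mulrCA mulrA [_ * 'i]mulrC mulrA mulrAC.
rewrite ['i * _]mulrC i2 mul1r.
pose c : R[i] := (- 'i) ^+ l; rewrite -/c.
have {}d1 := derivableP d1; have {}d2 := derivableP d2.
rewrite -!derive1E in d1 d2.
split.
- rewrite (_ : (fun t : R => _) = (fun t : R => Re c * derive1n l (fun s : R => Re (v s) : R^o) t -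
      Im c * derive1n l (fun s : R => Im (v s) : R^o) t : R^o)).
    apply: is_derive_eq; rewrite Re_mul /GRing.scale /=. ring.
  by apply/funext => r /=; case: c.
- rewrite (_ : (fun t : R => _) = (fun t : R => Re c * derive1n l (fun s : R => Im (v s) : R^o) t +
      Im c * derive1n l (fun s : R => Re (v s) : R^o) t : R^o)).
    apply: is_derive_eq; rewrite Im_mul /GRing.scale /=; ring.
  by apply/funext => r /=; case: c.
Qed.

Lemma Dt_sequence_contC U l : Dt_sequence U -> contC (U l).
Proof.
move=> HU t t0; have [[d1 _] [d2 _]] := HU l t t0.
by split; apply: differentiable_continuous; apply/derivable1_diffP.
Qed.

End Dt_sequences.

(** * Slices of kernels in x_n and Taylor's formula in L^2 *)

Section kernel_slices.
Variables (R : realType) (m : nat).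
Implicit Types (u w : kvar R m -> R[i]) (p : pvar R m).
Local Notation normc := Normc.normc.
Local Notation Re := complex.Re.
Local Notation Im := complex.Im.
Local Notation Om := (@kdom R m).
Local Notation cont := (continuous_along (E := complex_lcs R) Om).
Local Notation isD := (is_D (E := complex_lcs R) Om).
Local Notation nn := (inl (inl (inr tt)) : kcoord m).

Definition kpoint p (t : R) : kvar R m := (p.1.1, t, p.1.2, p.2).

Definition kvec (v : pvar R m) : kvar R m := (v.1.1, 0, v.1.2, v.2).

Definition kcoord_of (i : pcoord m) : kcoord m :=
  match i with
  | inl (inl i) => inl (inl (inl i))
  | inl (inr i) => inl (inr i)
  | inr _ => inr tt
  end.

Lemma kvec_pdir i : kvec (pdir R i) = kdir R (kcoord_of i).
Proof. by case: i => [[i|i]|[]]. Qed.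

Lemma kvecN v : kvec (- v) = - kvec v.
Proof. by rewrite /kvec -[RHS]/(- v.1.1, - 0, - v.1.2, - v.2) oppr0. Qed.

Lemma kpoint_line p v (h t : R) : kpoint (p + h *: v) t = kpoint p t + h *: kvec v.
Proof.
rewrite /kpoint /kvec.
rewrite -[RHS]/(p.1.1 + h *: v.1.1, t + h * 0, p.1.2 + h *: v.1.2, p.2 + h *: v.2).
by rewrite mulr0 addr0.
Qed.

Lemma kdom_kpoint p t : pdom p -> 0 < t -> Om (kpoint p t).
Proof. by []. Qed.

Lemma Dt_sequence_slice (F : nat -> kvar R m -> R[i]) p : pdom p ->
  (forall l, isD (kdir R nn) (F l) (F l.+1)) ->
  Dt_sequence (fun l t => F l (kpoint p t)).
Proof.
move=> mu0 dF l t t0.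
have key u u' : isD (kdir R nn) u u' ->
    is_derive t 1 (fun t : R => Re (u (kpoint p t)) : R^o) (Re ('i * u' (kpoint p t))).
  move=> du; have E s : kpoint p s = kpoint p 0 + s *: kdir R nn.
    by rewrite kdir_xn add0r.
  rewrite (_ : (fun t => _) = (fun s => Re (u (kpoint p 0 + s *: kdir R nn)))); last first.
    by apply/funext => s; rewrite -E.
  rewrite (E t); refine (line_derive du _).
  have pos : \forall r \near t, 0 < r by exact: lt_nbhsr.
  by apply: filterS pos => r r0; rewrite -E.
split; first exact: key.
have := key _ _ (isDZ (- 'i) (dF l)).
rewrite (_ : (fun t => _) = (fun t : R => Im (F l (kpoint p t)) : R^o)).
  by move=> H; apply: is_derive_eq H _; case: (F l.+1 _) => ? ? /=; ring.
by apply/funext => s; case: (F l _) => ? ? /=; ring.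
Qed.

Lemma measC_sub (f g : R -> R[i]) : measC f -> measC g -> measC (fun t => f t - g t).
Proof.
move=> mf mg; rewrite (_ : (fun t => _) = (fun t => f t + (- 1) * g t)).
  by apply: measC_add => //; apply: measC_mul => //; exact: measC_cst.
by apply/funext => t; rewrite mulN1r.
Qed.

Lemma Re_L2norm_le (f : R -> R[i]) : measC f ->
  (L2norm (fun t => (Re (f t))%:C) <= L2norm f)%E.
Proof.
move=> mf; have [m1 m2] := mf; apply: le_L2norm => //.
by move=> t t0; rewrite normc_real normc_Re.
Qed.

Lemma L2norm_le_ReIm (f : R -> R[i]) M : measC f ->
  (L2norm (fun t => (Re (f t))%:C) <= M%:E)%E ->
  (L2norm (fun t => (Re (- 'i * f t))%:C)%R <= M%:E)%E ->
  (L2norm f <= (2 * M)%:E)%E.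
Proof.
move=> mf H1 H2; have [m1 m2] := mf.
have mR (g : R -> R[i]) : measC g -> measC (fun t => (Re (g t))%:C).
  by move=> [g1 g2]; split => //=; exact: measurable_cst.
have mg : measC (fun t => - 'i * f t) by apply: measC_mul => //; exact: measC_cst.
rewrite (eq_L2norm (g := fun t => (Re (f t))%:C + 'i * (Re (- 'i * f t))%:C)); last first.
  by move=> t _; case: (f t) => a b; simpc.
have mi : measC (fun t => 'i * (Re (- 'i * f t))%:C).
  by apply: measC_mul; [exact: measC_cst|exact: mR].
apply: (le_trans (L2normD (mR _ mf) mi)).
rewrite mulr_natl mulr2n EFinD; apply: leeD => //.
rewrite L2normZ; last exact: mR.
by rewrite [normc _](_ : _ = 1) ?mul1e//= expr0n expr1n add0r sqrtr1.
Qed.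

(* Taylor's formula in L^2; [c = 0] gives the mean value inequality. *)
Lemma slice_taylor u u1 u2 p v l (c : R -> R[i]) (h M : R) : 0 < h -> 0 <= M ->
  (forall s, 0 <= s <= h -> pdom (p + s *: v)) ->
  cont u -> cont u1 -> cont u2 -> measC c ->
  isD (kvec v) u u1 -> isD (kvec v) u1 u2 ->
  (forall s, 0 <= s <= h ->
    (L2norm (fun t => ((t ^+ l)%:C * (u1 (kpoint (p + s *: v) t) - c t))%R) <= M%:E)%E) ->
  (L2norm (fun t => ((t ^+ l)%:C * (u (kpoint (p + h *: v) t) - u (kpoint p t)
     - h%:C * ('i * c t)))%R) <= (2 * (h * M))%:E)%E.
Proof.
move=> h0 M0 seg cu cu1 cu2 mc du du1 HM.
have h0h : 0 <= h <= h by rewrite lexx ltW.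
have h00 : 0 <= (0:R) <= h by rewrite lexx ltW.
have p0 : p = p + 0 *: v by rewrite scale0r addr0.
have mslice w s : cont w -> 0 <= s <= h -> measC (fun t => w (kpoint (p + s *: v) t)).
  by move=> cw sh; apply: slice_measC => //; exact: seg.
have main w w1 w2 (c' : R -> R[i]) : cont w -> cont w1 -> cont w2 -> measC c' ->
    isD (kvec v) w w1 -> isD (kvec v) w1 w2 ->
    (forall s, 0 <= s <= h ->
    (L2norm (fun t => ((t ^+ l)%:C * (w1 (kpoint (p + s *: v) t) - c' t))%R) <= M%:E)%E) ->
    (L2norm (fun t => (Re ((t ^+ l)%:C * (w (kpoint (p + h *: v) t) - w (kpoint p t)
     - h%:C * ('i * c' t))))%:C)%R <= (h * M)%:E)%E.
  move=> cw cw1 cw2 mc' dw dw1 HM'.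
  (* With the linear term s i c subtracted, the derivative in s is the difference w1 - c, whose norm
     is bounded by M; the mean value inequality for f is then Taylor's formula. *)
  pose f s t := Re ((t ^+ l)%:C * (w (kpoint (p + s *: v) t) - s%:C * ('i * c' t))).
  pose f1 s t := Re ((t ^+ l)%:C * ('i * (w1 (kpoint (p + s *: v) t) - c' t))).
  pose f2 s t := Re ((t ^+ l)%:C * (- w2 (kpoint (p + s *: v) t))).
  have segO s t : 0 <= s <= h -> 0 < t -> Om (kpoint p t + s *: kvec v).
    by move=> sh t0; rewrite -kpoint_line; exact: kdom_kpoint (seg _ sh) t0.
  have mvt y y1 t a b : cont y -> isD (kvec v) y y1 -> 0 < t -> 0 <= a -> a < b ->
      b <= h -> exists2 r, a < r < b &
      Re (y (kpoint (p + b *: v) t)) - Re (y (kpoint (p + a *: v) t)) =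
      (b - a) * Re ('i * y1 (kpoint (p + r *: v) t)).
    move=> cy dy t0 a0 ab bh.
    have ba : 0 < b - a by rewrite subr_gt0.
    have [|r /andP[r0 rb] E] := @Re_MVT _ _ Om y y1 (kvec v)
        (kpoint (p + a *: v) t) (b - a) ba _ cy dy.
      move=> r /andP[r0 rb]; rewrite -kpoint_line -addrA -scalerDl kpoint_line.
      apply: segO => //; rewrite addr_ge0//=; apply: le_trans bh.
      by rewrite addrC -lerBrDr.
    exists (a + r); first by rewrite ltrDl r0 /= addrC -ltrBrDr.
    move: E; rewrite -!kpoint_line -!addrA -!scalerDl subrKC => ->.
    by [].
  have := @L2norm_mean_value R f f1 f2 h M h0 M0.
  rewrite (eq_L2norm (g := fun t => (Re ((t ^+ l)%:C * (w (kpoint (p + h *: v) t)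
     - w (kpoint p t) - h%:C * ('i * c' t))))%:C)); last first.
    move=> t _; rewrite /f -Re_sub -p0; congr ((Re _)%:C).
    by rewrite -mulrBr mul0r subr0 addrAC.
  apply.
  - move=> s sh; split.
    + suff [] : measC (fun t => (t ^+ l)%:C *
        (w (kpoint (p + s *: v) t) - s%:C * ('i * c' t))) by [].
      apply: measC_mul; first exact: measC_pow.
      apply: measC_sub; first exact: mslice.
      by do 2![apply: measC_mul; first exact: measC_cst].
    + suff [] : measC (fun t => (t ^+ l)%:C *
        ('i * (w1 (kpoint (p + s *: v) t) - c' t))) by [].
      apply: measC_mul; first exact: measC_pow.
      apply: measC_mul; first exact: measC_cst.
      by apply: measC_sub => //; exact: mslice.
  - move=> t t0 a b a0 ab bh.
    have [r rab E] := mvt w w1 t a b cw dw t0 a0 ab bh.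
    exists r => //; move: E; rewrite /f /f1.
    move: (w _) (w _) (w1 _) (c' t) => [x1 y1] [x2 y2] [x3 y3] [x4 y4] /= E.
    have -> : x2 = x1 + (b - a) * (0 * x3 - 1 * y3) by rewrite -E; ring.
    ring.
  - move=> t t0 a b a0 ab bh.
    have [r rab E] := mvt _ _ t a b (contM (@cont_cst _ _ Om 'i) cw1) (isDZ 'i dw1) t0 a0 ab bh.
    exists r => //; move: E; rewrite /f1 /f2.
    move: (w1 _) (w1 _) (w2 _) (c' t) => [x1 y1] [x2 y2] [x3 y3] [x4 y4] /= E.
    have -> : y2 = y1 - (b - a) * (0 * (0 * x3 - 1 * y3) - 1 * (0 * y3 + 1 * x3)).
      by rewrite -E; ring.
    ring.
  - move=> t t0.
    (* For fixed t the second derivative is continuous on the compact segment; its extreme values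
       give the pointwise bound. *)
    have cs : {within `[0, h], continuous (fun s : R => Re (w2 (kpoint p t + s *: kvec v)))}.
      by apply: Re_segment_continuous cw2 => s sh; exact: segO.
    have [a _ Ha] := EVT_max (ltW h0) cs; have [b _ Hb] := EVT_min (ltW h0) cs.
    pose M1 := Re (w2 (kpoint p t + a *: kvec v)).
    pose M2 := Re (w2 (kpoint p t + b *: kvec v)).
    exists (t ^+ l * (`|M1| + `|M2|)) => s sh.
    have {}Ha := Ha s sh; have {}Hb := Hb s sh.
    have -> : f2 s t = t ^+ l * - Re (w2 (kpoint p t + s *: kvec v)).
      by rewrite /f2 kpoint_line; case: (w2 _) => ? ? /=; ring.
    rewrite normrM normrN ger0_norm ?exprn_ge0 ?(ltW t0)//.
    apply: ler_wpM2l; first by rewrite exprn_ge0// ltW.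
    rewrite ler_norml; apply/andP; split.
      apply: le_trans Hb; rewrite -/M2 lerNl.
      by apply: (le_trans (ler_norm _)); rewrite normrN lerDr.
    by apply: (le_trans Ha); rewrite -/M1; apply: (le_trans (ler_norm _)); rewrite lerDl.
  - move=> s sh; have m1 : measC (fun t => (t ^+ l)%:C *
      (w1 (kpoint (p + s *: v) t) - c' t)).
      by apply: measC_mul; [exact: measC_pow|apply: measC_sub => //; exact: mslice].
    apply: le_trans (HM' s sh).
    rewrite (eq_L2norm (g := fun t => (Re ('i * ((t ^+ l)%:C *
      (w1 (kpoint (p + s *: v) t) - c' t))))%:C)); last first.
      by move=> t _; rewrite /f1 mulrCA.
    apply: (le_trans (Re_L2norm_le (measC_mul (measC_cst 'i) m1))).
    by rewrite L2normZ// [normc _](_ : _ = 1) ?mul1e//= expr0n expr1n add0r sqrtr1.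
have cN y : cont y -> cont (fun q => - 'i * y q).
  by move=> cy; apply: contM => //; exact: cont_cst.
apply: L2norm_le_ReIm.
- apply: measC_mul; first exact: measC_pow.
  apply: measC_sub; last by do 2![apply: measC_mul; first exact: measC_cst].
  by apply: measC_sub; [|rewrite p0]; exact: mslice.
- exact: main du du1 HM.
- have mN : measC (fun t => - 'i * c t) by apply: measC_mul => //; exact: measC_cst.
  have := main _ _ _ _ (cN _ cu) (cN _ cu1) (cN _ cu2) mN (isDZ (- 'i) du)
    (isDZ (- 'i) du1).
  rewrite (eq_L2norm (g := fun t => (Re (- 'i * ((t ^+ l)%:C *
    (u (kpoint (p + h *: v) t) - u (kpoint p t) - h%:C * ('i * c t)))))%:C)).
    apply=> s sh; rewrite (eq_L2norm (g := fun t => - 'i * ((t ^+ l)%:C *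
      (u1 (kpoint (p + s *: v) t) - c t)))); last first.
      by move=> t _; rewrite -mulrBr mulrCA.
    rewrite L2normZ; last first.
      apply: measC_mul; first exact: measC_pow.
      by apply: measC_sub => //; exact: mslice.
    rewrite normcN [normc _](_ : _ = 1) ?mul1e//; first exact: HM.
    by rewrite /= expr0n expr1n add0r sqrtr1.
  by move=> t _; congr ((Re _)%:C); ring.
Qed.

End kernel_slices.

(** * Function spaces on (0, +oo) defined by weighted norms; their continuous semi-norms *)

Section weighted_spaces.
Variables (R : realType) (Q : countType) (wt : Q -> nat * nat).
Local Notation normc := Normc.normc.
Implicit Types (u v : R -> R[i]) (q : Q).

Definition weighted_sn q v : \bar R :=
  L2norm (fun t => (t ^+ (wt q).1)%:C * Dt (wt q).2 v t).

(* The common form of [S0] and [Hinfty]. *)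
Definition weighted_lcs : lcs R :=
  @Lcs R ((R -> R[i]^o) : lmodType R[i])
    [set v | smooth_Rplus v /\ forall q, (weighted_sn q v < +oo)%E]
    Q weighted_sn.

Lemma weighted_sn_ge0 q v : (0 <= weighted_sn q v)%E.
Proof. exact: L2norm_ge0. Qed.

Lemma measC_weighted q v : smooth_Rplus v ->
  measC (fun t => (t ^+ (wt q).1)%:C * Dt (wt q).2 v t).
Proof.
move=> sv; apply: measC_mul; first exact: measC_pow.
apply: contC_measC; exact: (Dt_sequence_contC _ (smooth_Dt_sequence sv)).
Qed.

Lemma smooth_RplusD u v : smooth_Rplus u -> smooth_Rplus v ->
  smooth_Rplus (fun t => u t + v t) /\
  forall l t, 0 < t -> Dt l (fun t => u t + v t) t = Dt l u t + Dt l v t.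
Proof.
move=> su sv.
have H := Dt_sequenceD (smooth_Dt_sequence su) (smooth_Dt_sequence sv).
have E t : 0 < t -> u t + v t = Dt 0 u t + Dt 0 v t.
  by move=> _; rewrite /Dt !expr0 !mul1r /=; case: (u t) (v t) => ? ? [? ?].
by split; [exact: Dt_sequence_smooth H E|exact: Dt_sequence_Dt H E].
Qed.

Lemma smooth_RplusZ c u : smooth_Rplus u -> smooth_Rplus (fun t => c * u t) /\
  forall l t, 0 < t -> Dt l (fun t => c * u t) t = c * Dt l u t.
Proof.
move=> su; have H := Dt_sequenceZ c (smooth_Dt_sequence su).
have E t : 0 < t -> c * u t = c * Dt 0 u t.
  by move=> _; rewrite /Dt !expr0 !mul1r /=; case: (u t).
by split; [exact: Dt_sequence_smooth H E|exact: Dt_sequence_Dt H E].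
Qed.

Lemma weighted_snD q u v : smooth_Rplus u -> smooth_Rplus v ->
  (weighted_sn q (fun t => u t + v t)%R <= weighted_sn q u + weighted_sn q v)%E.
Proof.
move=> su sv; have [_ E] := smooth_RplusD su sv.
have := L2normD (measC_weighted q su) (measC_weighted q sv).
rewrite (eq_L2norm (g := fun t => (t ^+ (wt q).1)%:C * Dt (wt q).2 (fun t => u t + v t) t))//.
by move=> t t0; rewrite E// mulrDr.
Qed.

Lemma weighted_snZ q c u : smooth_Rplus u ->
  weighted_sn q (fun t => c * u t) = ((normc c)%:E * weighted_sn q u)%E.
Proof.
move=> su; have [_ E] := smooth_RplusZ c su.
rewrite -(L2normZ c (measC_weighted q su)); apply: eq_L2norm => t t0.
by rewrite E// mulrCA.
Qed.

Lemma eltD u v : elt (l := weighted_lcs) u -> elt (l := weighted_lcs) v ->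
  elt (l := weighted_lcs) (fun t => u t + v t).
Proof.
move=> [su fu] [sv fv]; split; first by have [] := smooth_RplusD su sv.
move=> q; apply: (le_lt_trans (weighted_snD q su sv)).
exact: lte_add_pinfty.
Qed.

Lemma eltZ c u : elt (l := weighted_lcs) u ->
  elt (l := weighted_lcs) (fun t => c * u t).
Proof.
move=> [su fu]; split; first by have [] := smooth_RplusZ c su.
move=> q; rewrite weighted_snZ//; apply: lte_mul_pinfty => //.
by rewrite lee_fin normc_ge0.
Qed.

Lemma weighted_sn_fin q u : elt (l := weighted_lcs) u ->
  weighted_sn q u = (fine (weighted_sn q u))%:E.
Proof. by move=> [_ fu]; rewrite fineK// ge0_fin_numE// weighted_sn_ge0. Qed.

(** The estimates in [symbol] are stated for continuous real-valued semi-norms; this admits the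
    generating norms among them. *)
Lemma weighted_seminorm q :
  @seminorm_on R weighted_lcs (fun u => fine (weighted_sn q u)) /\
  @continuous_on_lcs R weighted_lcs (fun u => fine (weighted_sn q u)).
Proof.
have D u v : elt (l := weighted_lcs) u -> elt (l := weighted_lcs) v ->
    fine (weighted_sn q (fun t => u t + v t)) <=
    fine (weighted_sn q u) + fine (weighted_sn q v).
  move=> eu ev; have := weighted_snD q eu.1 ev.1.
  rewrite (weighted_sn_fin q eu) (weighted_sn_fin q ev).
  by rewrite (weighted_sn_fin q (eltD eu ev)) -EFinD lee_fin.
have Z c u : elt (l := weighted_lcs) u ->
    fine (weighted_sn q (fun t => c * u t)) = normc c * fine (weighted_sn q u).
  move=> eu; rewrite weighted_snZ; last by case: eu.
  by rewrite {1}(weighted_sn_fin q eu).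
split; first by split=> [u v eu ev|c u eu]; [exact: D|exact: Z].
move=> u eu e e0; exists [:: q], e; split => // v ev /(_ q (mem_head _ _)) H.
pose d : R -> R[i] := fun t => v t + (- 1) * u t.
have ed : elt (l := weighted_lcs) d by apply: eltD => //; exact: eltZ.
have dv : (v - u : R -> R[i]^o) = d by apply/funext => t; rewrite /d mulN1r.
move: H; rewrite /= [X in weighted_sn q X]dv (weighted_sn_fin q ed) lte_fin => H.
have H1 : fine (weighted_sn q v) <= fine (weighted_sn q d) + fine (weighted_sn q u).
  have := D _ _ ed eu; congr (fine (weighted_sn q _) <= _).
  by apply/funext => t; rewrite /d mulN1r subrK.
have H2 : fine (weighted_sn q u) <= fine (weighted_sn q v) + fine (weighted_sn q d).
  have := D _ _ ev (eltZ (- 1) ed); rewrite Z// normcN normc_real normr1 mul1r.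
  congr (fine (weighted_sn q _) <= _).
  by apply/funext => t; rewrite /d mulN1r; ring.
apply: le_lt_trans H; rewrite ler_norml; apply/andP; split; last by rewrite lerBlDr.
by rewrite lerNl opprB lerBlDl.
Qed.

(** Continuity at 0 makes p less than 1 where finitely many norms are less than some r; homogeneity
    extends this to all elements. Estimates for the generating norms thus suffice for a symbol. *)
Lemma seminorm_dominated (p : (R -> R[i]) -> R) :
  @seminorm_on R weighted_lcs p -> @continuous_on_lcs R weighted_lcs p ->
  exists (s : seq Q) (C : R), 0 <= C /\ forall u, elt (l := weighted_lcs) u ->
    p u <= C * \sum_(q <- s) fine (weighted_sn q u).
Proof.
move=> [pD pZ] pc.
have e0 : elt (l := weighted_lcs) (fun=> 0).
  have D0 : Dt_sequence (fun _ _ => 0 : R[i]).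
    by move=> l t t0; rewrite /= !mul0r mul1r subr0 addr0;
      split; exact: is_derive_cst.
  split; first exact: Dt_sequence_smooth D0 _.
  move=> q; rewrite /weighted_sn (eq_L2norm (g := fun=> 0)); last first.
    by move=> t t0; rewrite (Dt_sequence_Dt D0 (fun _ _ => erefl)) ?mulr0.
  apply: (@le_lt_trans _ _ 0%:E); last by rewrite ltry.
  apply/L2norm_le => //; rewrite /Q2 expr0n /= integral0_eq// => t _.
  by rewrite /= expr0n /= addr0 sqrtr0 expr0n.
have p0 : p (fun=> 0) = 0.
  have := pZ 0 _ e0; rewrite [normc 0](_ : _ = 0) ?mul0r.
    by move=> <-; congr p; apply/funext => t; rewrite -[RHS]/(0 * 0 : R[i]) mul0r.
  by rewrite /= expr0n /= addr0 sqrtr0.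
have [s [r [r0 H]]] := pc _ e0 1 ltr01.
exists s, (2 / r); split; first by rewrite divr_ge0// ltW.
move=> u eu; set S := \sum_(q <- s) fine (weighted_sn q u).
have sq q : q \in s -> fine (weighted_sn q u) <= S.
  move=> qs; rewrite /S (big_rem q)//= lerDl sumr_ge0// => q' _.
  by rewrite fine_ge0// weighted_sn_ge0.
have S0 : 0 <= S by apply: sumr_ge0 => q _; rewrite fine_ge0// weighted_sn_ge0.
apply/ler_addgt0Pr => e e_gt0.
(* S may vanish, hence the perturbation by e. All norms of c u are less than r, so p (c u) < 1 and p
   u < 1 / c = (2 / r) S + e. *)
pose x := S + e * (r / 2); have x0 : 0 < x by rewrite ltr_wpDl// mulr_gt0// divr_gt0.
pose c := r / (2 * x); have c0 : 0 < c by rewrite divr_gt0// mulr_gt0.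
have := H _ (eltZ c%:C eu); rewrite p0 !subr0.
have -> : p (fun t => c%:C * u t) = c * p u.
  have := pZ c%:C _ eu; rewrite normc_real gtr0_norm// => <-.
move=> /(_ _) pc1.
have {}pc1 : `|c * p u| < 1.
  apply: pc1 => q qs.
  rewrite /=.
  rewrite weighted_snZ; last by case: eu.
  rewrite (weighted_sn_fin q eu) normc_real gtr0_norm// -EFinM lte_fin.
  apply: (@le_lt_trans _ _ (c * x)).
    by rewrite ler_pM2l// (le_trans (sq _ qs))// /x lerDl mulr_ge0 ?divr_ge0 ?ltW.
  by rewrite /c invfM mulrA mulfVK ?gt_eqF// ltr_pdivrMr// mulr2n mulrDr mulr1 ltrDl.
have : c * p u < 1 by apply: le_lt_trans pc1; exact: ler_norm.
rewrite -ltr_pdivlMl// mulr1 => /ltW H2; apply: (le_trans H2).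
rewrite /c invfM invrK /x; rewrite le_eqVlt; apply/orP; left; apply/eqP; field.
by rewrite gt_eqF.
Qed.

End weighted_spaces.

(** * Coordinates, neighbourhoods and steps in the space of (x', xi', mu) *)

Section parameter_space.
Variables (R : realType) (m : nat).
Implicit Types (p : pvar R m) (i : pcoord m).
Local Notation Om := (@kdom R m).

Lemma cvge0_le (T : Type) (F : set_system T) (f : T -> \bar R) : Filter F ->
  (forall x, (0 <= f x)%E) ->
  (forall e : R, 0 < e -> \forall x \near F, (f x <= e%:E)%E) ->
  f x @[x --> F] --> (0 : \bar R)%E.
Proof.
move=> FF f0 H; apply/fine_cvgP; split.
  apply: filterS (H 1 ltr01) => x fx; rewrite ge0_fin_numE//.
  by apply: le_lt_trans fx _; rewrite ltry.
apply/cvgrPdist_le => e e0; apply: filterS (H e e0) => x fx /=.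
rewrite sub0r normrN ger0_norm ?fine_ge0//.
have fin : f x \is a fin_num by rewrite ge0_fin_numE// (le_lt_trans fx)// ltry.
by rewrite -lee_fin fineK.
Qed.

Definition pcoordv i p : R :=
  match i with
  | inl (inl k) => p.1.1 0 k
  | inl (inr k) => p.1.2 0 k
  | inr _ => p.2
  end.

Lemma pcoordv_inj p p' : (forall i, pcoordv i p = pcoordv i p') -> p = p'.
Proof.
case: p p' => [[x xi] mu] [[x' xi'] mu'] H; congr (_, _, _).
- by apply/rowP => k; exact: (H (inl (inl k))).
- by apply/rowP => k; exact: (H (inl (inr k))).
- exact: (H (inr tt)).
Qed.

Lemma pcoordv_line i p (h : R) j :
  pcoordv i (p + h *: pdir R j) = pcoordv i p + h * (i == j)%:R.
Proof.
by case: j => [[j|j]|[]]; case: i => [[i|i]|[]] /=;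
  rewrite ?mxE ?scaler0 ?mxE ?mulr0 ?addr0//.
Qed.

(** Displacement by coordinates: only partial derivatives are at hand, so nearby points are joined
    one coordinate at a time. *)
Definition pcomb p (a : pcoord m -> R) : pvar R m := p + \sum_i a i *: pdir R i.

Lemma pcoordv_sum i (s : seq (pcoord m)) (a : pcoord m -> R) p :
  pcoordv i (p + \sum_(j <- s) a j *: pdir R j) =
  pcoordv i p + \sum_(j <- s) a j * (i == j)%:R.
Proof.
elim: s p => [|j s IH] p; first by rewrite !big_nil !addr0.
by rewrite !big_cons addrA IH pcoordv_line addrA.
Qed.

Lemma pcoordv_pcomb i p a : pcoordv i (pcomb p a) = pcoordv i p + a i.
Proof.
rewrite /pcomb pcoordv_sum (bigD1 i)//= eqxx mulr1 big1 ?addr0// => j ji.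
by rewrite eq_sym (negbTE ji) mulr0.
Qed.

Lemma pcomb_coord p p' : pcomb p (fun i => pcoordv i p' - pcoordv i p) = p'.
Proof. by apply: pcoordv_inj => i; rewrite pcoordv_pcomb subrKC. Qed.

Lemma pcomb0 p : pcomb p (fun=> 0) = p.
Proof. by apply: pcoordv_inj => i; rewrite pcoordv_pcomb addr0. Qed.

Lemma pcomb_line p a j (h : R) : pcomb p a + h *: pdir R j =
  pcomb p (fun i => a i + h * (i == j)%:R).
Proof.
by apply: pcoordv_inj => i; rewrite pcoordv_line !pcoordv_pcomb addrA.
Qed.

Lemma nbhs_box p (A : set (pvar R m)) : nbhs p A -> exists2 eta : R, 0 < eta &
  forall a, (forall i, `|a i| <= eta) -> A (pcomb p a).
Proof.
move=> /nbhs_ballP[r /= r0 rA]; pose K : R := \sum_i `|pdir R (i : pcoord m)| + 1.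
have K0 : 0 < K by rewrite ltr_wpDl// sumr_ge0.
exists (r / (2 * K)); first by rewrite divr_gt0// mulr_gt0.
move=> a Ha; apply: rA; rewrite -ball_normE /= /pcomb opprD addrA subrr add0r normrN.
apply: (le_lt_trans (ler_norm_sum _ _ _)).
apply: (@le_lt_trans _ _ (r / (2 * K) * K)).
  rewrite /K mulrDr mulr1 -[leLHS]addr0 lerD//; last by rewrite divr_ge0 ?mulr_ge0 ?(ltW r0) ?(ltW K0).
  rewrite mulr_sumr; apply: ler_sum => i _; rewrite normrZ.
  exact: ler_wpM2r.
by rewrite invfM mulrA mulfVK ?gt_eqF// ltr_pdivrMr// mulr2n mulrDr mulr1 ltrDl.
Qed.

Lemma pcoordv_continuous i : continuous (pcoordv i).
Proof.
move=> p; case: i => [[k|k]|[]]; last exact: cvg_snd.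
- apply: (@cvg_comp _ _ _ (fun q : pvar R m => q.1.1)
    (fun M : 'rV[R]_m => M 0 k) (nbhs p) (nbhs p.1.1) (nbhs (p.1.1 0 k))).
    apply: (@cvg_comp _ _ _ (fun q : pvar R m => q.1)
      (fun q : 'rV[R]_m * 'rV[R]_m => q.1) (nbhs p) (nbhs p.1) (nbhs p.1.1)); exact: cvg_fst.
  exact: coord_continuous.
- apply: (@cvg_comp _ _ _ (fun q : pvar R m => q.1.2)
    (fun M : 'rV[R]_m => M 0 k) (nbhs p) (nbhs p.1.2) (nbhs (p.1.2 0 k))).
    apply: (@cvg_comp _ _ _ (fun q : pvar R m => q.1)
      (fun q : 'rV[R]_m * 'rV[R]_m => q.2) (nbhs p) (nbhs p.1) (nbhs p.1.2)).
      exact: cvg_fst.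
    exact: cvg_snd.
  exact: coord_continuous.
Qed.

Lemma near_pcoordv p (eta : R) : 0 < eta ->
  \forall q \near p, forall i, `|pcoordv i q - pcoordv i p| <= eta.
Proof.
move=> eta0; have FF : Filter (nbhs p) by exact: nbhs_filter.
have H (s : seq (pcoord m)) : \forall q \near p, forall i, i \in s ->
    `|pcoordv i q - pcoordv i p| <= eta.
  elim: s => [|i s IH]; first by apply: (filterS _ (@filterT _ (nbhs p) _)) => q _ i; rewrite in_nil.
  have /cvgrPdist_le /(_ eta eta0) Hi := @pcoordv_continuous i p.
  apply: filterS2 IH Hi => q qs qi j; rewrite inE => /orP[/eqP ->|]; last exact: qs.
  by rewrite distrC.
by apply: filterS (H (index_enum _)) => q + i; apply; exact: mem_index_enum.
Qed.

Lemma kpoint1_continuous : continuous (fun p => kpoint p 1).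
Proof.
move=> p.
have H1 : (fun q : pvar R m => q.1.1) @ p --> p.1.1.
  apply: (@cvg_comp _ _ _ (fun q : pvar R m => q.1)
      (fun q : 'rV[R]_m * 'rV[R]_m => q.1) (nbhs p) (nbhs p.1)); exact: cvg_fst.
have H2 : (fun q : pvar R m => q.1.2) @ p --> p.1.2.
  apply: (@cvg_comp _ _ _ (fun q : pvar R m => q.1)
      (fun q : 'rV[R]_m * 'rV[R]_m => q.2) (nbhs p) (nbhs p.1)).
    exact: cvg_fst.
  exact: cvg_snd.
have H3 : (fun q : pvar R m => q.2) @ p --> p.2 by exact: cvg_snd.
have H4 : (fun q : pvar R m => 1 : R^o) @ p --> (1 : R^o) by exact: cvg_cst.
exact: (cvg_pair (cvg_pair (cvg_pair H1 H4) H2) H3).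
Qed.

(** This is the source of the local uniformity of the L^2 bounds in the parameters. *)
Lemma symbol_weight_continuous (a b : R) :
  continuous (fun p => jap p.1.2 `^ a * jap2 p.1.2 p.2 `^ b).
Proof.
move=> p; rewrite (_ : (fun p => _) = (fun p =>
    bracket false (kpoint p 1) `^ (2^-1 * a) * bracket true (kpoint p 1) `^ (2^-1 * b))).
  apply: cvgM.
  - apply: (cvg_comp (fun p => kpoint p 1) (fun z => bracket false z `^ (2^-1 * a))).
      exact: kpoint1_continuous.
    exact: powR_bracket_continuous.
  - apply: (cvg_comp (fun p => kpoint p 1) (fun z => bracket true z `^ (2^-1 * b))).
      exact: kpoint1_continuous.
    exact: powR_bracket_continuous.
apply/funext => q; rewrite bracket_jap bracket_jap2 /=.
by congr (_ * _); rewrite -powR_mulrn ?ltW ?jap_gt0 ?jap2_gt0// -powRrM mulrA mulfV ?mul1r.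
Qed.

(** A step h < 0 is a step -h along the opposite direction, where the first derivative and its
    approximation c change sign and the second derivative does not. *)
Lemma slice_taylor_between (u ui uii : kvar R m -> R[i]) i p l (c : R -> R[i]) (h M : R) :
  0 <= M -> (forall s, between s h -> pdom (p + s *: pdir R i)) ->
  continuous_along (E := complex_lcs R) Om u ->
  continuous_along (E := complex_lcs R) Om ui ->
  continuous_along (E := complex_lcs R) Om uii ->
  measC c ->
  is_D (E := complex_lcs R) Om (kdir R (kcoord_of i)) u ui ->
  is_D (E := complex_lcs R) Om (kdir R (kcoord_of i)) ui uii ->
  (forall s, between s h ->
    (L2norm (fun t => ((t ^+ l)%:C *
      (ui (kpoint (p + s *: pdir R i) t) - c t))%R) <= M%:E)%E) ->
  (L2norm (fun t => ((t ^+ l)%:C * (u (kpoint (p + h *: pdir R i) t) - u (kpoint p t)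
     - h%:C * ('i * c t)))%R) <= (2 * (`|h| * M))%:E)%E.
Proof.
move=> M0 seg cu cui cuii mc du dui HM; rewrite -kvec_pdir in du dui.
have [h0|h0|h0] := ltgtP 0 h.
- rewrite gtr0_norm//; apply: (slice_taylor h0 M0 _ cu cui cuii mc du dui).
    by move=> s sh; apply: seg; rewrite /between sh.
  by move=> s sh; apply: HM; rewrite /between sh.
- have Nh0 : 0 < - h by rewrite oppr_gt0.
  have bN s : 0 <= s <= - h -> between (- s) h.
    by move=> /andP[s0 sh]; apply/orP; right; rewrite lerNr sh oppr_le0 s0.
  have cN w : continuous_along (E := complex_lcs R) Om w ->
      continuous_along (E := complex_lcs R) Om (fun q => - 1 * w q).
    by move=> cw; apply: contM => //; exact: cont_cst.
  have dN w w' : is_D (E := complex_lcs R) Om (kvec (pdir R i)) w w' ->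
      is_D (E := complex_lcs R) Om (kvec (- pdir R i)) w (fun q => - 1 * w' q).
    move=> dw; rewrite kvecN; apply: isD_ext (isDN dw) => // q _.
    by rewrite mulN1r.
  have mcN : measC (fun t => - 1 * c t) by apply: measC_mul => //; exact: measC_cst.
  have := slice_taylor (v := - pdir R i) (l := l) (p := p) Nh0 M0 _ cu (cN _ cui)
    (cN _ (cN _ cuii)) mcN (dN _ _ du) (isDZ (- 1) (dN _ _ dui)).
  rewrite ltr0_norm// (eq_L2norm (g := fun t => (t ^+ l)%:C *
    (u (kpoint (p + h *: pdir R i) t) - u (kpoint p t) - h%:C * ('i * c t)))).
    apply=> s sh; first by rewrite scalerN -scaleNr; apply: seg; exact: bN.
    have := HM (- s) (bN s sh).
    rewrite -(eq_L2norm (f := fun t => - 1 * ((t ^+ l)%:C *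
      (- 1 * ui (kpoint (p + s *: - pdir R i) t) - - 1 * c t)))); last first.
      by move=> t _; rewrite scalerN scaleNr; ring.
    rewrite L2normZ; last first.
      apply: measC_mul; first exact: measC_pow.
      apply: measC_sub => //; apply: measC_mul; first exact: measC_cst.
      apply: slice_measC => //; rewrite scalerN -scaleNr.
      by apply: seg; exact: bN.
    by rewrite normcN normc_real normr1 mul1e.
  move=> t _; rewrite scalerN scaleNr opprK.
  by rewrite (rmorphN (real_complex R)); ring.
- subst h; rewrite normr0 mul0r mulr0.
  rewrite (eq_L2norm (g := fun=> 0)).
    by apply/L2norm_le => //; rewrite /Q2 expr0n /= integral0_eq// => t _;
      rewrite /= expr0n /= addr0 sqrtr0 expr0n.
  by move=> t _; rewrite scale0r addr0 subrr mul0r subr0 mulr0.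
Qed.

End parameter_space.

(** * Function-valued symbols versus L^2 estimates of scalar derivatives *)

Section symbols_and_kernels.
Variables (R : realType) (m : nat) (d nu : R) (Q : countType) (wt : Q -> nat * nat).
Implicit Types (p : pvar R m) (i : pcoord m) (q : Q) (al : {ffun pcoord m -> nat}).
Local Notation normc := Normc.normc.
Local Notation Om := (@kdom R m).
Local Notation pdom := (@pdom R m).
Local Notation nn := (inl (inl (inr tt)) : kcoord m).
Local Notation E := (weighted_lcs R wt).
Local Notation cont := (continuous_along (E := complex_lcs R) Om).
Local Notation isD := (is_D (E := complex_lcs R) Om).

Definition kindex (l : nat) (al : {ffun pcoord m -> nat}) : {ffun kcoord m -> nat} :=
  [ffun k : kcoord m => match k with
    | inl (inl (inl i)) => al (inl (inl i)) | inl (inl (inr _)) => l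
    | inl (inr i) => al (inl (inr i)) | inr _ => al (inr tt) end].

Lemma kindexS l al i : kindex l [ffun k => (al k + (k == i))%N] =
  [ffun k => (kindex l al k + (k == kcoord_of i))%N].
Proof.
apply/ffunP => k; rewrite !ffunE.
by case: k => [[[k|[]]|k]|[]]; rewrite ?ffunE; case: i => [[i|i]|[]] /=;
  rewrite ?addn0.
Qed.

Lemma kindex_xn l al : kindex l.+1 al = [ffun k => (kindex l al k + (k == nn))%N].
Proof.
apply/ffunP => k; rewrite !ffunE.
by case: k => [[[k|[]]|k]|[]] /=; rewrite ?addn0 ?addn1.
Qed.

Lemma kindex_pidx l (be al : {ffun 'I_m -> nat}) j :
  kindex l (pidx be al j) = kidx be l al j :> {ffun kcoord m -> nat}.
Proof. by apply/ffunP => k; rewrite !ffunE; case: k => [[[k|[]]|k]|[]]; rewrite ?ffunE. Qed.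

Lemma kindex0 : kindex 0 [ffun=> 0%N] = [ffun=> 0%N].
Proof. by apply/ffunP => k; rewrite !ffunE; case: k => [[[k|[]]|k]|[]]; rewrite ?ffunE. Qed.

Lemma pidxE (al : {ffun pcoord m -> nat}) : exists (be ga : {ffun 'I_m -> nat}) j, al = pidx be ga j.
Proof.
exists [ffun k => al (inl (inl k))], [ffun k => al (inl (inr k))], (al (inr tt)).
by apply/ffunP => -[[k|k]|[]]; rewrite !ffunE.
Qed.

Variables (f : kvar R m -> R[i]) (F : {ffun kcoord m -> nat} -> kvar R m -> R[i]).
Hypothesis dF : D_family (E := complex_lcs R) Om (@kdir R m) f F.

Local Notation U l al p := (fun t : R => F (kindex l al) (kpoint p t)).

Lemma contF (ga : {ffun kcoord m -> nat}) : cont (F ga).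
Proof. by have [_ /(_ ga)[]] := dF. Qed.

Lemma isD_F l al i :
  isD (kdir R (kcoord_of i)) (F (kindex l al)) (F (kindex l [ffun k => (al k + (k == i))%N])).
Proof. by have [_ /(_ (kindex l al))[_ _ /(_ (kcoord_of i))]] := dF; rewrite kindexS. Qed.

Lemma Dt_sequence_F al p : pdom p -> Dt_sequence (fun l => U l al p).
Proof.
move=> pp; apply: (@Dt_sequence_slice _ _ (fun l => F (kindex l al))) => // l.
by have [_ /(_ (kindex l al))[_ _ /(_ nn)]] := dF; rewrite kindex_xn.
Qed.

Lemma measC_F al p l : pdom p -> measC (U l al p).
Proof. by move=> pp; apply: slice_measC => //; exact: contF. Qed.

Lemma weighted_sn_slice al p q (v : R -> R[i]) : pdom p ->
  (forall t, 0 < t -> v t = U 0%N al p t) ->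
  weighted_sn wt q v = L2norm (fun t => (t ^+ (wt q).1)%:C * U (wt q).2 al p t).
Proof.
move=> pp vU; apply: eq_L2norm => t t0; congr (_ * _).
exact: (Dt_sequence_Dt (Dt_sequence_F al pp) vU).
Qed.

(** The symbol estimates for the generating norms, expressed by the scalar derivatives F. *)
Definition slice_bounds := forall (be ga : {ffun 'I_m -> nat}) (j : nat) q,
  exists2 C : R, 0 <= C & forall x xi mu, 0 <= mu ->
    (L2norm (fun t => ((t ^+ (wt q).1)%:C * F (kidx be (wt q).2 ga j) (x, t, xi, mu))%R)
     <= (C * (jap xi `^ (nu - (msize ga)%:R) * jap2 xi mu `^ (d - nu - j%:R)))%:E)%E.

Section bounds_to_symbol.
Hypothesis bnd : slice_bounds.

(** Near [p0] the weight exceeds its value at [p0] by less than 1. A list of multi-indices is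
    allowed because continuity needs one bound for all first derivatives. *)
Lemma slice_local_bound (als : seq {ffun pcoord m -> nat}) q p0 :
  exists2 M : R, 0 <= M & \forall p \near p0, pdom p -> forall al, al \in als ->
    (L2norm (fun t => ((t ^+ (wt q).1)%:C * U (wt q).2 al p t)%R) <= M%:E)%E.
Proof.
have FF : Filter (nbhs p0) by exact: nbhs_filter.
elim: als => [|al als [M M0 IH]].
  by exists 0 => //; apply: (filterS _ (@filterT _ (nbhs p0) _)) => p _ _ al; rewrite in_nil.
have [be [al' [j alE]]] := pidxE al.
have [C C0 HC] := bnd be al' j q.
pose wgt p := jap p.1.2 `^ (nu - (msize al')%:R) * jap2 p.1.2 p.2 `^ (d - nu - j%:R).
have w0 p : 0 <= wgt p by rewrite mulr_ge0// powR_ge0.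
exists (M + C * (wgt p0 + 1)); first by rewrite addr_ge0// mulr_ge0// addr_ge0.
have /cvgrPdist_lt /(_ 1 ltr01) := @symbol_weight_continuous R m
  (nu - (msize al')%:R) (d - nu - j%:R) p0.
move=> W; apply: filterS2 IH W => p IH wp pp al''; rewrite inE => /orP[/eqP ->|].
  case: p pp wp {IH} => -[x xi] mu pp wp; rewrite alE kindex_pidx.
  apply: (le_trans (HC x xi mu pp)); rewrite lee_fin -[leLHS]add0r lerD// ler_wpM2l//.
  move: wp; rewrite distrC => wp; rewrite -lerBlDl.
  exact: le_trans (ler_norm _) (ltW wp).
by move=> /(IH pp) H; apply: (le_trans H); rewrite lee_fin lerDl mulr_ge0// addr_ge0.
Qed.

Definition slice_family (al : {ffun pcoord m -> nat}) p : R -> R[i] := U 0%N al p.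

Lemma slice_family_elt al p : pdom p -> elt (l := E) (slice_family al p).
Proof.
move=> pp; split.
  exact: (Dt_sequence_smooth (Dt_sequence_F al pp) (fun _ _ => erefl)).
move=> q; rewrite (weighted_sn_slice q pp (fun _ _ => erefl)).
have [M M0 /nbhs_singleton /(_ pp al (mem_head _ _)) H] := slice_local_bound [:: al] q p.
by apply: le_lt_trans H _; rewrite ltry.
Qed.

Lemma L2norm0 : L2norm (fun=> 0 : R[i]) = 0%E.
Proof.
apply/le_anti/andP; split; last exact: L2norm_ge0.
apply/(L2norm_le _ (lexx 0)); rewrite /Q2 expr0n /= integral0_eq// => t _.
by rewrite /= expr0n /= addr0 sqrtr0 expr0n.
Qed.

Lemma slice_mean_value al i q p (h M : R) : 0 <= M ->
  (forall s, between s h -> pdom (p + s *: pdir R i)) ->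
  (forall s, between s h -> (L2norm (fun t => ((t ^+ (wt q).1)%:C *
     U (wt q).2 [ffun k => (al k + (k == i))%N] (p + s *: pdir R i) t)%R) <= M%:E)%E) ->
  (L2norm (fun t => ((t ^+ (wt q).1)%:C *
    (U (wt q).2 al (p + h *: pdir R i) t - U (wt q).2 al p t))%R)
      <= (2 * (`|h| * M))%:E)%E.
Proof.
move=> M0 seg HM.
have := @slice_taylor_between R m _ _ _ i p (wt q).1 (fun=> 0) h M M0 seg
  (contF _) (contF _) (contF _) (measC_cst 0) (isD_F (wt q).2 al i)
  (isD_F (wt q).2 _ i).
rewrite (eq_L2norm (g := fun t => (t ^+ (wt q).1)%:C *
    (U (wt q).2 al (p + h *: pdir R i) t - U (wt q).2 al p t))).
  apply=> s sh; have := HM s sh; congr (_ <= _)%E.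
  by apply: eq_L2norm => t _; rewrite subr0.
by move=> t _; rewrite !mulr0 subr0.
Qed.

(** From [p0] to p one coordinate at a time: by the mean value inequality each of the n steps, of
    length at most eta, changes the slice by at most 2 eta M. *)
Lemma slice_family_cont al : continuous_along (E := E) pdom (slice_family al).
Proof.
move=> p0 pp0 q; have FF : Filter (nbhs p0) by exact: nbhs_filter.
apply: cvge0_le => [p|e e0]; first exact: weighted_sn_ge0.
rewrite near_withinE.
pose als := [seq [ffun k => (al k + (k == i))%N] | i <- enum (pcoord m)].
have [M M0 HM] := slice_local_bound als q p0.
have alsP i : [ffun k => (al k + (k == i))%N] \in als.
  by apply/mapP; exists i => //; rewrite mem_enum.
have [eta0 eta00 box] := nbhs_box HM.
pose n := size (index_enum (pcoord m)).
(* The n steps cost at most eta n 2 M, which eta <= e / K keeps below e; the summand 1 makes K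
   positive. *)
pose K : R := n%:R * (2 * M) + 1; have K0 : 0 < K by rewrite ltr_wpDl// !mulr_ge0.
pose eta := Num.min eta0 (e / K); have eta_gt0 : 0 < eta by rewrite lt_min eta00 divr_gt0.
apply: (filterS _ (near_pcoordv p0 eta_gt0)) => p Hp pp.
pose c i := pcoordv i p - pcoordv i p0.
have eta_ge0 := ltW eta_gt0.
(* At [pcomb p0 (a s)] the coordinates in s have already been moved to those of p. *)
pose a (s : seq (pcoord m)) i := if i \in s then c i else 0 : R.
pose Nrm z := L2norm (fun t => ((t ^+ (wt q).1)%:C *
  (U (wt q).2 al z t - U (wt q).2 al p0 t))%R).
(* The mu-coordinate stays between those of [p0] and p, both of which are nonnegative. *)
have pdomP b : between (b (inr tt)) (c (inr tt)) -> pdom (pcomb p0 b).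
  move=> bc; have E0 := pcoordv_pcomb (inr tt) p0 b.
  rewrite /Defs.pdom/= -[X in 0 <= X]/(pcoordv (inr tt) (pcomb p0 b)) E0.
  rewrite /c in bc; have p2 : 0 <= pcoordv (inr tt) p by exact: pp.
  have p02 : 0 <= pcoordv (inr tt) p0 by exact: pp0.
  case/orP: bc => /andP[b1 b2]; first exact: addr_ge0.
  by move: b1; rewrite lerBlDl; apply: le_trans.
have path s : uniq s -> (Nrm (pcomb p0 (a s)) <= ((size s)%:R * (2 * (eta * M)))%:E)%E
    /\ pdom (pcomb p0 (a s)).
  elim: s => [_|j s IH /= /andP[js us]].
    have -> : pcomb p0 (a [::]) = p0 by rewrite (_ : a _ = fun=> 0) ?pcomb0.
    split=> //; rewrite mul0r /Nrm (eq_L2norm (g := fun=> 0)) ?L2norm0//.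
    by move=> t _; rewrite subrr mulr0.
  have [IH1 IH2] := IH us.
  have aE : pcomb p0 (a (j :: s)) = pcomb p0 (a s) + c j *: pdir R j.
    rewrite pcomb_line; congr pcomb; apply/funext => i.
    rewrite /a inE; have [->|ij] := eqVneq i j; last by rewrite mulr0 addr0.
    by rewrite (negbTE js) add0r mulr1.
  have segb r : between r (c j) -> pdom (pcomb p0 (a s) + r *: pdir R j) /\
      (forall i, `|a s i + r * (i == j)%:R| <= eta).
    move=> rb; split.
      rewrite pcomb_line; apply: pdomP; rewrite /a.
      have [jmu|jmu] := eqVneq (inr tt) j.
        by rewrite jmu (negbTE js) add0r mulr1.
      rewrite mulr0 addr0; case: ifP => _; last by rewrite /between lexx; case: leP => // /ltW ->.
      by rewrite /between lexx !andbT; case: leP => // /ltW ->.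
    move=> i; rewrite /a; have [->|ij] := eqVneq i j.
      rewrite (negbTE js) add0r mulr1; apply: le_trans (Hp j); rewrite -/(c j).
      case/orP: rb => /andP[r1 r2]; first by rewrite !ger0_norm// (le_trans r1).
      by rewrite !ler0_norm ?lerN2// (le_trans r1).
    by rewrite mulr0 addr0; case: ifP => _; rewrite ?normr0//; exact: Hp.
  have cc : between (c j) (c j).
    by rewrite /between !lexx !andbT /= le_total.
  split; last by rewrite aE; have [] := segb _ cc.
  have step := @slice_mean_value al j q (pcomb p0 (a s)) (c j) M M0
    (fun r rb => (segb r rb).1).
  have {}step : (L2norm (fun t => ((t ^+ (wt q).1)%:C *
      (U (wt q).2 al (pcomb p0 (a s) + c j *: pdir R j) t -
       U (wt q).2 al (pcomb p0 (a s)) t))%R) <= (2 * (`|c j| * M))%:E)%E.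
    apply: step => r rb; have [pr ar] := segb r rb.
    move: pr; rewrite pcomb_line => pr; apply: box => // i.
    by apply: le_trans (ar i) _; rewrite /eta ge_min lexx.
  have mz z z' : pdom z -> pdom z' -> measC (fun t => (t ^+ (wt q).1)%:C *
      (U (wt q).2 al z t - U (wt q).2 al z' t)).
    move=> pz pz'; apply: measC_mul; first exact: measC_pow.
    by apply: measC_sub; exact: measC_F.
  have := L2normD (mz _ _ (segb _ cc).1 IH2) (mz _ _ IH2 pp0).
  rewrite (eq_L2norm (g := fun t => (t ^+ (wt q).1)%:C *
      (U (wt q).2 al (pcomb p0 (a (j :: s))) t - U (wt q).2 al p0 t))).
    move=> H; apply: (le_trans H); rewrite -natr1 mulrDl mul1r addrC EFinD.
    apply: leeD => //; apply: (le_trans step); rewrite lee_fin ler_pM2l// ler_wpM2r//.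
    exact: Hp.
  by move=> t _; rewrite aE -mulrDr addrA subrK.
have [] := path (index_enum (pcoord m)) (index_enum_uniq _).
have -> : pcomb p0 (a (index_enum (pcoord m))) = p.
  rewrite -[RHS](pcomb_coord p0 p); congr pcomb; apply/funext => i.
  by rewrite /a mem_index_enum.
move=> H _.
have -> : sn (l := E) q (slice_family al p - slice_family al p0) = Nrm p.
  have D := Dt_sequenceD (Dt_sequence_F al pp) (Dt_sequenceZ (- 1) (Dt_sequence_F al pp0)).
  apply: eq_L2norm => t t0; congr (_ * _).
  have /(_ _ (wt q).2 t t0) := Dt_sequence_Dt (v := slice_family al p - slice_family al p0) D.
  by rewrite mulN1r; apply => r r0; rewrite mulN1r.
apply: (le_trans H); rewrite lee_fin -/n.
apply: (@le_trans _ _ (e / K * (n%:R * (2 * M)))).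
  rewrite (_ : n%:R * (2 * (eta * M)) = eta * (n%:R * (2 * M))); last by ring.
  by rewrite ler_wpM2r ?mulr_ge0// /eta ge_min lexx orbT.
rewrite -mulrA ler_piMr ?(ltW e0)// mulrC ler_pdivrMr// mul1r /K lerDl//.
Qed.

(** With M bounding the second derivative locally, the first derivative changes by at most 2 |h| M
    along the step. Taylor's formula turns this into an error 4 |h|^2 M of the increment, and 4 |h|
    M of the difference quotient. *)
Lemma slice_family_isD al i : is_D (E := E) pdom (pdir R i) (slice_family al)
  (slice_family [ffun k => (al k + (k == i))%N]).
Proof.
move=> p0 pp0 q; set al1 := [ffun k => (al k + (k == i))%N].
have FF : Filter (within [set h : R | pdom (p0 + h *: pdir R i)] (0 : R)^') by exact: _.
apply: (@cvge0_le _ _ _ _ FF) => [h|e e0]; first exact: weighted_sn_ge0.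
pose al2 := [ffun k => (al1 k + (k == i))%N].
have [M M0 HM] := slice_local_bound [:: al2] q p0.
have [eta0 eta00 box] := nbhs_box HM.
rewrite near_withinE.
have K0 : 0 < 4 * M + 1 by rewrite ltr_wpDl// mulr_ge0.
have small : \forall h \near (0 : R)^', `|h| <= eta0 /\ `|h| <= e / (4 * M + 1).
  by apply: filterI; apply: nbhs_dnbhs; apply: (@nbhs0_le R R) => //; rewrite divr_gt0.
have nz : \forall h \near (0 : R)^', h != 0 by exact: (@nbhs_dnbhs_neq R 0).
apply: filterS2 nz small => h h0 [h1 h2] ph.
have seg s : between s h -> pdom (p0 + s *: pdir R i).
  move=> sb; have E0 z := pcoordv_line (inr tt) p0 z i.
  rewrite /Defs.pdom/= -[X in 0 <= X]/(pcoordv (inr tt) (p0 + s *: pdir R i)) E0.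
  have p02 : 0 <= pcoordv (inr tt) p0 by exact: pp0.
  have : 0 <= pcoordv (inr tt) (p0 + h *: pdir R i) by exact: ph.
  rewrite E0; case: eqP => _; last by rewrite !mulr0 addr0.
  rewrite !mulr1 => ph2; case/orP: sb => /andP[s1 s2]; first exact: addr_ge0.
  by apply: (le_trans ph2); rewrite lerD2l.
have sh s : between s h -> `|s| <= `|h|.
  case/orP => /andP[r1 r2]; first by rewrite !ger0_norm// (le_trans r1).
  by rewrite !ler0_norm ?lerN2// (le_trans r1).
have bsub s r : between s h -> between r s -> between r h.
  case/orP => /andP[s1 s2] /orP[] /andP[r1 r2]; apply/orP.
  - by left; rewrite r1 (le_trans r2).
  - by left; rewrite (le_trans s1 r1) /= (le_trans r2)// (le_trans s1).
  - by right; rewrite (le_trans s1)//= ?(le_trans r2)// (le_trans _ r1)// .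
  - by right; rewrite r2 andbT (le_trans s1).
have first_order s : between s h -> (L2norm (fun t => ((t ^+ (wt q).1)%:C *
    (U (wt q).2 al1 (p0 + s *: pdir R i) t - U (wt q).2 al1 p0 t))%R)
      <= (2 * (`|h| * M))%:E)%E.
  move=> sb; have := @slice_mean_value al1 i q p0 s M M0 (fun r rb => seg r (bsub s r sb rb)).
  move=> H; apply: (le_trans (H _)); last first.
    by rewrite lee_fin ler_pM2l// ler_wpM2r// sh.
  move=> r rb; have rh := bsub s r sb rb; have pr := seg r rh.
  have := box (fun k => r * (k == i)%:R); rewrite (_ : pcomb _ _ = p0 + r *: pdir R i).
    move=> /(_ _ pr al2 (mem_head _ _)); apply => k.
    case: eqP => _; rewrite ?mulr1 ?mulr0 ?normr0 ?(ltW eta00)//.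
    by rewrite (le_trans (sh r rh)).
  by rewrite -[in RHS](pcomb0 p0) pcomb_line; congr pcomb; apply/funext => k; rewrite add0r.
have M2 : 0 <= 2 * (`|h| * M) by rewrite !mulr_ge0.
have second := @slice_taylor_between R m _ _ _ i p0 (wt q).1 (U (wt q).2 al1 p0) h
  (2 * (`|h| * M)) M2 seg (contF _) (contF _) (contF _) (measC_F al1 (wt q).2 pp0)
  (isD_F (wt q).2 al i) (isD_F (wt q).2 al1 i) first_order.
have mq : measC (fun t => (t ^+ (wt q).1)%:C *
    (U (wt q).2 al (p0 + h *: pdir R i) t - U (wt q).2 al p0 t
     - h%:C * ('i * U (wt q).2 al1 p0 t))).
  apply: measC_mul; first exact: measC_pow.
  apply: measC_sub; first by apply: measC_sub; exact: measC_F.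
  apply: measC_mul; first exact: measC_cst.
  by apply: measC_mul; [exact: measC_cst|exact: measC_F].
pose v : R -> R[i] := fun t => (- 'i * (h^-1)%:C) *
  (U 0%N al (p0 + h *: pdir R i) t - U 0%N al p0 t) - U 0%N al1 p0 t.
have DU z (ga : {ffun pcoord m -> nat}) : pdom z -> Dt_sequence (fun l => U l ga z).
  exact: Dt_sequence_F.
have D := Dt_sequenceD (Dt_sequenceZ (- 'i * (h^-1)%:C)
   (Dt_sequenceD (DU _ al ph) (Dt_sequenceZ (- 1) (DU _ al pp0))))
   (Dt_sequenceZ (- 1) (DU _ al1 pp0)).
have -> : sn (l := E) q ((- 'i * (h^-1)%:C) *: (slice_family al (p0 + h *: pdir R i)
    - slice_family al p0) - slice_family al1 p0) =
  L2norm (fun t => (- 'i * (h^-1)%:C) * ((t ^+ (wt q).1)%:C *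
    (U (wt q).2 al (p0 + h *: pdir R i) t - U (wt q).2 al p0 t
     - h%:C * ('i * U (wt q).2 al1 p0 t)))).
  apply: eq_L2norm => t t0.
  rewrite (_ : Dt _ _ t = Dt (wt q).2 v t)//.
  rewrite (Dt_sequence_Dt (v := v) D) => [|r r0|//]; last by rewrite /v !mulN1r.
  have hC : (h^-1)%:C * h%:C = 1 :> R[i].
    by rewrite -(rmorphM (real_complex R)) mulVf.
  have -> : (- 'i * (h^-1)%:C) * ((t ^+ (wt q).1)%:C *
    (U (wt q).2 al (p0 + h *: pdir R i) t - U (wt q).2 al p0 t
     - h%:C * ('i * U (wt q).2 al1 p0 t))) = (t ^+ (wt q).1)%:C * ((- 'i * (h^-1)%:C) *
    (U (wt q).2 al (p0 + h *: pdir R i) t - U (wt q).2 al p0 t)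
     + ('i * 'i) * ((h^-1)%:C * h%:C) * U (wt q).2 al1 p0 t) by ring.
  by rewrite hC -expr2 sqr_i; ring.
rewrite L2normZ// Normc.normcM normcN normc_real.
rewrite [normc 'i](_ : _ = 1) ?mul1r; last by rewrite /= expr0n expr1n add0r sqrtr1.
apply: (le_trans (lee_wpmul2l _ second)); first by rewrite lee_fin.
rewrite -EFinM lee_fin normfV (_ : _ * _ = (`|h|^-1 * `|h|) * (`|h| * (4 * M))); last by ring.
rewrite mulVf ?normr_eq0// mul1r; apply: (le_trans (ler_wpM2r _ h2)); first by rewrite mulr_ge0.
by rewrite -mulrA ler_piMr ?(ltW e0)// mulrC ler_pdivrMr// mul1r lerDl.
Qed.

Lemma symbol_of_bounds : symbol d nu (E := E) (slice_family [ffun=> 0%N]).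
Proof.
exists slice_family; split.
  split; first by [].
  move=> al; split; [exact: slice_family_elt|exact: slice_family_cont|exact: slice_family_isD].
move=> sp sp1 sp2 be ga j.
have [s [C [C0 H]]] := seminorm_dominated sp1 sp2.
have /choice[Cq HCq] : forall q, exists C : R, 0 <= C /\ forall x xi mu, 0 <= mu ->
    (L2norm (fun t => ((t ^+ (wt q).1)%:C * F (kidx be (wt q).2 ga j) (x, t, xi, mu))%R)
     <= (C * (jap xi `^ (nu - (msize ga)%:R) * jap2 xi mu `^ (d - nu - j%:R)))%:E)%E.
  by move=> q; have [C' C'0 HC'] := bnd be ga j q; exists C'.
exists (C * \sum_(q <- s) Cq q).
  by rewrite mulr_ge0// sumr_ge0// => q _; case: (HCq q).
move=> x xi mu mu0; have pp : pdom (x, xi, mu) by [].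
have el := slice_family_elt (pidx be ga j) pp.
apply: (le_trans (H _ el)); rewrite -mulrA ler_wpM2l// mulr_suml; apply: ler_sum => q _.
rewrite -lee_fin -weighted_sn_fin// (weighted_sn_slice q pp (fun _ _ => erefl)).
by rewrite kindex_pidx; have [_] := HCq q; apply.
Qed.

End bounds_to_symbol.

Section symbol_to_bounds.
Variables (q0 : Q) (a : pvar R m -> R -> R[i]).
Hypothesis wt_q0 : wt q0 = (0, 0)%N.
Hypothesis a_f : forall p t, pdom p -> 0 < t -> a p t = f (kpoint p t).

(* The difference quotients converge to A pointwise in t through f and in L^2
   through a, so Fatou's lemma identifies the two limits. *)
Lemma symbol_family_slice A : D_family (E := E) pdom (@pdir R m) a A ->
  forall al p t, pdom p -> 0 < t -> A al p t = U 0%N al p t.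
Proof.
move=> [A0 DA] al; have [n] := ubnP (\sum_k al k)%N.
elim: n al => [//|n IH] al.
have [/forallP al0 _|] := boolP [forall k, al k == 0%N].
  have -> : al = [ffun=> 0%N] by apply/ffunP => k; rewrite ffunE; apply/eqP.
  move=> p t pp t0; rewrite A0// a_f// kindex0.
  by have [F0 _] := dF; rewrite F0.
rewrite negb_forall => /existsP[i ali] aln p t pp t0.
pose al' := [ffun k => (al k - (k == i))%N].
have alE : al = [ffun k => (al' k + (k == i))%N].
  apply/ffunP => k; rewrite !ffunE; case: eqP => [->|_]; last by rewrite subn0 addn0.
  by rewrite subnK// lt0n.
have aln' : (\sum_k al' k < n)%N.
  move: aln; rewrite {1}alE (eq_bigr (fun k => al' k + (k == i))%N); last first.
    by move=> k _; rewrite ffunE.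
  rewrite big_split /= (bigD1 i (F := fun k => nat_of_bool (k == i)))//= eqxx.
  rewrite [X in (_ + (_ + X))%N]big1; last by move=> k /negbTE ->.
  by rewrite addn0 addn1.
have [eA' _ /(_ i)] := DA al'; rewrite -alE => dA.
have [eA _ _] := DA al.
(* Positive steps stay in [pdom], also at mu = 0, and a sequence of them is what Fatou's lemma asks
   for. *)
pose h k : R := (k.+1%:R)^-1.
have h0 k : 0 < h k by rewrite invr_gt0.
have ph k : pdom (p + h k *: pdir R i).
  rewrite /Defs.pdom/= -[X in 0 <= X]/(pcoordv (inr tt) (p + h k *: pdir R i)) pcoordv_line.
  by rewrite addr_ge0// mulr_ge0// ltW.
(* The difference quotient of [A al'] minus its limit [A al] in the function space: it tends to 0 in
   L^2 and, by the induction hypothesis for [al'], pointwise to the function [G] below. *)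
pose g k : R -> R[i] := fun r => (- 'i * ((h k)^-1)%:C) *
  (A al' (p + h k *: pdir R i) r + (- 1) * A al' p r) + (- 1) * A al p r.
have sg k : smooth_Rplus (g k).
  have [s1 _] := eA' _ (ph k); have [s2 _] := eA' _ pp; have [s3 _] := eA _ pp.
  have [s4 _] := smooth_RplusZ (- 1) s2; have [s5 _] := smooth_RplusD s1 s4.
  have [s6 _] := smooth_RplusZ (- 'i * ((h k)^-1)%:C) s5.
  have [s7 _] := smooth_RplusZ (- 1) s3.
  by have [] := smooth_RplusD s6 s7.
have contDt0 (v : R -> R[i]) : smooth_Rplus v -> contC v.
  move=> sv r r0; have := Dt_sequence_contC 0 (smooth_Dt_sequence sv) r0.
  by rewrite (_ : Dt 0 v = v)//; apply/funext => z; rewrite /Dt expr0 mul1r /=; case: (v z).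
pose G r := U 0%N al p r - A al p r.
have cG : contC G.
  move=> r r0; have [s1 _] := eA p pp.
  have [c1 c2] := contDt0 _ s1 r r0.
  have [c3 c4] := Dt_sequence_contC 0 (Dt_sequence_F al pp) r0.
  split.
  - rewrite (_ : (fun t => _) = (fun t => complex.Re (U 0%N al p t) - complex.Re (A al p t))).
      exact: cvgB.
    by apply/funext => z; rewrite /G Re_sub.
  - rewrite (_ : (fun t => _) = (fun t => complex.Im (U 0%N al p t) - complex.Im (A al p t))).
      exact: cvgB.
    by apply/funext => z; rewrite /G Im_sub.
have hcvg : h k @[k --> \oo] --> (0 : R) by exact: cvg_harmonic.
have hin : h k @[k --> \oo] --> within [set z : R | pdom (p + z *: pdir R i)] (0 : R)^'.
  move=> S HS.
  have NH : \forall k \near \oo, (h k != 0 -> pdom (p + h k *: pdir R i) -> S (h k)) := hcvg _ HS.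
  by apply: filterS NH => k /(_ (lt0r_neq0 (h0 k)) (ph k)).
have gG r : 0 < r -> cvg_lcs (E := complex_lcs R) (fun k => g k r) \oo (G r).
  move=> r0.
  have dFi := isD_F 0 al' i; rewrite -alE in dFi.
  have /cvg_lcs_near H := dFi (kpoint p r) (kdom_kpoint pp r0).
  apply/cvg_lcs_near => e e0; have := H e e0.
  rewrite near_withinE near_withinE => H1.
  have NH : \forall k \near \oo, _ (h k) := hcvg _ H1.
  apply: filterS NH => k /= Hk.
  have {Hk} := Hk (lt0r_neq0 (h0 k)); rewrite -kvec_pdir -kpoint_line.
  move=> /(_ (kdom_kpoint (ph k) r0)); rewrite /g /G.
  rewrite (IH al' aln' _ _ (ph k) r0) (IH al' aln' _ _ pp r0).
  congr (normc _ < e); rewrite /GRing.scale /=; ring.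
have Lg : L2norm (g k) @[k --> \oo] --> (0 : \bar R)%E.
  have := cvg_comp _ _ hin (dA p pp q0).
  rewrite (_ : _ \o _ = (fun k => L2norm (g k)))//.
  apply/funext => k /=; rewrite /weighted_sn wt_q0 /=; apply: eq_L2norm => r r0.
  rewrite mul1r; set w := (X in Dt 0 X); rewrite (_ : Dt 0 w r = w r); last first.
    by rewrite /Dt expr0 mul1r /=; case: (w r).
  rewrite /w /g !mulN1r; exact: erefl.
have LG0 : L2norm G = 0%E.
  apply/le_anti/andP; split; last exact: L2norm_ge0.
  apply/lee_addgt0Pr => e e0; rewrite add0e.
  have [N _ HN] : \forall k \near \oo, (L2norm (g k) <= e%:E)%E.
    move: Lg => /fine_cvgP[fin /cvgrPdist_le /(_ e e0)].
    apply: filterS2 fin => k fk /=; rewrite sub0r normrN ger0_norm ?fine_ge0 ?L2norm_ge0//.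
    by rewrite -lee_fin fineK.
  (* The bound e holds only from N on, while Fatou's lemma is stated with a bound for all terms. *)
  apply: (@L2norm_fatou R (fun k => g (k + N)%N) G e (ltW e0)).
  - by move=> k; apply: contC_measC; exact/contDt0/sg.
  - exact: contC_measC.
  - move=> r r0; have /cvg_lcs_near H := gG r r0; apply/cvg_lcs_near => e' e'0.
    have [N' _ HN'] := H e' e'0; exists N' => // k kN'; apply: HN'.
    exact: leq_trans (leq_addr _ _).
  - by move=> k; apply: HN; rewrite /= leq_addl.
have := L2norm_eq0 cG LG0 t0; rewrite /G => /eqP; rewrite subr_eq0 => /eqP ->.
by [].
Qed.

Lemma bounds_of_symbol : symbol d nu (E := E) a -> slice_bounds.
Proof.
move=> [A [DA HA]] be ga j q.
have [sp1 sp2] := @weighted_seminorm R Q wt q.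
have [C C0 HC] := HA _ sp1 sp2 be ga j; exists C => // x xi mu mu0.
have pp : pdom (x, xi, mu) by [].
have [_ DA'] := DA; have [eA _ _] := DA' (pidx be ga j).
have := HC x xi mu mu0; rewrite -lee_fin -weighted_sn_fin; last exact: eA.
rewrite (weighted_sn_slice (al := pidx be ga j) q pp); first by rewrite kindex_pidx.
by move=> t t0; exact: (symbol_family_slice DA).
Qed.

End symbol_to_bounds.
End symbols_and_kernels.

(** * Poisson symbol-kernels *)

Section kernel_families.
Variables (R : realType) (m : nat) (d nu : R).
Implicit Types (f k : kvar R m -> R[i]) (F K : {ffun kcoord m -> nat} -> kvar R m -> R[i]).
Implicit Types (be ga : {ffun 'I_m -> nat}) (L : int -> Prop) (sigma : 'rV[R]_m -> R -> R).
Local Notation Om := (@kdom R m).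
Local Notation dir := (@kdir R m).
Local Notation kgrade := (@kgrade R m).
Local Notation family := (D_family (E := complex_lcs R) Om dir).

Definition family_bound L sigma F := forall be ga (j l l' : nat), L (l%:Z - l'%:Z) ->
  exists2 C : R, 0 <= C & forall x xi mu, 0 <= mu ->
    (L2norm (fun t => ((t ^+ l)%:C * F (kidx be l' ga j) (x, t, xi, mu))%R)
     <= (C * (sigma xi mu `^ (l%:R - l'%:R) *
          (jap xi `^ (nu - (msize ga)%:R) * jap2 xi mu `^ (d - nu - j%:R))))%:E)%E.

Lemma total_grade be l ga j : \sum_i kgrade i *+ kidx be l ga j i =
  (l%:Z, (msize ga)%:R, j%:R) :> grade R.
Proof.
have unitE (g : unit -> grade R) : \sum_i g i = g tt by rewrite (big_pred1 tt)// => -[].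
rewrite !big_sumType !unitE /= !ffunE.
rewrite big1 ?add0r; last by move=> i _; rewrite mul0rn.
under eq_bigr do rewrite ffunE.
have -> : \sum_(i < m) ((0, 1, 0) : grade R) *+ ga i = (0, (msize ga)%:R, 0) :> grade R.
  rewrite /msize; elim/big_ind2: _ => [|a a' b b' -> ->|i _].
  - by rewrite mulr0n.
  - by rewrite natrD; congr (_, _, _); rewrite addr0.
  - by elim: (ga i) => [|n IH]; rewrite ?mulr0n// mulrSr IH -natr1; congr (_, _, _); rewrite addr0.
have -> : ((1, 0, 0) : grade R) *+ l = (l%:Z, 0, 0) :> grade R.
  elim: l => [|n IH]; rewrite ?mulr0n// mulrSr IH; congr (_, _, _); rewrite ?addr0//.
  by rewrite -addn1 PoszD.
have -> : ((0, 0, 1) : grade R) *+ j = (0, 0, j%:R) :> grade R.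
  by elim: j => [|n IH]; rewrite ?mulr0n// mulrSr IH -natr1; congr (_, _, _); rewrite addr0.
by congr (_, _, _); rewrite /= ?addr0 ?add0r.
Qed.

Lemma kidxE (al : {ffun kcoord m -> nat}) : exists be l ga j, al = kidx be l ga j.
Proof.
exists [ffun i => al (inl (inl (inl i)))], (al (inl (inl (inr tt)))),
  [ffun i => al (inl (inr i))], (al (inr tt)).
by apply/ffunP => -[[[i|[]]|i]|[]]; rewrite !ffunE.
Qed.

Lemma family_boundP L sigma F : family_bound L sigma F <->
  forall al : {ffun kcoord m -> nat}, kernel_bound nu (d - nu) L sigma
    (0 + \sum_i kgrade i *+ al i) (F al).
Proof.
split=> [H al|H be ga j l l' Ll].
  have [be [l' [ga [j ->]]]] := kidxE al.
  by rewrite add0r total_grade => l Ll; exact: H.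
by have := H (kidx be l' ga j); rewrite add0r total_grade => /(_ l Ll).
Qed.

Lemma family_bound_eq L L' sigma sigma' F F' :
  (forall z, L' z -> L z) -> (forall xi mu, sigma xi mu = sigma' xi mu) ->
  (forall al p, Om p -> F al p = F' al p) ->
  family_bound L sigma F -> family_bound L' sigma' F'.
Proof.
move=> LL ss FF H be ga j l l' /LL Ll; have [C C0 HC] := H be ga j l l' Ll.
exists C => // x xi mu mu0; rewrite -ss.
rewrite -(eq_L2norm (f := fun t => (t ^+ l)%:C * F (kidx be l' ga j) (x, t, xi, mu))) ?HC//.
by move=> t t0; rewrite FF.
Qed.

Lemma family_dilation eps s f F : family f F -> exists F', family (dilation eps s 0 f) F'.
Proof.
move=> dF.
(* For the empty regime the estimates are vacuous, and the invariance under dilations reduces to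
   differentiability. *)
have H (al : {ffun kcoord m -> nat}) : kernel_bound 0 0 (fun=> False) (fun _ _ => 1)
  (0 + \sum_i kgrade i *+ al i) (F al) by [].
have Hf N : CN Om dir kgrade (kernel_bound 0 0 (fun=> False) (fun _ _ => 1)) N 0 f.
  have := CN_family dF H N [ffun=> 0%N]; rewrite add0r big1 ?[X in CN _ _ _ _ _ X]/=.
    by apply: CN_ext => [g u w|p Op]; [exact: kernel_bound_ext|case: dF => F0 _; exact: F0].
  by move=> i _; rewrite ffunE.
have ext := @kernel_bound_ext R m 0 0 (fun=> False) (fun xi mu => 1 * bracket_pow eps s xi mu).
have [F' [dF' _]] := CN_D_family (@kdom_dir R m) ext
  (fun N => @CN_dilation R m 0 0 eps s _ _ N 0 f (fun _ _ => ltr01) (Hf N)).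
by exists F'.
Qed.

Lemma family_bound_dilation L sigma eps s f F f' F' :
  (forall xi mu, 0 < sigma xi mu) -> family f F -> family f' F' ->
  (forall p, Om p -> f' p = dilation eps s 0 f p) ->
  family_bound L sigma F ->
  family_bound L (fun xi mu => sigma xi mu * bracket_pow eps s xi mu) F'.
Proof.
move=> s0 dF dF' ff' /family_boundP H.
have Hf N : CN Om dir kgrade (kernel_bound nu (d - nu) L sigma) N 0 f.
  have := CN_family dF H N [ffun=> 0%N]; rewrite add0r big1.
    by apply: CN_ext => [g u w|p Op]; [exact: kernel_bound_ext|case: dF => F0 _; exact: F0].
  by move=> i _; rewrite ffunE.
have ext := @kernel_bound_ext R m nu (d - nu) L
  (fun xi mu => sigma xi mu * bracket_pow eps s xi mu).
have [F'' [dF'' bF'']] := CN_D_family (@kdom_dir R m) ext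
  (fun N => @CN_dilation R m nu (d - nu) eps s _ _ N 0 f s0 (Hf N)).
(* The estimates hold for the chosen family [F'']; uniqueness of derivatives transfers them to the
   given [F']. *)
apply/family_boundP => al; apply: ext (bF'' al) => p Op.
have dFf' : family f' F''.
  by case: dF'' => F0 DF; split => // q Oq; rewrite F0// ff'.
exact: (D_family_unique (@kdom_dir R m) dFf' dF' al Op).
Qed.

Definition jap_of (eps : bool) (xi : 'rV[R]_m) mu := if eps then jap2 xi mu else jap xi.

Lemma jap_of_gt0 eps xi mu : 0 < jap_of eps xi mu.
Proof. by case: eps; [exact: jap2_gt0|exact: jap_gt0]. Qed.

Lemma bracket_powR eps (p : kvar R m) r : bracket eps p `^ r = jap_of eps p.1.2 p.2 `^ (2 * r).
Proof.
have j0 := ltW (jap_of_gt0 eps p.1.2 p.2).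
rewrite powRrM powR_mulrn//; congr (_ `^ _).
by case: eps {j0}; rewrite /jap_of ?bracket_jap2 ?bracket_jap.
Qed.

Lemma dilation_half eps k x xn xi mu : 0 < xn -> 0 <= mu ->
  dilation eps (2^-1) 0 k (x, xn, xi, mu) =
  (jap_of eps xi mu `^ (- 2^-1))%:C * k (x, xn / jap_of eps xi mu, xi, mu).
Proof.
move=> xn0 mu0; rewrite /dilation /prefactor_exp !bracket_powR /= /dilate bracket_powR /=.
congr ((_ `^ _)%:C * k (_, _ * _, _, _)); first by rewrite addr0; field.
by rewrite mulrN mulfV// powR_inv1// ltW// jap_of_gt0.
Qed.

Lemma dilation_opp_half eps k p : kdom p ->
  dilation eps (- 2^-1) 0 (dilation eps (2^-1) 0 k) p = k p.
Proof.
case: p => -[[x xn] xi] mu [/= xn0 mu0]; have j0 := jap_of_gt0 eps xi mu.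
rewrite [LHS]/dilation /prefactor_exp !bracket_powR /= /dilate bracket_powR /=.
rewrite opprK mulfV// powRr1 ?(ltW j0)// dilation_half ?mulr_gt0// mulfK ?gt_eqF//.
rewrite mulrA -rmorphM /= -powRD; last by apply/implyP => _; rewrite gt_eqF.
by rewrite addr0 (_ : _ + _ = 0) ?powRr0 ?mul1r//; field.
Qed.

Lemma bracket_pow_half eps xi mu :
  bracket_pow eps (2^-1) xi mu = jap_of eps xi mu /\
  bracket_pow eps (- 2^-1) xi mu = (jap_of eps xi mu)^-1.
Proof.
have j0 := ltW (jap_of_gt0 eps xi mu).
by rewrite /bracket_pow !bracket_powR/= mulrN mulfV// powRr1// powR_inv1.
Qed.

(* Substituting x_n -> x_n / <.> normalizes the weight <.>^-1 of each factor x_n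
   to 1. *)
Lemma family_bound_normalize L eps k K F : family k K -> family (dilation eps (2^-1) 0 k) F ->
  family_bound L (fun xi mu => (jap_of eps xi mu)^-1) K <->
  family_bound L (fun _ _ => 1) F.
Proof.
move=> dK dF; split=> H.
  have i0 xi mu : 0 < (jap_of eps xi mu)^-1 by rewrite invr_gt0 jap_of_gt0.
  apply: family_bound_eq (family_bound_dilation i0 dK dF (fun _ _ => erefl) H) => // xi mu.
  by have [-> _] := bracket_pow_half eps xi mu; rewrite mulVf// gt_eqF// jap_of_gt0.
apply: family_bound_eq (family_bound_dilation (eps := eps) (s := - 2^-1)
  (fun _ _ => ltr01) dF dK _ H) => // [xi mu|p Op].
  by have [_ ->] := bracket_pow_half eps xi mu; rewrite mul1r.
by rewrite dilation_opp_half.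
Qed.

(** For l = l' sigma occurs with exponent 0. This is the bridge between the two dilations. *)
Lemma family_bound_diagonal sigma sigma' F :
  family_bound (fun z => z = 0) sigma F -> family_bound (fun z => z = 0) sigma' F.
Proof.
move=> H be ga j l l' ll; have [C C0 HC] := H be ga j l l' ll; exists C => // x xi mu mu0.
have := HC x xi mu mu0; have -> : l = l' by apply/eqP; rewrite -eqz_nat -subr_eq0 ll.
by rewrite subrr !powRr0.
Qed.

Lemma poisson_weight (a b r s e : R) (l l' : nat) : 0 < a -> 0 < b ->
  (a / b) `^ (nu - Num.max 0 (l%:R - l'%:R) - r) * b `^ (d - l%:R + l'%:R - r - s) =
  ((if (l' <= l)%N then a else b)^-1) `^ (l%:R - l'%:R) * (a `^ (nu - r) * b `^ (d - nu - s)).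
Proof.
move=> a0 b0; have iv c z : 0 < c -> c^-1 `^ z = c `^ (- z) :> R.
  by move=> c0; rewrite -powR_inv1 ?ltW// -powRrM mulN1r.
have D c z z' : 0 < c -> c `^ (z + z') = c `^ z * c `^ z' :> R.
  by move=> c0; rewrite powRD//; apply/implyP => _; rewrite gt_eqF.
rewrite powRM ?invr_ge0 ?ltW// !iv//; last by case: ifP.
case: (leqP l' l) => ll.
- have -> : Num.max 0 (l%:R - l'%:R) = l%:R - l'%:R :> R.
    by apply/max_idPr; rewrite subr_ge0 ler_nat.
  rewrite -[LHS]mulrA -D// [RHS]mulrA -D//; congr (_ `^ _ * _ `^ _); ring.
- have -> : Num.max 0 (l%:R - l'%:R) = 0 :> R.
    by apply/max_idPl; rewrite subr_le0 ler_nat ltnW.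
  rewrite -[LHS]mulrA -D// [RHS]mulrCA -D// subr0; congr (_ `^ _ * _ `^ _); ring.
Qed.

End kernel_families.

(** * The two halves of the Poisson estimates and the two symbol spaces *)

Section poisson.
Variables (R : realType) (m : nat) (d nu : R).
Implicit Types (f k : kvar R m -> R[i]) (F K : {ffun kcoord m -> nat} -> kvar R m -> R[i]).
Local Notation Om := (@kdom R m).
Local Notation family := (D_family (E := complex_lcs R) Om (@kdir R m)).
Local Notation nonneg := (fun z : int => 0 <= z).
Local Notation nonpos := (fun z : int => z <= 0).
Local Notation one := (fun (_ : 'rV[R]_m) (_ : R) => 1 : R).
Local Notation inv_jap eps := (fun xi mu => (@jap_of R m eps xi mu)^-1).
Local Notation bound := (@family_bound R m d nu).

Lemma poisson_symbol_kernelP k K : family k K ->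
  poisson_symbol_kernel (d + 2^-1) nu k <->
  bound nonneg (inv_jap false) K /\ bound nonpos (inv_jap true) K.
Proof.
move=> dK; rewrite /poisson_symbol_kernel addrK; split.
  move=> [K' [dK' H]].
  have KK al p : Om p -> K' al p = K al p := D_family_unique (@kdom_dir R m) dK' dK al (p := p).
  have E L sigma := @family_bound_eq R m d nu L L sigma sigma K' K (fun _ => id)
    (fun _ _ => erefl) KK.
  split; apply: E => be ga j l l' Ll; have [C C0 HC] := H be ga j l l';
    exists C => // x xi mu mu0; have := HC x xi mu mu0;
    rewrite poisson_weight ?jap_gt0 ?jap2_gt0//=.
  - by have -> : (l' <= l)%N by move: Ll; rewrite subr_ge0 lez_nat.
  - have ll : (l <= l')%N by move: Ll; rewrite subr_le0 lez_nat.
    (* The diagonal belongs to both regimes; there both weights are 1. *)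
    case: ifP => // l'l; have -> : l = l' by apply/eqP; rewrite eqn_leq ll l'l.
    by rewrite subrr !powRr0.
move=> [H1 H2]; exists K; split=> // be ga j l l'.
case: (leqP l' l) => ll.
- have Ll : 0 <= l%:Z - l'%:Z by rewrite subr_ge0 lez_nat.
  have [C C0 HC] := H1 be ga j l l' Ll; exists C => // x xi mu mu0.
  by have := HC x xi mu mu0; rewrite poisson_weight ?jap_gt0 ?jap2_gt0//= ll.
- have Ll : l%:Z - l'%:Z <= 0 by rewrite subr_le0 lez_nat ltnW.
  have [C C0 HC] := H2 be ga j l l' Ll; exists C => // x xi mu mu0.
  by have := HC x xi mu mu0; rewrite poisson_weight ?jap_gt0 ?jap2_gt0//= leqNgt ll.
Qed.

Definition S0_weight (q : S0_idx) : nat * nat := val q.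
Definition Hinfty_weight (l' : nat) : nat * nat := (0, l')%N.

Lemma symbol_Hinfty (a : pvar R m -> R -> R[i]) :
  symbol d nu (E := Hinfty R) a <-> symbol d nu (E := weighted_lcs R Hinfty_weight) a.
Proof.
rewrite /Hinfty /weighted_lcs; have -> // : @Hinfty_sn R = weighted_sn Hinfty_weight.
apply/funext => l; apply/funext => v; apply: eq_L2norm => t _.
by rewrite expr0 mul1r.
Qed.

Lemma family_bound_S0 F : bound nonneg one F <-> slice_bounds d nu S0_weight F.
Proof.
split=> H.
  move=> be ga j [[l l'] /= ll]; have Ll : 0 <= l%:Z - l'%:Z by rewrite subr_ge0 lez_nat.
  have [C C0 HC] := H be ga j l l' Ll; exists C => // x xi mu mu0.
  by have := HC x xi mu mu0; rewrite powR1 mul1r.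
move=> be ga j l l' Ll; have ll : (l' <= l)%N by move: Ll; rewrite /= subr_ge0 lez_nat.
have [C C0 HC] := H be ga j (exist _ (l, l') ll); exists C => // x xi mu mu0.
by rewrite powR1 mul1r; exact: HC.
Qed.

Lemma family_bound_Hinfty F : bound nonpos one F -> slice_bounds d nu Hinfty_weight F.
Proof.
move=> H be ga j l'; have Ll : 0%:Z - l'%:Z <= 0 by rewrite sub0r oppr_le0.
have [C C0 HC] := H be ga j 0%N l' Ll; exists C => // x xi mu mu0.
by have := HC x xi mu mu0; rewrite powR1 mul1r.
Qed.

(* For l <= l' the estimate follows from t^l <= 1 + t^l'. *)
Lemma family_bound_interpolate f F : family f F ->
  bound (fun z => z = 0) one F -> slice_bounds d nu Hinfty_weight F ->
  bound nonpos one F.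
Proof.
move=> [_ dF] H1 H2 be ga j l l' Ll.
have ll : (l <= l')%N by move: Ll; rewrite /= subr_le0 lez_nat.
have [C C0 HC] := H1 be ga j l' l' (subrr _); have [C' C'0 HC'] := H2 be ga j l'.
exists (C + C'); first exact: addr_ge0.
move=> x xi mu mu0; have [_ cF _] := dF (kidx be l' ga j).
set u := (fun t : R => F (kidx be l' ga j) (x, t, xi, mu)).
have mu_ n : measC (fun t => (t ^+ n)%:C * u t) := measC_slice x xi n cF mu0.
have n1 t : Normc.normc (1 + t%:C) = `|1 + t| :> R by rewrite -normc_real rmorphD.
apply: (@le_trans _ _ (L2norm (fun t => (t ^+ l')%:C * u t + (t ^+ 0)%:C * u t))).
  apply: le_L2norm; [exact: mu_|by apply: measC_add; exact: mu_|move=> t t0].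
  rewrite -mulrDl addrC expr0 !Normc.normcM; apply: ler_wpM2r; first exact: normc_ge0.
  rewrite n1 normc_real !ger0_norm ?addr_ge0 ?exprn_ge0 ?(ltW t0)//.
  have [t1|t1] := leP t 1.
    by apply: ler_wpDr; [exact: exprn_ge0 (ltW t0)|exact: exprn_ile1 (ltW t0) t1].
  by apply: ler_wpDl => //; rewrite ler_eXn2l.
apply: (le_trans (L2normD (mu_ l') (mu_ 0%N))); rewrite mulrDl EFinD powR1 mul1r; apply: leeD.
- by have := HC x xi mu mu0; rewrite subrr powRr0 mul1r.
- exact: HC'.
Qed.

(** The factorization of k solved for a by the substitution x_n = t / <.>, a bijection of (0,
    +oo). *)
Lemma dilation_half_eq eps k (a : pvar R m -> R -> R[i]) :
  (forall x xi xn mu, 0 < xn -> 0 <= mu -> k (x, xn, xi, mu) =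
    (jap_of eps xi mu `^ 2^-1)%:C * a (x, xi, mu) (jap_of eps xi mu * xn)) <->
  (forall p t, pdom p -> 0 < t -> a p t = dilation eps (2^-1) 0 k (kpoint p t)).
Proof.
have j0 := @jap_of_gt0 R m eps.
have E (xi : 'rV[R]_m) mu : (jap_of eps xi mu `^ (- 2^-1))%:C * (jap_of eps xi mu `^ 2^-1)%:C = 1 :> R[i].
  rewrite -rmorphM /= -powRD; first by rewrite addNr powRr0.
  by apply/implyP => _; rewrite gt_eqF.
split=> H.
  move=> [[x xi] mu] t mu0 t0; rewrite /kpoint /= dilation_half// H ?divr_gt0//.
  by rewrite mulrA E mul1r mulrC divfK// gt_eqF.
move=> x xi xn mu xn0 mu0; rewrite H ?mulr_gt0// /kpoint /= dilation_half ?mulr_gt0//.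
by rewrite mulrA [X in X * _]mulrC E mul1r mulrAC divff ?mul1r// gt_eqF.
Qed.

End poisson.

Theorem theorem4p3 (R : realType) (n : nat) (hn : (0 < n)%N) (d nu : R)
    (k : kvar R n.-1 -> R[i])
    (hk : smooth (E := complex_lcs R) (@kdom R n.-1) (@kdir R n.-1) k) :
  poisson_symbol_kernel (d + 2^-1) nu k <->
  exists k1 k2 : pvar R n.-1 -> R -> R[i],
    [/\ symbol d nu (E := S0 R) k1,
        symbol d nu (E := Hinfty R) k2 &
        forall (x xi : 'rV[R]_(n.-1)) (xn mu : R), 0 < xn -> 0 <= mu ->
          k (x, xn, xi, mu)
            = (jap xi `^ 2^-1)%:C * k1 (x, xi, mu) (jap xi * xn) /\
          k (x, xn, xi, mu)
            = (jap2 xi mu `^ 2^-1)%:C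
              * k2 (x, xi, mu) (jap2 xi mu * xn)].
Proof.
have [K dK] := hk; rewrite (poisson_symbol_kernelP d nu dK).
have [F1 dF1] := family_dilation false (2^-1) dK.
have [F2 dF2] := family_dilation true (2^-1) dK.
have [F10 _] := dF1; have [F20 _] := dF2.
have N1 L := family_bound_normalize d nu L dK dF1.
have N2 L := family_bound_normalize d nu L dK dF2.
split.
  move=> [/N1/family_bound_S0 H1 /N2/family_bound_Hinfty H2].
  exists (slice_family F1 [ffun=> 0%N]), (slice_family F2 [ffun=> 0%N]); split.
  - exact: (symbol_of_bounds dF1 H1).
  - exact/symbol_Hinfty/(symbol_of_bounds dF2 H2).
  - move=> x xi xn mu xn0 mu0; split.
    + apply: ((dilation_half_eq false k _).2 _ x xi xn mu xn0 mu0) => p t pp t0.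
      by rewrite /slice_family kindex0 F10//; exact: kdom_kpoint.
    + apply: ((dilation_half_eq true k _).2 _ x xi xn mu xn0 mu0) => p t pp t0.
      by rewrite /slice_family kindex0 F20//; exact: kdom_kpoint.
move=> [k1 [k2 [S1 /symbol_Hinfty S2 kk]]].
have k1f := (dilation_half_eq false k k1).1 (fun x xi xn mu a b => (kk x xi xn mu a b).1).
have k2f := (dilation_half_eq true k k2).1 (fun x xi xn mu a b => (kk x xi xn mu a b).2).
have B1 := bounds_of_symbol (q0 := exist _ (0, 0)%N isT : S0_idx)  (wt := S0_weight) dF1 erefl k1f S1.
have B2 := bounds_of_symbol (q0 := 0%N) dF2 erefl k2f S2.
have /N1 H1 := (family_bound_S0 d nu F1).2 B1.
(* The estimates for the S^0-valued symbol, brought back to k and restricted to l = l', pass to the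
   dilation by <xi',mu> and supply the diagonal needed for the interpolation. *)
split=> //; apply/N2/(family_bound_interpolate dF2 _ B2)/N2.
apply: family_bound_diagonal (family_bound_eq _ (fun _ _ => erefl) (fun _ _ _ => erefl) H1).
by move=> z ->.
Qed.
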